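(* Let $f(D,\alpha)$, $\alpha>0$, be an elliptic pseudo-differential operator, with $f(\xi)\in\mathbb{Z}_p[\xi_1,\ldots,\xi_n]$ elliptic of degree $d$, and let $Z(x,t)=\int_{\mathbb{Q}_p^n}\Psi(x\cdot\xi)e^{-t|f(\xi)|_p^\alpha}d^n\xi$ for $t>0$. If $\varphi\in L^2(\mathbb{Q}_p^n)\cap C_b(\mathbb{Q}_p^n,\mathbb{C})$, then the Cauchy problem $$\begin{cases}\dfrac{\partial u(x,t)}{\partial t}+(f(D,\alpha)u)(x,t)=0, & x\in\mathbb{Q}_p^n,\ t>0,\\[2mm] u(x,0)=\varphi(x),\end{cases}$$ has a classical solution $$u(x,t)=\int_{\mathbb{Q}_p^n}Z(\eta,t)\,\varphi(x-\eta)\,d^n\eta,$$ which belongs to $\widetilde{H}_\infty$ for every fixed $t>0$.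
   Context: $p$ is a prime, $|\cdot|_p$ the $p$-adic absolute value on $\mathbb{Q}_p$, and $0\in\mathbb{N}$. A polynomial $f(\xi)$ is elliptic of degree $d$ if it is non-constant, homogeneous of degree $d$, and $f(\xi)=0\Leftrightarrow\xi=0$, i.e. it is quasielliptic of degree $d$ with respect to $\boldsymbol{w}=(1,\ldots,1)$; by convention its coefficients are in $\mathbb{Z}_p$. Set $\Xi(\xi)=\sum_{i=1}^n|\xi_i|_p^{d}$. $C_b(\mathbb{Q}_p^n,\mathbb{C})$ is the space of continuous bounded functions from $\mathbb{Q}_p^n$ to $\mathbb{C}$. $\Psi:\mathbb{Q}_p\to\mathbb{C}^\times$ is the standard additive character, $(\mathcal{F}\phi)(\xi)=\int_{\mathbb{Q}_p^n}\Psi(-x\cdot\xi)\phi(x)\,d^nx$ (extended to $L^2$), with $d^nx$ the Haar measure normalized by $\mathrm{vol}(\mathbb{Z}_p^n)=1$. The operator is $f(D,\alpha)\phi=\mathcal{F}^{-1}(|f|_p^\alpha\mathcal{F}(\phi))$, acting in the $x$ variable, with domain $\{\phi\in L^2(\mathbb{Q}_p^n):|f|_p^\alpha\mathcal{F}\phi\in L^2(\mathbb{Q}_p^n)\}$. A classical solution is a function $u$, continuous on $\mathbb{Q}_p^n\times[0,\infty)$ with $u(x,0)=\varphi(x)$, such that for $t>0$ it is continuously differentiable in $t$, $u(\cdot,t)$ lies in the domain of $f(D,\alpha)$, and the equation holds. $S$ is the space of Schwartz--Bruhat functions on $\mathbb{Q}_p^n$; for $\beta\geq0$ put $\|\phi\|_\beta^2=\int_{\mathbb{Q}_p^n}\Xi^{2\beta}(\xi)|\mathcal{F}(\phi)(\xi)|^2d^n\xi$;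 $\Phi=\{\phi\in S:\mathcal{F}(\phi)(0)=0\}$; $\widetilde{H}_\beta$ is the completion of $(\Phi,\|\cdot\|_\beta)$, identified via $\mathcal{F}$ with $L^2(\mathbb{Q}_p^n,\Xi^{2\beta}(\xi)d^n\xi)$ (so $\widetilde{H}_0=L^2(\mathbb{Q}_p^n)$). $\widetilde{H}_\infty$ is the completion of $\bigcap_{\beta\in\mathbb{N}}\widetilde{H}_\beta$ for the metric $\rho(x,y)=\max_{\beta\in\mathbb{N}}\left\{c_\beta\frac{\|x-y\|_\beta}{1+\|x-y\|_\beta}\right\}$, with $\{c_\beta\}$ a fixed null-sequence of positive numbers; it equals $(\bigcap_{\beta\in\mathbb{N}}\widetilde{H}_\beta,\rho)$. *)

(* Defs.v *)
From HB Require Import structures.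
From mathcomp Require Import all_boot all_order all_algebra.
From mathcomp Require Import generic_quotient ring_quotient complex.
From mathcomp Require Import all_classical all_reals all_analysis.
From mathcomp Require mpoly.

Set Implicit Arguments.
Unset Strict Implicit.
Unset Printing Implicit Defensive.

Import Order.TTheory GRing.Theory Num.Theory numFieldNormedType.Exports.

Local Open Scope classical_set_scope.
Local Open Scope ring_scope.
Local Open Scope quotient_scope.
Local Open Scope complex_scope.

(* Q_p is the quotient of the ring of p-adic Cauchy sequences of rationals by
   the ideal of null sequences. *)

Section RationalAbs.
Variable p : nat.

Definition ratp_abs (q : rat) : rat :=
  if q == 0 then 0
  else p%:R ^ ((logn p `|denq q|)%:Z - (logn p `|numq q|)%:Z).

Lemma ratp_abs0 : ratp_abs 0 = 0.
Proof. by rewrite /ratp_abs eqxx. Qed.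

Lemma ratp_absN q : ratp_abs (- q) = ratp_abs q.
Proof. by rewrite /ratp_abs oppr_eq0 denqN numqN abszN. Qed.

Hypothesis p_pr : prime p.

Let p_gt0 : 0 < p%:R :> rat.
Proof. by rewrite ltr0n prime_gt0. Qed.

Let p_neq0 : p%:R != 0 :> rat.
Proof. by rewrite lt0r_neq0. Qed.

Lemma ratp_abs_gt0 q : (0 < ratp_abs q) = (q != 0).
Proof.
by rewrite /ratp_abs; case: eqP => _ /=; rewrite ?ltxx// exprz_gt0.
Qed.

Lemma ratp_abs_ge0 q : 0 <= ratp_abs q.
Proof.
by have [->|q0] := eqVneq q 0; rewrite ?ratp_abs0// ltW// ratp_abs_gt0.
Qed.

Lemma ratp_abs_eq0 q : (ratp_abs q == 0) = (q == 0).
Proof.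
apply/idP/idP => [|/eqP->]; last by rewrite ratp_abs0.
by apply: contraLR; rewrite -ratp_abs_gt0 => /lt0r_neq0.
Qed.

Lemma ratp_abs1 : ratp_abs 1 = 1.
Proof. by rewrite /ratp_abs oner_eq0 (denq_int 1) (numq_int 1) subrr expr0z. Qed.

Lemma ratp_abs_frac (a b : int) : a != 0 -> b != 0 ->
  ratp_abs (a%:~R / b%:~R) = p%:R ^ ((logn p `|b|)%:Z - (logn p `|a|)%:Z).
Proof.
move=> a0 b0; set q := (_ / _).
have q0 : q != 0 by rewrite mulf_neq0 ?invr_eq0 ?intr_eq0.
rewrite /ratp_abs (negbTE q0).
have nq0 : numq q != 0 by rewrite numq_eq0.
have dq0 : denq q != 0 by rewrite denq_neq0.
have E : (a * denq q = numq q * b)%R.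
  apply: (intr_inj (R := rat)); rewrite !rmorphM/=.
  have -> : a%:~R = q * b%:~R by rewrite mulfVK// intr_eq0.
  by rewrite -mulrA [b%:~R * _]mulrC mulrA -{1}(divq_num_den q) mulfVK ?intr_eq0.
have : (logn p (`|a| * `|denq q|) = logn p (`|numq q| * `|b|))%N.
  by rewrite -!abszM E.
rewrite !lognM ?absz_gt0// => EE.
congr (_ ^ _); apply/eqP; rewrite subr_eq addrAC eq_sym subr_eq.
by rewrite -!PoszD [X in _ == Posz X]addnC EE addnC.
Qed.

Lemma ratp_absM q r : ratp_abs (q * r) = ratp_abs q * ratp_abs r.
Proof.
have [->|q0] := eqVneq q 0; first by rewrite mul0r ratp_abs0 mul0r.
have [->|r0] := eqVneq r 0; first by rewrite mulr0 ratp_abs0 mulr0.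
rewrite -{1}(divq_num_den q) -{1}(divq_num_den r) mulf_div -!rmorphM/=.
rewrite ratp_abs_frac ?mulf_neq0 ?numq_eq0 ?denq_neq0//.
rewrite !abszM !lognM ?absz_gt0 ?numq_eq0 ?denq_neq0//.
rewrite /ratp_abs (negbTE q0) (negbTE r0) -expfzDr//.
by congr (_ ^ _); rewrite !PoszD opprD addrACA.
Qed.

Lemma ratp_absV q : ratp_abs q^-1 = (ratp_abs q)^-1.
Proof.
have [->|q0] := eqVneq q 0; first by rewrite invr0 ratp_abs0.
apply: (mulIf (x := ratp_abs q)); first by rewrite ratp_abs_eq0.
by rewrite -ratp_absM !mulVf ?ratp_abs1// ratp_abs_eq0.
Qed.

Lemma ratp_abs_int (a : int) : a != 0 ->
  ratp_abs a%:~R = p%:R ^ (- (logn p `|a|)%:Z).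
Proof.
by move=> a0; rewrite /ratp_abs intr_eq0 (negbTE a0) denq_int numq_int logn1 sub0r.
Qed.

Lemma ratp_abs_int_le1 (a : int) : ratp_abs a%:~R <= 1.
Proof.
have [->|a0] := eqVneq a 0; first by rewrite ratp_abs0.
rewrite ratp_abs_int// -exprnN invf_le1 ?exprn_gt0// exprn_ege1// ler1n.
exact: prime_gt0.
Qed.

Lemma ratp_absD1 q : ratp_abs q <= 1 -> ratp_abs (1 + q) <= 1.
Proof.
have [->|q0] := eqVneq q 0; first by rewrite addr0 ratp_abs1.
rewrite {1}/ratp_abs (negbTE q0) => h.
have pd : ~~ (p %| `|denq q|)%N.
  apply/negP => pd; have pn : ~~ (p %| `|numq q|)%N.
    apply/negP => pn; have := coprime_num_den q.
    move=> /eqP c; have : (p %| 1)%N by rewrite -c dvdn_gcd pn pd.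
    by rewrite dvdn1 => /eqP p1; move: p_pr; rewrite p1.
  move: h; rewrite (lognE p `|numq q|) (negbTE pn) !andbF subr0.
  apply/negP; rewrite -ltNge exprn_egt1 ?ltr1n ?prime_gt1//.
  by rewrite -lt0n logn_gt0 mem_primes p_pr absz_gt0 denq_neq0.
have -> : 1 + q = (denq q + numq q)%:~R / (denq q)%:~R.
  by rewrite rmorphD/= mulrDl divff ?divq_num_den// intr_eq0 denq_neq0.
rewrite ratp_absM ratp_absV.
rewrite [ratp_abs (denq q)%:~R]ratp_abs_int ?denq_neq0//.
rewrite (lognE p `|denq q|) (negbTE pd) !andbF expr0z.
by rewrite invr1 mulr1 ratp_abs_int_le1.
Qed.

Lemma ratp_absD q r : ratp_abs (q + r) <= Num.max (ratp_abs q) (ratp_abs r).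
Proof.
wlog le_rq : q r / ratp_abs r <= ratp_abs q => [hw|].
  have /orP[/hw//|/hw] := le_total (ratp_abs r) (ratp_abs q).
  by rewrite addrC maxC.
rewrite (max_idPl le_rq).
have [q0|q0] := eqVneq q 0.
  move: le_rq; rewrite q0 ratp_abs0 add0r; exact: le_trans.
have -> : q + r = q * (1 + r / q) by rewrite mulrDr mulr1 mulrC mulfVK.
rewrite ratp_absM -[leRHS]mulr1 ler_wpM2l ?ratp_abs_ge0//.
by rewrite ratp_absD1// ratp_absM ratp_absV ler_pdivrMr ?mul1r// ratp_abs_gt0.
Qed.

End RationalAbs.

Section CauchySequences.
Variables (p : nat) (p_pr : prime p).
Implicit Types s t : nat -> rat.

Definition padic_cauchy (_ : prime p) : {pred (nat -> rat)} := fun s =>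
  `[< forall e : rat, 0 < e -> exists N, forall i j, (N <= i)%N -> (N <= j)%N ->
      ratp_abs p (s i - s j) < e >].

Definition padic_null s : Prop :=
  forall e : rat, 0 < e -> exists N, forall i, (N <= i)%N -> ratp_abs p (s i) < e.

Let absD_lt q r e : ratp_abs p q < e -> ratp_abs p r < e ->
  ratp_abs p (q + r) < e.
Proof.
by move=> qe re; rewrite (le_lt_trans (ratp_absD p_pr _ _))// gt_max qe re.
Qed.

Lemma padic_cauchy_bounded s : s \in padic_cauchy p_pr ->
  exists2 M : rat, 0 < M & exists N, forall i, (N <= i)%N -> ratp_abs p (s i) < M.
Proof.
move=> /asboolP/(_ 1 ltr01)[N sN]; exists (1 + ratp_abs p (s N)).
  by rewrite ltr_pwDl// ratp_abs_ge0.
exists N => i Ni; rewrite -(subrK (s N) (s i)) absD_lt//.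
  by rewrite (lt_le_trans (sN _ _ Ni (leqnn N)))// lerDl ratp_abs_ge0.
by rewrite ltrDr.
Qed.

Lemma padic_cauchy_cst (q : rat) : (fun=> q) \in padic_cauchy p_pr.
Proof.
by apply/asboolP => e e0; exists 0%N => i j _ _; rewrite subrr ratp_abs0.
Qed.

Lemma padic_cauchy_subring : GRing.subring_closed (padic_cauchy p_pr).
Proof.
split.
- exact: padic_cauchy_cst.
- move=> s t /asboolP cs /asboolP ct; apply/asboolP => e e0.
  have [N sN] := cs _ e0; have [M tM] := ct _ e0.
  exists (maxn N M) => i j; rewrite !geq_max => /andP[Ni Mi] /andP[Nj Mj].
  have -> : (s - t) i - (s - t) j = (s i - s j) + - (t i - t j).
    by rewrite /= !opprD !opprK addrACA.
  by rewrite absD_lt// ?ratp_absN ?sN ?tM.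
- move=> s t cs ct; apply/asboolP => e e0.
  have [A A0 [NA sA]] := padic_cauchy_bounded cs.
  have [B B0 [NB tB]] := padic_cauchy_bounded ct.
  move/asboolP : cs => /(_ (e / B))[|N sN]; first by rewrite divr_gt0.
  move/asboolP : ct => /(_ (e / A))[|M tM]; first by rewrite divr_gt0.
  exists (maxn (maxn N M) (maxn NA NB)) => i j.
  rewrite !geq_max => /andP[/andP[Ni Mi] /andP[Ai Bi]] /andP[/andP[Nj Mj] /andP[Aj Bj]].
  have -> : (s * t) i - (s * t) j = (s i - s j) * t i + s j * (t i - t j).
    by rewrite /= mulrBl mulrBr addrA subrK.
  rewrite absD_lt// ratp_absM//.
    rewrite -[ltRHS](divfK (lt0r_neq0 B0)) ltr_pM ?ratp_abs_ge0//.
      exact: sN.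
    exact: tB.
  rewrite mulrC -[ltRHS](divfK (lt0r_neq0 A0)) ltr_pM ?ratp_abs_ge0//.
    exact: tM.
  exact: sA.
Qed.

HB.instance Definition _ :=
  GRing.isSubringClosed.Build _ (padic_cauchy p_pr) padic_cauchy_subring.

Lemma padic_nonnull s : s \in padic_cauchy p_pr -> ~ padic_null s ->
  exists2 c : rat, 0 < c & exists N, forall i, (N <= i)%N -> ratp_abs p (s i) = c.
Proof.
move=> /asboolP cs /existsNP[e /not_implyP[e0 /forallNP ns]].
have [N sN] := cs _ e0.
have /existsNP[k /not_implyP[Nk /negP]] := ns N; rewrite -leNgt => ek.
exists (ratp_abs p (s k)); first exact: lt_le_trans ek.
exists N => i Ni; apply/eqP; rewrite eq_le; apply/andP; split.
  rewrite -(subrK (s k) (s i)) (le_trans (ratp_absD p_pr _ _))//.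
  by rewrite ge_max lexx andbT (le_trans _ ek)// ltW// sN.
rewrite leNgt; apply/negP => ik.
have : ratp_abs p (s k) < ratp_abs p (s k).
  rewrite -{1}(subrK (s i) (s k)) absD_lt//.
  by rewrite (lt_le_trans _ ek)// sN.
by rewrite ltxx.
Qed.

End CauchySequences.

Definition padic_seq (p : nat) (p_pr : prime p) :=
  {s : nat -> rat | s \in padic_cauchy p_pr}.

Section PadicSeq.
Variables (p : nat) (p_pr : prime p).
Local Notation padic_seq := (padic_seq p_pr).

HB.instance Definition _ := SubType.on padic_seq.
HB.instance Definition _ := Choice.on padic_seq.
HB.instance Definition _ := [SubChoice_isSubComNzRing of padic_seq by <:].

Definition padic_null_ideal : {pred padic_seq} :=
  fun s => `[< padic_null p (val s) >].

Lemma padic_null_idealr_closed : idealr_closed padic_null_ideal.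
Proof.
split.
- by apply/asboolP => e e0; exists 0%N => i _; rewrite ratp_abs0.
- apply/negP => /asboolP/(_ 1 ltr01)[N /(_ N (leqnn N))].
  by rewrite ratp_abs1 ltxx.
- move=> a u v /asboolP un /asboolP vn; apply/asboolP => e e0.
  have [A A0 [NA aA]] := padic_cauchy_bounded (valP a).
  have [|N uN] := un (e / A); first by rewrite divr_gt0.
  have [M vM] := vn _ e0.
  exists (maxn (maxn N M) NA) => i.
  rewrite !geq_max => /andP[/andP[Ni Mi] Ai] /=.
  rewrite (le_lt_trans (ratp_absD p_pr _ _))// gt_max vM// andbT ratp_absM//.
  rewrite mulrC -[ltRHS](divfK (lt0r_neq0 A0)) ltr_pM ?ratp_abs_ge0//.
    exact: uN.
  exact: aA.
Qed.

HB.instance Definition _ :=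
  isIdealr.Build padic_seq padic_null_ideal padic_null_idealr_closed.

Definition Qp := {ideal_quot (padic_null_ideal : idealr padic_seq)}.

HB.instance Definition _ := GRing.ComNzRing.on Qp.
HB.instance Definition _ := NzRingQuotient.on Qp.

Implicit Types (x y : Qp) (s t : padic_seq).

Lemma padic_null_pi s : padic_null p (val s) <-> \pi_Qp s = 0.
Proof.
have -> : (0 : Qp) = \pi_Qp 0 by rewrite pi_zeror.
split=> [sn|/eqP].
  by apply/eqP; rewrite -Quotient.idealrBE subr0; apply/asboolP.
by rewrite -Quotient.idealrBE subr0 => /asboolP.
Qed.

Definition Qp_of_seq (s : nat -> rat) : Qp :=
  \pi_Qp (insubd (0 : padic_seq) s : padic_seq).

Definition Qp_inv x : Qp :=
  if x == 0 then 0 else Qp_of_seq (fun k => (val (repr x) k)^-1).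

Lemma Qp_mulVf x : x != 0 -> Qp_inv x * x = 1.
Proof.
move=> x0; rewrite /Qp_inv (negbTE x0) /Qp_of_seq.
set s := repr x; have xs : x = \pi_Qp s by rewrite reprK.
have [|c c0 [N sc]] := padic_nonnull (valP s).
  by move/padic_null_pi; rewrite -xs => /eqP; rewrite (negbTE x0).
have s0 i : (N <= i)%N -> val s i != 0.
  by move=> Ni; rewrite -(ratp_abs_gt0 p_pr) sc.
have cV : (fun k => (val s k)^-1) \in padic_cauchy p_pr.
  apply/asboolP => e e0; have /asboolP/(_ (e * (c * c))) := valP s.
  rewrite !mulr_gt0// => /(_ isT)[M sM].
  exists (maxn N M) => i j; rewrite !geq_max => /andP[Ni Mi] /andP[Nj Mj].
  have -> : (val s i)^-1 - (val s j)^-1 =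
      (val s j - val s i) * ((val s i)^-1 * (val s j)^-1).
    by rewrite mulrBl mulrCA divff ?s0// mulr1 mulrA divff ?s0// mul1r.
  rewrite !ratp_absM// !ratp_absV// !sc// -invfM ltr_pdivrMr ?mulr_gt0//.
  exact: sM.
rewrite [in X in _ * X]xs -pi_mulr -pi_oner.
apply/eqP; rewrite -Quotient.idealrBE; apply/asboolP => e e0.
exists N => i Ni /=.
have -> : val (insubd (0 : padic_seq) (fun k => (val s k)^-1)) = (fun k => (val s k)^-1).
  by rewrite insubdK.
rewrite -[X in ratp_abs p X]/((val s i)^-1 * val s i - 1).
by rewrite mulVf ?s0// subrr ratp_abs0.
Qed.

Lemma Qp_inv0 : Qp_inv 0 = 0.
Proof. by rewrite /Qp_inv eqxx. Qed.

HB.instance Definition _ := GRing.ComNzRing_isField.Build Qp Qp_mulVf Qp_inv0.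

Definition padic_abs x : rat :=
  lim ((ratp_abs p (val (repr x) k) : rat^o) @[k --> \oo]).

Lemma padic_abs0 : padic_abs 0 = 0.
Proof.
have /padic_null_pi n0 : \pi_Qp (repr (0 : Qp)) = 0 by rewrite reprK.
apply: (@cvg_lim rat^o); first exact: norm_hausdorff.
apply/cvgrPdist_lt => /= e e0; have [N sN] := n0 _ e0.
exists N => // i /= Ni; rewrite sub0r normrN ger0_norm ?ratp_abs_ge0//.
exact: sN.
Qed.

Lemma padic_abs_pi s : \pi_Qp s != 0 ->
  exists N, forall i, (N <= i)%N -> ratp_abs p (val s i) = padic_abs (\pi_Qp s).
Proof.
set x := \pi_Qp s => x0; set t := repr x.
have xt : \pi_Qp t = x by rewrite reprK.
have [|c c0 [N tc]] := padic_nonnull (valP t).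
  by move/padic_null_pi; rewrite xt => /eqP; rewrite (negbTE x0).
have -> : padic_abs x = c.
  apply: (@norm_lim_near_cst rat rat^o) => //.
  by exists N => // i /= Ni; exact: tc.
have : t == s %[mod Qp] by rewrite xt.
rewrite -Quotient.idealrBE => /asboolP/(_ _ c0)[M tsc].
exists (maxn N M) => i; rewrite geq_max => /andP[Ni Mi].
have ti := tc _ Ni; have tsi : ratp_abs p (val t i - val s i) < c by exact: tsc.
apply/eqP; rewrite eq_le; apply/andP; split.
  have -> : val s i = val t i + - (val t i - val s i) by rewrite opprB addrCA subrr addr0.
  by rewrite (le_trans (ratp_absD p_pr _ _))// ratp_absN ti ge_max lexx/= ltW.
rewrite leNgt; apply/negP => sc.
have : ratp_abs p (val t i) < c.
  rewrite -(subrK (val s i) (val t i)).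
  by rewrite (le_lt_trans (ratp_absD p_pr _ _))// gt_max sc tsi.
by rewrite ti ltxx.
Qed.

Lemma padic_abs_repr x : x != 0 ->
  exists N, forall i, (N <= i)%N -> ratp_abs p (val (repr x) i) = padic_abs x.
Proof. by move=> x0; have := @padic_abs_pi (repr x); rewrite reprK; apply. Qed.

Lemma padic_abs_gt0 x : x != 0 -> 0 < padic_abs x.
Proof.
move=> x0; have [|c c0 [N sc]] := padic_nonnull (valP (repr x)).
  by move/padic_null_pi; rewrite reprK => /eqP; rewrite (negbTE x0).
have [M sM] := padic_abs_repr x0.
by rewrite -(sM (maxn N M)) ?leq_maxr// sc// leq_maxl.
Qed.

Lemma padic_abs_ge0 x : 0 <= padic_abs x.
Proof.
by have [->|/padic_abs_gt0/ltW//] := eqVneq x 0; rewrite padic_abs0.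
Qed.

Lemma padic_abs_eq0 x : padic_abs x = 0 -> x = 0.
Proof.
by move=> x0; apply/eqP; apply: contraT => /padic_abs_gt0; rewrite x0 ltxx.
Qed.

Lemma padic_absM x y : padic_abs (x * y) = padic_abs x * padic_abs y.
Proof.
have [->|x0] := eqVneq x 0; first by rewrite mul0r padic_abs0 mul0r.
have [->|y0] := eqVneq y 0; first by rewrite mulr0 padic_abs0 mulr0.
have xyE : x * y = \pi_Qp (repr x * repr y) by rewrite pi_mulr !reprK.
have [|N xyN] := @padic_abs_pi (repr x * repr y).
  by rewrite -xyE mulf_neq0.
have [M xM] := padic_abs_repr x0; have [K yK] := padic_abs_repr y0.
pose i := maxn N (maxn M K); rewrite xyE -(xyN i) ?leq_maxl//.
by rewrite ratp_absM// xM ?yK// /i ?leq_max ?leqnn ?orbT.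
Qed.

Lemma padic_absD x y : padic_abs (x + y) <= Num.max (padic_abs x) (padic_abs y).
Proof.
have [->|x0] := eqVneq x 0; first by rewrite add0r le_max lexx orbT.
have [->|y0] := eqVneq y 0; first by rewrite addr0 le_max lexx.
have [->|xy0] := eqVneq (x + y) 0.
  by rewrite padic_abs0 le_max padic_abs_ge0.
have xyE : x + y = \pi_Qp (repr x + repr y) by rewrite pi_addr !reprK.
have [|N xyN] := @padic_abs_pi (repr x + repr y); first by rewrite -xyE.
have [M xM] := padic_abs_repr x0; have [K yK] := padic_abs_repr y0.
pose i := maxn N (maxn M K); rewrite xyE -(xyN i) ?leq_maxl//.
rewrite -(xM i) -?(yK i)/i ?leq_max ?leqnn ?orbT//.
exact: ratp_absD.
Qed.

Let cst_seq (q : rat) : padic_seq := exist _ (fun=> q) (padic_cauchy_cst p_pr q).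

Let cst_seq_int (m : int) : cst_seq m%:~R = m%:~R.
Proof.
have cstN q : cst_seq (- q) = - cst_seq q by exact/val_inj.
have cstD q r : cst_seq (q + r) = cst_seq q + cst_seq r by exact/val_inj.
have cst_nat k : cst_seq k%:R = k%:R.
  elim: k => [|k IH]; first exact/val_inj.
  by rewrite !mulrSr cstD IH; congr (_ + _); exact/val_inj.
by case: m => k; rewrite ?NegzE ?rmorphN/= -!pmulrn ?cstN cst_nat.
Qed.

Lemma padic_abs_ratr (q : rat) : padic_abs (ratr q) = ratp_abs p q.
Proof.
have pi_int (m : int) : \pi_Qp (cst_seq m%:~R) = m%:~R by rewrite cst_seq_int rmorph_int.
have int_neq0 (m : int) : m != 0 -> (m%:~R : Qp) != 0.
  move=> m0; rewrite -pi_int; apply/eqP => /padic_null_pi.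
  move=> /(_ (ratp_abs p m%:~R)); rewrite ratp_abs_gt0// intr_eq0 => /(_ m0)[N].
  by move=> /(_ N (leqnn N)) /=; rewrite ltxx.
have qE : ratr q = \pi_Qp (cst_seq q).
  have d0 : ((denq q)%:~R : Qp) != 0 by rewrite int_neq0// denq_neq0.
  rewrite /ratr; apply: (mulIf d0); rewrite divfK// -!pi_int -pi_mulr.
  congr (\pi_Qp _); apply/val_inj/funext => i /=.
  by rewrite numqE.
have [->|q0] := eqVneq q 0; first by rewrite ratp_abs0 /ratr (numq_int 0) mul0r padic_abs0.
have [|N qN] := @padic_abs_pi (cst_seq q); last by rewrite qE -(qN N).
rewrite -qE /ratr mulf_neq0 ?invr_eq0 ?int_neq0 ?numq_eq0 ?denq_neq0//.
Qed.

Lemma padic_absN x : padic_abs (- x) = padic_abs x.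
Proof.
have [->|x0] := eqVneq x 0; first by rewrite oppr0.
have xE : - x = \pi_Qp (- repr x) by rewrite pi_oppr reprK.
have [|N xN] := @padic_abs_pi (- repr x); first by rewrite -xE oppr_eq0.
have [M xM] := padic_abs_repr x0.
by rewrite xE -(xN (maxn N M)) ?leq_maxl// -(xM (maxn N M)) ?leq_maxr// ratp_absN.
Qed.

Let Qp_dist x y := padic_abs (x - y).

Let Qp_distxx x : Qp_dist x x = 0.
Proof. by rewrite /Qp_dist subrr padic_abs0. Qed.

Let Qp_dist_eq0 x y : Qp_dist x y = 0 -> x = y.
Proof. by move/padic_abs_eq0/eqP; rewrite subr_eq0 => /eqP. Qed.

Let Qp_dist_sym x y : Qp_dist x y = Qp_dist y x.
Proof. by rewrite /Qp_dist -padic_absN opprB. Qed.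

Let Qp_dist_triangle y x z : Qp_dist x z <= Qp_dist x y + Qp_dist y z.
Proof.
rewrite /Qp_dist -(subrKA y); apply: le_trans (padic_absD _ _) _.
by rewrite ge_max lerDl lerDr !padic_abs_ge0.
Qed.

HB.instance Definition _ :=
  isMetric.Build rat Qp Qp_distxx Qp_dist_eq0 Qp_dist_sym Qp_dist_triangle.
HB.instance Definition _ := isPointed.Build Qp 0.

End PadicSeq.

HB.instance Definition _ (R : realType) := NormedModule.copy R[i] (R[i])^o.

Section ComplexIntegration.
Context d (T : measurableType d) (R : realType) (mu : {measure set T -> \bar R}).
Implicit Types (f g : T -> R[i]) (w : T -> R).

Definition cmeasurable f : Prop :=
  measurable_fun [set: T] (fun x => complex.Re (f x)) /\
  measurable_fun [set: T] (fun x => complex.Im (f x)).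

Definition cintegrable f : Prop :=
  mu.-integrable [set: T] (fun x => (complex.Re (f x))%:E) /\
  mu.-integrable [set: T] (fun x => (complex.Im (f x))%:E).

Definition cintegral f : R[i] :=
  Complex (\int[mu]_(x in [set: T]) complex.Re (f x))%R
          (\int[mu]_(x in [set: T]) complex.Im (f x))%R.

Definition wnorm2 w f : \bar R :=
  (\int[mu]_(x in [set: T]) (w x * Normc.normc (f x) ^+ 2)%:E)%E.

Definition in_wL2 w f : Prop := cmeasurable f /\ (wnorm2 w f < +oo)%E.

Definition wL2_cvg w (s : nat -> T -> R[i]) f : Prop :=
  wnorm2 w (fun x => s k x - f x) @[k --> \oo] --> 0%E.

Definition in_L2 := in_wL2 (fun=> 1).

Definition L2_cvg := wL2_cvg (fun=> 1).

End ComplexIntegration.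

Definition QpnBorel (p : nat) (p_pr : prime p) (n : nat) :=
  g_sigma_algebraType (@open 'rV[Qp p_pr]_n).

Section PadicAnalysis.
Context (R : realType) (p : nat) (p_pr : prime p) (n : nat).
Local Notation K := (Qp p_pr).
Local Notation V := ('rV[K]_n).
Implicit Types (x y xi : V) (phi psi g : V -> R[i]).

Definition pabs (a : K) : R := ratr (padic_abs a).

Definition Zpn : set V := [set x | forall i, padic_abs (x 0 i) <= 1].

(* These two conditions characterize the normalized Haar measure: a Borel
   measure satisfying them is finite on compact sets, and it is regular
   because the space is locally compact, metrizable and separable. *)
Definition normalized_haar (mu : {measure set (QpnBorel p_pr n) -> \bar R}) : Prop :=
  mu Zpn = 1%E /\
  forall (a : V) (A : set V), measurable (A : set (QpnBorel p_pr n)) ->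
    mu [set x + a | x in A] = mu A.

(* {a}_p, the unique m / p^k in [0, 1[ with a - m / p^k a p-adic integer *)
Definition padic_frac (a : K) : rat :=
  xget 0 [set q : rat | [/\ 0 <= q < 1,
    exists m k : nat, q = m%:R / p%:R ^+ k & padic_abs (a - ratr q) <= 1]].

Definition Psi (a : K) : R[i] :=
  let theta : R := 2 * pi * ratr (padic_frac a) in Complex (cos theta) (sin theta).

Definition dotp x y : K := \sum_i x 0 i * y 0 i.

Definition fpoly (f : mpoly.mpoly n K) x : K := mpoly.meval (fun i => x 0 i) f.

Definition Zp_coefs (f : mpoly.mpoly n K) : Prop :=
  forall m, padic_abs (mpoly.mcoeff m f) <= 1.

Definition elliptic (f : mpoly.mpoly n K) (d : nat) : Prop :=
  [/\ forall c : K, f <> mpoly.mpolyC n c,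
      forall m, mpoly.mcoeff m f != 0 -> mpoly.mdeg m = d
    & forall x, fpoly f x = 0 <-> x = 0].

Definition Xi (d : nat) x : R := \sum_i pabs (x 0 i) ^+ d.

Definition schwartz_bruhat phi : Prop :=
  (forall x, \forall y \near x, phi y = phi x) /\
  compact (closure [set x | phi x != 0]).

Definition cbounded phi : Prop := exists M : R, forall x, Normc.normc (phi x) <= M.

Section Haar.
Variable mu : {measure set (QpnBorel p_pr n) -> \bar R}.

Definition fourier phi xi : R[i] :=
  cintegral mu (fun x : V => Psi (- dotp x xi) * phi x).

(* g is (a representative of) the Fourier transform of the class of phi in L2,
   defined by continuous extension from the dense subspace of Schwartz--Bruhat
   functions. *)
Definition fourierL2 phi g : Prop :=
  [/\ in_L2 mu phi, in_L2 mu g &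
    exists s : nat -> V -> R[i], [/\ forall k, schwartz_bruhat (s k),
      L2_cvg mu s phi & L2_cvg mu (fun k => fourier (s k)) g]].

Definition symbol (f : mpoly.mpoly n K) (alpha : R) xi : R :=
  pabs (fpoly f xi) `^ alpha.

Definition pdo_dom f alpha phi : Prop :=
  exists2 g, fourierL2 phi g & in_L2 mu (fun xi => (symbol f alpha xi)%:C * g xi).

(* psi is (a representative of) f(D, alpha) phi; the inverse transform is
   expressed by F psi = |f|^alpha F phi. *)
Definition pdo f alpha phi psi : Prop :=
  exists2 g, fourierL2 phi g &
    fourierL2 psi (fun xi => (symbol f alpha xi)%:C * g xi).

Definition t_derivative (v : R -> R[i]) (t : R) (l : R[i]) : Prop :=
  (h^-1)%:C * (v (t + h) - v t) @[h --> 0^'] --> l.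

(* As f(D, alpha) u(., t) is a class in L2, the equation means that -du/dt(., t)
   represents it. *)
Definition classical_solution f alpha phi (u : V -> R -> R[i]) : Prop :=
  [/\ {within [set z : V * R | 0 <= z.2], continuous (fun z : V * R => u z.1 z.2)},
      forall x, u x 0 = phi x,
      forall t : R, 0 < t -> pdo_dom f alpha (u^~ t) &
      exists du : V -> R -> R[i],
        [/\ forall x (t : R), 0 < t -> t_derivative (u x) t (du x t),
            forall x (t : R), 0 < t -> {for t, continuous (du x)} &
            forall t : R, 0 < t -> exists2 psi, pdo f alpha (u^~ t) psi &
              forall x, du x t + psi x = 0]].

Definition heat_integrand (f : mpoly.mpoly n K) (alpha : R) x (t : R) xi : R[i] :=
  Psi (dotp x xi) * (expR (- t * symbol f alpha xi))%:C.

Definition heat_kernel f alpha x t : R[i] :=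
  cintegral mu (heat_integrand f alpha x t).

Definition Phi phi : Prop := schwartz_bruhat phi /\ fourier phi 0 = 0.

(* On the Fourier side: Htilde d beta consists of the g in
   L2(Xi^(2 beta) dxi) that are limits of F(phi_k), phi_k in Phi, for the norm
   transported by F, i.e. the completion of (Phi, ||.||_beta) realized in that
   weighted L2 space. *)
Definition Xi_weight (d : nat) (beta : R) xi : R := Xi d xi `^ (2 * beta).

Definition Htilde (d : nat) (beta : R) g : Prop :=
  in_wL2 mu (Xi_weight d beta) g /\
  exists s : nat -> V -> R[i], (forall k, Phi (s k)) /\
    wL2_cvg mu (Xi_weight d beta) (fun k => fourier (s k)) g.

(* Htilde_oo is the intersection over beta in nat, already complete for rho;
   as beta = 0 gives L2, its elements are L2 classes. *)
Definition Htilde_oo (d : nat) phi : Prop :=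
  exists2 g, fourierL2 phi g & forall beta : nat, Htilde d beta%:R g.

End Haar.
End PadicAnalysis.

(* Main.v *)
(* Write sigma = |f|_p^alpha.  Compactness of the unit sphere and homogeneity give
   c q^j <= sigma <= q^j on the sphere of radius p^j, with q = p^(alpha d), and
   sigma is constant on balls of radius p^(j-l) there.  Hence e^(-t sigma) is
   integrable and its transform Z satisfies |Z(x,t)| <= C t |x|^(-n - alpha d), so
   that the Z(.,t) are bounded in L^1, have total mass 1 and concentrate at 0 as
   t -> 0: this gives continuity of the solution up to t = 0.

   The initial datum is approximated, boundedly pointwise and in L^2, by step
   functions; with their transforms converging to g in L^2, the convolution of Z
   with the datum becomes the inverse transform of e^(-t sigma) g.  All multipliers
   sigma^i e^(-t sigma) are bounded and square integrable for t > 0, so the time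
   derivative, the equation and the membership in the weighted L^2 spaces can be
   read off g.  Truncating such a multiplier to an annulus makes it a step function
   vanishing at 0, which produces the required approximations by functions of S
   and of Phi. *)

Require Import Defs.
From HB Require Import structures.
From mathcomp Require Import all_boot all_order all_algebra complex.
From mathcomp Require Import generic_quotient ring_quotient.
From mathcomp Require Import all_classical all_reals all_analysis.
From mathcomp Require Import measurable_realfun.
From mathcomp Require Import ring lra zify.
From mathcomp Require mpoly.

Set Implicit Arguments.
Unset Strict Implicit.
Unset Printing Implicit Defensive.

Import Order.TTheory GRing.Theory Num.Theory numFieldNormedType.Exports.

Local Open Scope classical_set_scope.
Local Open Scope ring_scope.
Local Open Scope quotient_scope.
Local Open Scope complex_scope.

(** * The p-adic field and its additive character *)

(** As [phi] need not be integrable, its transform exists only as an L^2 limit [g], while the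
    solution must be known at every point. The bridge is that a square integrable multiplier [u]
    makes [u * g] integrable: its inverse transform is then an honest continuous function, and the
    work lies in showing that this function also represents the L^2 inverse transform. Hence every
    approximation must converge twice, in L^1 for the pointwise values and in L^2 for Parseval, and
    Fatou's lemma identifies the two limits. Fubini's theorem is never invoked: inversion, the
    multiplication formula and the convolution formula are computed on indicators of balls and
    extended by linearity and density. The symbol is locally constant only away from 0, with a
    radius proportional to the norm, so a ball around 0 has to be cut out as well; the loss is
    harmless because {0} is null when [0 < n]. The datum is not assumed uniformly continuous, so the
    limit t -> 0 is taken near one point at a time. Differentiation under the integral becomes an
    explicit Taylor bound, where half of the exponent of e^(-t sigma) pays for the change of
    time. *)

Section Padic.
Variables (p : nat) (p_pr : prime p).
Local Notation K := (Qp p_pr).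
Implicit Types x y : K.

Lemma pq_gt0 : 0 < p%:R :> rat.
Proof. by rewrite ltr0n prime_gt0. Qed.

Lemma pq_gt1 : 1 < p%:R :> rat.
Proof. by rewrite ltr1n prime_gt1. Qed.

Lemma pq_neq0 : p%:R != 0 :> rat.
Proof. exact: lt0r_neq0 pq_gt0. Qed.

Lemma ler_pq (j k : int) : (p%:R ^ j <= p%:R ^ k :> rat) = (j <= k).
Proof. by rewrite ler_eXz2l ?pq_gt1. Qed.

Lemma padic_abs_value x : x != 0 -> exists j : int, padic_abs x = p%:R ^ j.
Proof.
move=> x0; have [N xN] := padic_abs_repr x0.
have xx := xN N (leqnn N); move: (padic_abs_gt0 x0); rewrite -xx.
rewrite ratp_abs_gt0// /ratp_abs => /negbTE->; by eexists.
Qed.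

Lemma padic_absDl (r : rat) x y :
  padic_abs x <= r -> padic_abs y <= r -> padic_abs (x + y) <= r.
Proof.
by move=> xr yr; apply: le_trans (padic_absD x y) _; rewrite ge_max xr.
Qed.

Lemma padic_absBl (r : rat) x y :
  padic_abs x <= r -> padic_abs y <= r -> padic_abs (x - y) <= r.
Proof. by move=> xr yr; apply: padic_absDl; rewrite ?padic_absN. Qed.

Definition cst_seq (q : rat) : padic_seq p_pr :=
  exist _ (fun=> q) (padic_cauchy_cst p_pr q).

Definition Qp_of_rat (q : rat) : K := \pi_K (cst_seq q).

Fact Qp_of_rat_is_zmod_morphism : zmod_morphism Qp_of_rat.
Proof.
move=> q r; rewrite /Qp_of_rat -pi_oppr -pi_addr; congr (\pi_K _).
exact/val_inj.
Qed.

Fact Qp_of_rat_is_monoid_morphism : monoid_morphism Qp_of_rat.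
Proof.
split; first by rewrite /Qp_of_rat -pi_oner; congr (\pi_K _); exact/val_inj.
by move=> q r; rewrite /Qp_of_rat -pi_mulr; congr (\pi_K _); exact/val_inj.
Qed.

HB.instance Definition _ := GRing.isZmodMorphism.Build rat K Qp_of_rat
  Qp_of_rat_is_zmod_morphism.
HB.instance Definition _ := GRing.isMonoidMorphism.Build rat K Qp_of_rat
  Qp_of_rat_is_monoid_morphism.

Lemma ratr_Qp q : ratr q = Qp_of_rat q.
Proof. by rewrite /ratr -{3}(divq_num_den q) fmorph_div !rmorph_int. Qed.

Lemma padic_abs_of_rat q : padic_abs (Qp_of_rat q) = ratp_abs p q.
Proof. by rewrite -ratr_Qp padic_abs_ratr. Qed.

Lemma padic_abs1 : padic_abs (1 : K) = 1.
Proof. by rewrite -(rmorph1 Qp_of_rat) padic_abs_of_rat ratp_abs1. Qed.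

Lemma padic_abs_p : padic_abs (p%:R : K) = p%:R^-1.
Proof.
rewrite -(rmorph_nat Qp_of_rat p) padic_abs_of_rat.
rewrite -[p%:R]/((Posz p)%:~R) ratp_abs_int; last by case: p p_pr.
by rewrite absz_nat logn_prime// eqxx.
Qed.

Lemma padic_absV x : padic_abs x^-1 = (padic_abs x)^-1.
Proof.
have [->|x0] := eqVneq x 0; first by rewrite invr0 padic_abs0 invr0.
apply: (mulIf (x := padic_abs x)); first exact: lt0r_neq0 (padic_abs_gt0 x0).
by rewrite -padic_absM !mulVf ?padic_abs1// lt0r_neq0 ?padic_abs_gt0.
Qed.

Lemma p_neq0 : p%:R != 0 :> K.
Proof.
apply/eqP => p0; have := padic_abs_p; rewrite p0 padic_abs0 => /esym/eqP.
by rewrite invr_eq0 (negbTE pq_neq0).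
Qed.

Lemma padic_abs_expz (j : int) : padic_abs ((p%:R : K) ^ j) = p%:R ^ (- j).
Proof.
have absX (k : nat) : padic_abs ((p%:R : K) ^+ k) = p%:R ^- k.
  elim: k => [|k IH]; first by rewrite !expr0 invr1 padic_abs1.
  by rewrite !exprS padic_absM IH padic_abs_p invfM.
case: j => k; first by rewrite -exprnP absX -exprnN.
by rewrite NegzE opprK -invr_expz padic_absV absX invrK.
Qed.

Lemma Qp_rat_dense x (e : rat) : 0 < e -> exists q, padic_abs (x - Qp_of_rat q) < e.
Proof.
move=> e0; have [N sN] := asboolP _ (valP (repr x)) _ e0.
exists (val (repr x) N).
have [->|xq] := eqVneq (x - Qp_of_rat (val (repr x) N)) 0; first by rewrite padic_abs0.
have xqE : x - Qp_of_rat (val (repr x) N) = \pi_K (repr x - cst_seq (val (repr x) N)).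
  by rewrite pi_addr pi_oppr reprK.
have [|M sM] := @padic_abs_pi _ p_pr (repr x - cst_seq (val (repr x) N)).
  by rewrite -xqE.
rewrite xqE -(sM (maxn M N)) ?leq_maxl//.
by apply: sN => //; exact: leq_maxr.
Qed.

Definition Qp_cauchy (s : nat -> K) := forall e : rat, 0 < e ->
  exists N, forall i j, (N <= i)%N -> (N <= j)%N -> padic_abs (s i - s j) < e.

(** Choosing a rational [t k] within 1/(k+1) of [s k] gives a Cauchy sequence of rationals, and its
    class is the limit. *)
Lemma Qp_complete (s : nat -> K) : Qp_cauchy s ->
  exists x, forall e : rat, 0 < e ->
    exists N, forall i, (N <= i)%N -> padic_abs (x - s i) < e.
Proof.
move=> cs.
have inv0 k : 0 < (k.+1%:R)^-1 :> rat by rewrite invr_gt0 ltr0n.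
pose t k := sval (cid (Qp_rat_dense (s k) (inv0 k))).
have tP k : padic_abs (s k - Qp_of_rat (t k)) < k.+1%:R^-1.
  by rewrite /t; case: cid.
have small (e : rat) : 0 < e -> exists N, forall i, (N <= i)%N ->
    padic_abs (s i - Qp_of_rat (t i)) < e.
  move=> e0; have [N Ne] : exists N : nat, e^-1 < N%:R.
    by exists (Num.bound e^-1); apply: archi_boundP; rewrite invr_ge0 ltW.
  exists N => i Ni; apply: lt_trans (tP i) _.
  rewrite invf_plt ?posrE ?ltr0n//; apply: lt_le_trans Ne _.
  by rewrite ler_nat ltnW.
have absD_lt (e : rat) x y : padic_abs x < e -> padic_abs y < e -> padic_abs (x + y) < e.
  by move=> xe ye; rewrite (le_lt_trans (padic_absD _ _))// gt_max xe ye.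
have tc : t \in padic_cauchy p_pr.
  apply/asboolP => e e0; have [N1 sN] := cs _ e0; have [N2 tN] := small _ e0.
  exists (maxn N1 N2) => i j; rewrite !geq_max => /andP[i1 i2] /andP[j1 j2].
  rewrite -padic_abs_of_rat rmorphB/=.
  have -> : Qp_of_rat (t i) - Qp_of_rat (t j) =
     - (s i - Qp_of_rat (t i)) + ((s i - s j) + (s j - Qp_of_rat (t j))).
    by ring.
  apply: (absD_lt); first by rewrite padic_absN tN.
  by apply: (absD_lt); rewrite ?sN ?tN.
pose T : padic_seq p_pr := exist _ t tc.
exists (\pi_K T) => e e0; have [N1 sN] := small _ e0.
have [N2 tN] := asboolP _ tc _ e0.
exists (maxn N1 N2) => i; rewrite !geq_max => /andP[i1 i2].
have -> : \pi_K T - s i = (\pi_K T - Qp_of_rat (t i)) + - (s i - Qp_of_rat (t i)).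
  by ring.
apply: absD_lt; last by rewrite padic_absN sN.
have E : \pi_K T - Qp_of_rat (t i) = \pi_K (T - cst_seq (t i)).
  by rewrite pi_addr pi_oppr.
have [->|nz] := eqVneq (\pi_K T - Qp_of_rat (t i)) 0; first by rewrite padic_abs0.
have [|M sM] := @padic_abs_pi _ p_pr (T - cst_seq (t i)); first by rewrite -E.
rewrite E -(sM (maxn M N2)) ?leq_maxl//.
by apply: tN => //; exact: leq_maxr.
Qed.

Definition Qball (k : int) : set K := [set x | padic_abs x <= p%:R ^ k].

Lemma QballE k x : Qball k x = (padic_abs x <= p%:R ^ k).
Proof. by []. Qed.

Lemma Qball0 k : Qball k 0.
Proof. by rewrite QballE padic_abs0 exprz_ge0// ltW// pq_gt0. Qed.

Lemma QballN k x : Qball k x -> Qball k (- x).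
Proof. by rewrite !QballE padic_absN. Qed.

Lemma QballD k x y : Qball k x -> Qball k y -> Qball k (x + y).
Proof. by rewrite !QballE; exact: padic_absDl. Qed.

Lemma QballM j k x y : Qball j x -> Qball k y -> Qball (j + k) (x * y).
Proof.
rewrite !QballE => xj yk; rewrite padic_absM expfzDr ?pq_neq0//.
by apply: ler_pM => //; exact: padic_abs_ge0.
Qed.

Lemma Qball_le j k x : j <= k -> Qball j x -> Qball k x.
Proof. by rewrite !QballE -ler_pq => jk xj; exact: le_trans xj jk. Qed.

Lemma Qball_pz k : Qball (- k) ((p%:R : K) ^ k).
Proof. by rewrite QballE padic_abs_expz. Qed.

Lemma Qball_neq0 x : x != 0 -> exists k : int, [/\ Qball k x, ~ Qball (k - 1) x
  & Qball (- k) x^-1].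
Proof.
move=> /padic_abs_value[k xk]; exists k; rewrite !QballE padic_absV xk; split=> //.
  by rewrite ler_pq; lia.
by rewrite -invr_expz.
Qed.

Lemma Qball_small (e : rat) : 0 < e -> exists k : nat, p%:R ^ (- k%:Z) < e.
Proof.
move=> e0; exists (Num.bound e^-1).
have bk (k : nat) : k%:R <= p%:R ^+ k :> rat.
  by rewrite -natrX ler_nat ltnW// ltn_expl// prime_gt1.
rewrite -invr_expz invf_plt ?posrE ?exprn_gt0 ?pq_gt0//.
apply: lt_le_trans (bk _); apply: archi_boundP.
by rewrite invr_ge0 ltW.
Qed.

Lemma Qball_inter0 x : (forall k : nat, Qball (- k%:Z) x) -> x = 0.
Proof.
move=> xk; apply/eqP; apply: contraT => /padic_abs_gt0/Qball_small[k].
by move=> /(le_lt_trans (xk k)); rewrite ltxx.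
Qed.
End Padic.
#[global] Opaque Qball.

(** * The additive character [Psi]: independence of the choice of fractional part, additivity,
    nontriviality *)

Section AdditiveCharacter.
Variables (R : realType) (p : nat) (p_pr : prime p).
Local Notation K := (Qp p_pr).
Implicit Types (x y : K) (q r : rat).
#[local] Opaque padic_abs padic_frac.

(** The ring Z[1/p]. Numerators may be negative, unlike in [padic_frac], so that differences stay
    inside. *)
Definition p_fraction q := exists (z : int) (k : nat), q = z%:~R / p%:R ^+ k.

Lemma p_fractionD q r : p_fraction q -> p_fraction r -> p_fraction (q + r).
Proof.
move=> [z [k ->]] [w [l ->]]; exists (z * (Posz p) ^+ l + w * (Posz p) ^+ k), (k + l)%N.
rewrite rmorphD !rmorphM/= !rmorphXn/= -pmulrn.
have pk j : p%:R ^+ j != 0 :> rat by rewrite expf_neq0 ?pq_neq0.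
by rewrite addf_div// exprD.
Qed.

Lemma p_fractionN q : p_fraction q -> p_fraction (- q).
Proof. by move=> [z [k ->]]; exists (- z), k; rewrite rmorphN mulNr. Qed.

(** Inside Q, Z[1/p] and the p-adic integers meet in Z: absolute value at most 1 makes the power of
    p divide the numerator. *)
Lemma p_fraction_int q : p_fraction q -> ratp_abs p q <= 1 -> exists z : int, q = z%:~R.
Proof.
move=> [z [k ->]]; have [->|z0] := eqVneq z 0; first by exists 0; rewrite mul0r.
rewrite -[p%:R ^+ k]/((Posz p)%:~R ^+ k) -rmorphXn/=.
have pk0 : (Posz p) ^+ k != 0 by rewrite expf_neq0//; case: p p_pr.
rewrite ratp_abs_frac// abszX absz_nat pfactorK//.
rewrite -[leRHS](expr0z p%:R) ler_pq// subr_le0 lez_nat.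
rewrite -pfactor_dvdn ?absz_gt0// => pz.
have /dvdzP[w ->] : (((Posz p) ^+ k) %| z)%Z by rewrite dvdzE abszX absz_nat.
by exists w; rewrite rmorphM/= mulfK// intr_eq0.
Qed.

(** Write the denominator as p^k w with w prime to p, and a w + b p^k = 1. Then q = N a / p^k + N b
    / w, where N is the numerator; the second term is p-integral, and reducing N a modulo p^k brings
    the first into [0, 1[ at the cost of an integer. *)
Lemma p_fraction_approx q :
  exists r, [/\ 0 <= r < 1, exists m k : nat, r = m%:R / p%:R ^+ k & ratp_abs p (q - r) <= 1].
Proof.
set v := `|denq q|%N; have v0 : (0 < v)%N by rewrite absz_gt0 denq_neq0.
set k := logn p v; set w := (v`_p^')%N.
have vE : v = (p ^ k * w)%N by rewrite /w -[LHS](partnC p)// p_part.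
have cpw : coprimez w (p ^ k)%N.
  rewrite /coprimez /gcdz !absz_nat; apply/eqP; congr Posz; apply/eqP.
  rewrite -/(coprime _ _) coprime_sym; apply: coprimeXl.
  by rewrite -[p in coprime p _](part_pnat_id (pnat_id p_pr)) coprime_partC.
have [a [b]] := Bezoutz w (p ^ k)%N.
have -> : gcdz w (p ^ k)%N = 1 by exact/eqP.
move=> ab.
set m := (numq q * a %% (p ^ k)%N)%Z.
have pk0 : (Posz (p ^ k)%N) != 0 by rewrite -lt0n expn_gt0 prime_gt0.
have m0 : 0 <= m by rewrite modz_ge0.
have mE : m = `|m|%N by rewrite gez0_abs.
have pkR : (Posz (p ^ k)%N)%:~R = p%:R ^+ k :> rat by rewrite -pmulrn natrX.
have pk0R : 0 < p%:R ^+ k :> rat by rewrite exprn_gt0 ?pq_gt0.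
exists (m%:~R / p%:R ^+ k); split.
- apply/andP; split; first by rewrite divr_ge0 ?ler0z// ltW.
  rewrite ltr_pdivrMr// mul1r -pkR ltr_int.
  by rewrite ltz_pmod// lt_neqAle eq_sym pk0.
- by exists `|m|%N, k; rewrite mE.
- have w0 : (Posz w) != 0 by rewrite -lt0n part_gt0.
  have qE : q = (numq q)%:~R / (Posz (p ^ k)%N * Posz w)%:~R.
    rewrite -{1}(divq_num_den q); congr (_ / _%:~R).
    by rewrite -PoszM -vE /v gez0_abs// ltW ?denq_gt0.
  have nE : numq q * a = (numq q * a %/ (p ^ k)%N)%Z * (p ^ k)%N + m.
    exact: divz_eq.
  set c := (_ %/ _)%Z in nE.
  have -> : q - m%:~R / p%:R ^+ k = (numq q * b + c * w)%:~R / w%:~R.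
    rewrite {1}qE -pkR; apply/eqP.
    have w0R : (Posz w)%:~R != 0 :> rat by rewrite intr_eq0.
    have pk0R' : (Posz (p ^ k)%N)%:~R != 0 :> rat by rewrite intr_eq0.
    rewrite rmorphM/= -mulNr addf_div ?mulf_neq0//.
    rewrite eqr_div ?mulf_neq0// -!rmorphM -!rmorphN -!rmorphM -!rmorphD -!rmorphM/=.
    rewrite eqr_int; apply/eqP.
    have mE' : m = numq q * a - c * (p ^ k)%N by rewrite nE addrC addKr.
    have bE : b * (p ^ k)%N = 1 - a * w by rewrite -ab addrC addKr.
    rewrite mE'; set P := Posz _ in bE |- *; set W := Posz w in bE |- *; set N := numq q.
    transitivity (N * P * W - (N * a - c * P) * P * W * W); first by rewrite -/P -/W; ring.
    transitivity ((N * (b * P) + c * W * P) * (P * W)); last by ring.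
    rewrite bE; ring.
  have [->|n0] := eqVneq (numq q * b + c * w) 0; first by rewrite mul0r ratp_abs0.
  rewrite ratp_abs_frac//.
  have -> : logn p `|Posz w| = 0%N.
    rewrite absz_nat; apply: logn_coprime.
    by rewrite -[p in coprime p _](part_pnat_id (pnat_id p_pr)) coprime_partC.
  rewrite -[leRHS](expr0z p%:R) ler_pq// sub0r oppr_le0//.
Qed.

Definition circle (theta : R) : R[i] := Complex (cos theta) (sin theta).

Lemma circleD a b : circle (a + b) = circle a * circle b.
Proof. by rewrite /circle cosD sinD; congr Complex; rewrite addrC. Qed.

Lemma circle_int (z : int) : circle (2 * pi * z%:~R) = 1.
Proof.
have nat_case (k : nat) : circle (2 * pi * k%:R) = 1.
  elim: k => [|k IH]; first by rewrite mulr0 /circle cos0 sin0.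
  rewrite -[k.+1%:R]natr1 mulrDr mulr1 circleD IH mul1r.
  by rewrite /circle mulr_natl cos2pi sin2pi.
case: z => k; first exact: nat_case.
rewrite NegzE rmorphN/= mulrN; have := nat_case k.+1.
rewrite /circle cosN sinN => -[-> ->]; by rewrite oppr0.
Qed.

Lemma padic_frac_spec x : [/\ 0 <= padic_frac x < 1, p_fraction (padic_frac x)
  & padic_abs (x - ratr (padic_frac x)) <= 1].
Proof.
have [q qx] := Qp_rat_dense x ltr01.
have [r [r01 rf qr]] := p_fraction_approx q.
pose P := [set q : rat | [/\ 0 <= q < 1,
    exists m k : nat, q = m%:R / p%:R ^+ k & padic_abs (x - ratr q) <= 1]].
have Pr : P r.
  split=> //; rewrite ratr_Qp.
  rewrite -(subrK (Qp_of_rat p_pr q) x) -addrA padic_absDl//; first exact: ltW.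
  by rewrite -rmorphB padic_abs_of_rat.
have : P (padic_frac x) by apply: xgetPex; exists r.
case=> x01 [m [k mk]] xx; split; [exact: x01| |exact: xx].
by exists (Posz m), k; rewrite mk -pmulrn.
Qed.

(** Two fractions in Z[1/p] congruent to x modulo Z_p differ by an integer, which [circle] does not
    see. Hence [Psi] may be computed from any such fraction and not only from the one selected by
    [xget]; additivity follows at once. *)
Lemma Psi_eq x q : p_fraction q -> padic_abs (x - Qp_of_rat p_pr q) <= 1 ->
  Psi R x = circle (2 * pi * ratr q).
Proof.
move=> fq xq; have [_ fx] := padic_frac_spec x; rewrite ratr_Qp => xx.
have [z zE] : exists z : int, padic_frac x - q = z%:~R.
  apply: p_fraction_int; first exact: p_fractionD fx (p_fractionN fq).
  rewrite -(padic_abs_of_rat p_pr) rmorphB/=.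
  have -> : Qp_of_rat p_pr (padic_frac x) - Qp_of_rat p_pr q =
    (x - Qp_of_rat p_pr q) - (x - Qp_of_rat p_pr (padic_frac x)) by ring.
  exact: padic_absBl.
rewrite -[LHS]/(circle (2 * pi * ratr (padic_frac x))).
rewrite -(subrK q (padic_frac x)) zE rmorphD/= mulrDr circleD.
by rewrite ratr_int circle_int mul1r.
Qed.

Lemma p_fraction0 : p_fraction 0.
Proof. by exists 0, 0%N; rewrite mul0r. Qed.

Lemma Psi_Zp x : padic_abs x <= 1 -> Psi R x = 1.
Proof.
move=> x1; rewrite (Psi_eq p_fraction0) ?rmorph0 ?subr0//.
exact: circle_int 0.
Qed.

Lemma PsiD x y : Psi R (x + y) = Psi R x * Psi R y.
Proof.
have [_ fx xx] := padic_frac_spec x; have [_ fy yy] := padic_frac_spec y.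
rewrite (Psi_eq (p_fractionD fx fy)); first by rewrite rmorphD/= mulrDr circleD.
rewrite rmorphD/= opprD addrACA; rewrite ratr_Qp in xx; rewrite ratr_Qp in yy.
refine (padic_absDl _ _); [exact xx | exact yy].
Qed.

Lemma Psi0 : Psi R (0 : K) = 1.
Proof. by rewrite Psi_Zp// padic_abs0. Qed.

Lemma PsiN x : Psi R (- x) = (Psi R x)^*%C.
Proof.
have [_ fx xx] := padic_frac_spec x; rewrite (Psi_eq (p_fractionN fx)).
  by rewrite rmorphN/= mulrN /circle cosN sinN.
rewrite ratr_Qp in xx; rewrite rmorphN/= -opprD padic_absN; exact: xx.
Qed.

Lemma normc_Psi x : Normc.normc (Psi R x) = 1.
Proof. by rewrite /Psi /= cos2Dsin2 sqrtr1. Qed.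

Lemma Psi_neq1 : Psi R ((p%:R : K)^-1) <> 1.
Proof.
have fp : p_fraction p%:R^-1 by exists 1, 1%N; rewrite mul1r expr1.
rewrite (Psi_eq fp); last by rewrite fmorphV rmorph_nat subrr padic_abs0.
rewrite fmorphV rmorph_nat => -[c _].
(* The half angle lies strictly between 0 and pi for every prime, p = 2 included, so its sine is
   positive, whereas cos (2 u) = 1 would make it vanish. *)
set u : R := pi / p%:R.
have pR : 1 < p%:R :> R by rewrite ltr1n prime_gt1.
have u0 : 0 < u < pi.
  rewrite divr_gt0 ?pi_gt0 ?(lt_trans ltr01)//=.
  by rewrite ltr_pdivrMr ?(lt_trans ltr01)// ltr_pMr ?pi_gt0.
have := sin_gt0_pi u0; rewrite lt0r => /andP[/negP + _]; apply.
move: c; rewrite mulrAC -mulrA (mulrC _ pi) -/u mulr_natl cos_mulr2n.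
move=> c; have := cos2Dsin2 u; have -> : cos u ^+ 2 = 1 by lra.
by move=> s; rewrite -sqrf_eq0; apply/eqP; lra.
Qed.
End AdditiveCharacter.

(** * Balls of Q_p^n and Haar measure *)

Section Balls.
Variables (p : nat) (p_pr : prime p) (n : nat).
Local Notation K := (Qp p_pr).
Local Notation V := ('rV[K]_n).
Implicit Types (x y : V) (k : int).

Definition B k : set V := [set x | forall i, Qball k (x 0 i)].

Lemma B_coordP k x : B k x <-> forall i, Qball k (x 0 i).
Proof. by []. Qed.

Lemma B0 k : B k 0.
Proof. by move=> i; rewrite mxE; exact: Qball0. Qed.

Lemma BN k x : B k x -> B k (- x).
Proof. by move=> xk i; rewrite mxE; exact: QballN. Qed.

Lemma BD k x y : B k x -> B k y -> B k (x + y).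
Proof. by move=> xk yk i; rewrite mxE; exact: QballD. Qed.

Lemma BB k x y : B k x -> B k y -> B k (x - y).
Proof. by move=> xk yk; apply: BD => //; exact: BN. Qed.

Lemma BBC k x y : B k (x - y) -> B k (y - x).
Proof. by move=> /BN; rewrite opprB. Qed.

Lemma B_trans k x y z : B k (x - y) -> B k (y - z) -> B k (x - z).
Proof. by move=> xy yz; rewrite -(subrKA y); exact: BD. Qed.

Lemma B_le j k x : j <= k -> B j x -> B k x.
Proof. by move=> jk xj i; exact: Qball_le (xj i). Qed.

Lemma BZ (c : K) j k x : Qball j c -> B k x -> B (j + k) (c *: x).
Proof. by move=> cj xk i; rewrite mxE; exact: QballM. Qed.

Lemma BDr k x y : B k y -> B k (x + y) <-> B k x.
Proof. by move=> yk; split=> [xyk|xk]; [rewrite -(addrK y x); exact: BB|exact: BD]. Qed.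

Lemma Qball_sum (I : finType) (F : I -> K) k : (forall i, Qball k (F i)) -> Qball k (\sum_i F i).
Proof.
by move=> Fk; elim/big_ind: _ => [|a b ak bk|i _]; [exact: Qball0|exact: QballD|].
Qed.

Lemma dotp_Qball j k x y : B j x -> B k y -> Qball (j + k) (dotp x y).
Proof. by move=> xj yk; apply: Qball_sum => i; exact: QballM. Qed.

Lemma dotpDl x y z : dotp (x + y) z = dotp x z + dotp y z.
Proof. by rewrite /dotp -big_split/=; apply: eq_bigr => i _; rewrite mxE mulrDl. Qed.

Lemma dotpC x y : dotp x y = dotp y x.
Proof. by rewrite /dotp; apply: eq_bigr => i _; rewrite mulrC. Qed.

Lemma dotpDr x y z : dotp x (y + z) = dotp x y + dotp x z.
Proof. by rewrite dotpC dotpDl dotpC (dotpC z). Qed.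

Lemma dotpNl x y : dotp (- x) y = - dotp x y.
Proof. by rewrite /dotp -sumrN; apply: eq_bigr => i _; rewrite mxE mulNr. Qed.

Lemma dotp0r x : dotp x 0 = 0.
Proof. by rewrite /dotp big1// => i _; rewrite mxE mulr0. Qed.

Lemma ballE (a b : K) (e : rat) : ball a e b = (padic_abs (a - b) < e).
Proof. by rewrite ballEmdist. Qed.

Lemma nbhsQP (a : K) (A : set K) :
  nbhs a A <-> exists k : nat, forall b, Qball (- k%:Z) (b - a) -> A b.
Proof.
rewrite -nbhs_ballE; split=> [[e /= e0 eA]|[k kA]].
  have [k ke] := Qball_small p_pr e0; exists k => b bk; apply: eA.
  by rewrite ballE -padic_absN opprB; exact: le_lt_trans ke.
exists (p%:R ^ (- k%:Z)) => /=; first by rewrite exprz_gt0// pq_gt0.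
move=> b; rewrite ballE => ab; apply: kA; rewrite QballE -padic_absN opprB.
exact: ltW.
Qed.

(** A neighbourhood of a row vector is a product of finitely many coordinate neighbourhoods; the
    largest of their exponents gives one ball inside. *)
Lemma nbhsVP x (A : set V) :
  nbhs x A <-> exists k : nat, forall y, B (- k%:Z) (y - x) -> A y.
Proof.
split=> [[P xP PA]|[k kA]].
  have kP (j : 'I_n) : {k : nat | forall b, Qball (- k%:Z) (b - x 0 j) -> P 0 j b}.
    by apply/cid/nbhsQP/xP.
  exists (\max_(j < n) sval (kP j))%N => y yx; apply: PA => i j; rewrite ord1.
  case: (kP j) (leq_bigmax (F := fun j : 'I_n => sval (kP j)) j) => k kPj /= kle.
  by apply: kPj; have := yx j; rewrite !mxE; apply: Qball_le; rewrite lerN2 lez_nat.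
exists (fun i j => [set b | Qball (- k%:Z) (b - x i j)]) => [i j|y yx].
  by apply/nbhsQP; exists k.
by apply: kA => i; rewrite !mxE; exact: yx.
Qed.

Lemma open_B_invariant (A : set V) : (forall x, A x -> exists k : nat,
  forall y, B (- k%:Z) (y - x) -> A y) -> open A.
Proof. by move=> Ainv; rewrite openE => x /Ainv kA; exact/nbhsVP. Qed.

Lemma open_coset k a : open [set x : V | B k (x - a)].
Proof.
apply: open_B_invariant => x /= xa; exists `|k|%N => y yx.
by apply: B_trans xa; apply: B_le yx; lia.
Qed.

Lemma open_B k : open (B k).
Proof.
apply: open_B_invariant => x /= xk; exists `|k|%N => y yx.
rewrite -(subrK x y); apply: BD xk; apply: B_le yx; lia.
Qed.

Lemma closed_B k : closed (B k).
Proof.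
rewrite -[B k]setCK closedC; apply: open_B_invariant => x /= xk; exists `|k|%N => y yx yk.
apply: xk; rewrite -(subKr y x); apply: BB yk _; apply: B_le yx; lia.
Qed.

Lemma B_inter0 x : (forall k : nat, B (- k%:Z) x) -> x = 0.
Proof. by move=> xk; apply/rowP => i; rewrite mxE; apply: Qball_inter0 => k; exact: xk. Qed.

Lemma Qball_bounded (a : K) : exists k : nat, Qball k a.
Proof.
have [->|/Qball_neq0[k [ak _ _]]] := eqVneq a 0; first by exists 0%N; exact: Qball0.
by exists `|k|%N; apply: Qball_le ak; lia.
Qed.

Lemma B_bounded x : exists k : nat, B k x.
Proof.
pose k i := sval (cid (Qball_bounded (x 0 i))).
exists (\max_i k i)%N => i; apply: (@Qball_le _ _ (k i)); last by rewrite /k; case: cid.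
exact: (leq_bigmax (F := k)).
Qed.

Lemma B_level x : x != 0 -> exists j : int, B j x /\ ~ B (j - 1) x.
Proof.
move=> x0; have [k xk] := B_bounded x.
have [m xm] : exists m : nat, ~ B (- m%:Z) x.
  by apply/existsNP => /B_inter0 x00; move: x0; rewrite x00 eqxx.
have : exists i : nat, `[< ~ B (k%:Z - i%:Z) x >].
  by exists (k + m)%N; apply/asboolP; rewrite PoszD opprD addrA subrr sub0r.
case/ex_minnP => -[|i] /asboolP ni imin; first by rewrite subr0 in ni.
exists (k%:Z - i%:Z); split; last first.
  by move: ni; have -> : k%:Z - i.+1%:Z = k%:Z - i%:Z - 1 by lia.
apply: contrapT => /asboolP/imin; rewrite ltnn//.
Qed.

(** Take a coordinate i with |x_i| >= p^j and h = (p x_i)^-1 e_i: then x . h = 1/p, where [Psi]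
    differs from 1. *)
Lemma dual_vector (R : realType) j x : ~ B (j - 1) x ->
  exists2 h, B (1 - j) h & Psi R (dotp x h) <> 1.
Proof.
move=> /existsNP[i xi].
have xi0 : x 0 i != 0 by apply/eqP => xi0; apply: xi; rewrite xi0; exact: Qball0.
have [k [xik nxik xVk]] := Qball_neq0 xi0.
have jk : j <= k.
  by rewrite leNgt; apply/negP => kj; apply: xi; apply: Qball_le xik; lia.
exists ((p%:R^-1 * (x 0 i)^-1) *: delta_mx 0 i).
  move=> l; rewrite !mxE eqxx/=; case: eqP => _; last by rewrite mulr0; exact: Qball0.
  rewrite mulr1; apply: (@Qball_le _ _ (1 + - k)); first by lia.
  by apply: QballM xVk; have := Qball_pz p_pr (-1); rewrite opprK.
rewrite /dotp (bigD1 i)//= big1 ?addr0.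
  by rewrite !mxE !eqxx/= mulr1 mulrCA divff// mulr1; exact: Psi_neq1.
by move=> l li; rewrite !mxE (negbTE li) andbF !mulr0.
Qed.

(** The leading digit is p times the fractional part of a / p: this number lies in Z[1/p] and is
    p-integral, hence is an integer, and it lies in [0, p[. *)
Lemma Qball_digit (a : K) : Qball 0 a -> exists m : 'I_p, Qball (-1) (a - m%:R).
Proof.
move=> a0; have [r01 rf ar] := padic_frac_spec (a / p%:R).
set r := padic_frac _ in r01 rf ar; rewrite ratr_Qp in ar.
have apr : Qball (-1) (a - Qp_of_rat p_pr (p%:R * r)).
  have -> : a - Qp_of_rat p_pr (p%:R * r) = p%:R * (a / p%:R - Qp_of_rat p_pr r).
    by rewrite mulrBr mulrCA divff ?p_neq0// mulr1 rmorphM rmorph_nat.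
  rewrite -[-1 : int]addr0; apply: QballM; last by rewrite QballE expr0z.
  exact: Qball_pz 1.
have [z zE] : exists z : int, p%:R * r = z%:~R.
  apply: (p_fraction_int (p := p)) => //.
    move: rf => [z [k ->]]; exists (Posz p * z), k; rewrite mulrA.
    by rewrite [in RHS]rmorphM.
  rewrite -(padic_abs_of_rat p_pr).
  have -> : Qp_of_rat p_pr (p%:R * r) = a - (a - Qp_of_rat p_pr (p%:R * r)) by rewrite subKr.
  rewrite -(expr0z p%:R) -QballE; apply: QballD a0 _; apply: QballN.
  exact: Qball_le apr.
have z0 : 0 <= z.
  by rewrite -(ler0z rat) -zE mulr_ge0 ?ler0n//; case/andP: r01.
have zp : (`|z| < p)%N.
  rewrite -(ltr_nat rat) -[X in X < _]/((Posz `|z|%N)%:~R) gez0_abs// -zE.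
  by rewrite gtr_pMr ?pq_gt0//; case/andP: r01.
exists (Ordinal zp) => /=.
move: apr; rewrite zE -{1}(gez0_abs z0) rmorph_int.
by [].
Qed.

Lemma digit_inj (m l : 'I_p) : Qball (-1) (m%:R - l%:R : K) -> m = l.
Proof.
wlog lm : m l / (l < m)%N.
  move=> hw; case: (ltngtP m l) => [ml|lm|ml _]; last exact/val_inj.
  - by move=> /QballN; rewrite opprB => /(hw _ _ ml).
  - exact: hw.
rewrite -natrB ?(ltnW lm)// -(rmorph_nat (Qp_of_rat p_pr)) QballE padic_abs_of_rat.
rewrite -[_%:R]/((Posz (m - l)%N)%:~R) ratp_abs_int; last by rewrite -lt0n subn_gt0.
rewrite absz_nat logn_coprime ?oppr0 ?expr0z.
  by rewrite -[X in X <= _](expr0z p%:R) ler_pq.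
rewrite prime_coprime// gtnNdvd ?subn_gt0//.
exact: leq_ltn_trans (leq_subr _ _) (ltn_ord m).
Qed.
End Balls.

(** An ultrafilter cannot avoid all members of a finite cover; this replaces the extraction of
    subsequences in the compactness proof. *)
Lemma ultra_fincover (T : Type) (I : finType) (F : set_system T) (A : I -> set T) :
  UltraFilter F -> F (\bigcup_i A i) -> exists i, F (A i).
Proof.
move=> FU FA; apply: contrapT => /forallNP nF.
have FC i : F (~` A i) by case: (in_ultra_setVsetC (A i) FU) => // /nF.
have Fall : F [set x | forall i, (~` A i) x] by exact: filter_forall.
have [x [/= nA [i _ Ai]]] := filter_ex (filterI Fall FA).
exact: nA Ai.
Qed.

(** * Decomposition of balls into sub-balls, and their compactness *)

Section Compact.
Variables (p : nat) (p_pr : prime p) (n : nat).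
Local Notation K := (Qp p_pr).
Local Notation V := ('rV[K]_n).
Implicit Types (x y : V) (k : int).

Definition digit_vec k (e : {ffun 'I_n -> 'I_p}) : V :=
  \row_i ((p%:R : K) ^ (- k) * (e i)%:R).

Lemma B_digit k x : B k x -> exists e, B (k - 1) (x - digit_vec k e).
Proof.
move=> xk.
have dP i : {m : 'I_p | Qball (-1) ((p%:R : K) ^ k * x 0 i - m%:R)}.
  apply/cid/Qball_digit; rewrite -(addNr k); apply: QballM (Qball_pz _ _) (xk i).
exists [ffun i => sval (dP i)] => i; rewrite !mxE ffunE.
case: (dP i) => m /= mP.
have -> : x 0 i - (p%:R : K) ^ (- k) * m%:R =
    (p%:R : K) ^ (- k) * ((p%:R : K) ^ k * x 0 i - m%:R).
  by rewrite mulrBr mulrA -expfzDr ?p_neq0// addNr expr0z mul1r.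
apply: QballM mP; by have := Qball_pz p_pr (- k); rewrite opprK.
Qed.

Lemma digit_vec_inj k e e' : B (k - 1) (digit_vec k e - digit_vec k e') -> e = e'.
Proof.
move=> ee; apply/ffunP => i; apply: (@digit_inj _ p_pr).
have -> : (e i)%:R - (e' i)%:R = (p%:R : K) ^ k * ((digit_vec k e - digit_vec k e') 0 i).
  rewrite !mxE -mulrBr mulrA -expfzDr ?p_neq0//.
  by rewrite subrr expr0z mul1r.
by have := QballM (Qball_pz p_pr k) (ee i); rewrite addrA addNr sub0r.
Qed.

Lemma digit_vecB k e : B k (digit_vec k e).
Proof.
move=> i; rewrite mxE -[k in Qball k _]addr0; apply: QballM.
  by have := Qball_pz p_pr (- k); rewrite opprK.
rewrite QballE expr0z -(rmorph_nat (Qp_of_rat p_pr)) padic_abs_of_rat.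
exact: (ratp_abs_int_le1 p_pr (Posz _)).
Qed.

Lemma B_split k : B k = \bigcup_e [set x : V | B (k - 1) (x - digit_vec k e)].
Proof.
apply/seteqP; split=> [x /B_digit[e xe]|x [e _ /= xe]]; first by exists e.
rewrite -(subrK (digit_vec k e) x); apply: BD (digit_vecB _ _); apply: B_le xe; lia.
Qed.

(** At each scale an ultrafilter on the ball selects one of the p^n sub-balls. The centres form a
    Cauchy sequence, and completeness of Q_p, coordinate by coordinate, yields the limit point. *)
Lemma compact_B k : compact (B k : set V).
Proof.
rewrite compact_ultra => F FU FB.
have F_B (m : nat) : exists a : V, F [set y | B (k - m%:Z) (y - a)].
  elim: m => [|m [a Fa]].
    by exists 0; apply: filterS FB => y; rewrite /= !subr0.
  have : F (\bigcup_e [set y : V | B (k - m.+1%:Z) (y - (a + digit_vec (k - m%:Z) e))]).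
    apply: filterS Fa => y /= ya; have [e ye] := B_digit ya; exists e => //=.
    rewrite opprD addrA; have -> : k - m.+1%:Z = k - m%:Z - 1 by lia.
    exact: ye.
  by case/ultra_fincover => e Fe; exists (a + digit_vec (k - m%:Z) e).
have /choice[a aP] := F_B.
have aa i j (m : nat) : (m <= i)%N -> (m <= j)%N -> B (k - m%:Z) (a i - a j).
  move=> mi mj; have [y [/= yi yj]] := filter_ex (filterI (aP i) (aP j)).
  have -> : a i - a j = (y - a j) - (y - a i).
    by rewrite opprB [RHS]addrC subrKA.
  apply: BB; [apply: B_le yj|apply: B_le yi]; lia.
have cvg_i (l : 'I_n) : exists z : K, forall m : nat, Qball (k - m%:Z) (z - a m 0 l).
  have [|z zP] := @Qp_complete _ p_pr (fun i => a i 0 l).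
    move=> e e0; have [N Ne] := Qball_small p_pr e0; exists (N + `|k|)%N => i j Ni Nj.
    apply: le_lt_trans Ne; rewrite -QballE.
    have := aa i j (N + `|k|)%N Ni Nj l; rewrite !mxE; apply: Qball_le; lia.
  exists z => m; have e0 : 0 < p%:R ^ (k - m%:Z) :> rat by rewrite exprz_gt0 ?pq_gt0.
  have [N NP] := zP _ e0.
  rewrite -(subrKA (a (maxn N m) 0 l)); apply: QballD.
    by rewrite QballE; apply/ltW/NP; exact: leq_maxl.
  by have := aa (maxn N m) m m (leq_maxr _ _) (leqnn m) l; rewrite !mxE.
have /choice[z zP] := cvg_i.
pose x : V := \row_l z l.
have xa m : B (k - m%:Z) (x - a m) by move=> l; rewrite !mxE; exact: zP.
have Fx (m : nat) : F [set y | B (k - m%:Z) (y - x)].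
  apply: filterS (aP m) => y /= ya; apply: (B_trans ya); exact/BBC.
exists x; split.
  have := Fx 0%N; rewrite subr0 => Fx0.
  have [y [/= yk yx]] := filter_ex (filterI FB Fx0).
  by rewrite -(subKr y x); exact: BB.
move=> A /nbhsVP[N NA]; apply: filterS (Fx (N + `|k|)%N) => y /= yx; apply: NA.
apply: B_le yx; lia.
Qed.
End Compact.
#[global] Opaque B addmx oppmx.

(** * The normalized Haar measure of balls *)

Section HaarMeasure.
Context (R : realType) (p : nat) (p_pr : prime p) (n : nat).
Local Notation K := (Qp p_pr).
Local Notation V := ('rV[K]_n).
Local Notation VB := (QpnBorel p_pr n).
Variable mu : {measure set VB -> \bar R}.
Implicit Types (x y : V) (k : int).

Lemma open_measurableV (A : set V) : open A -> measurable (A : set VB).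
Proof. exact: sub_sigma_algebra. Qed.

Lemma measurable_B k : measurable (B k : set VB).
Proof. by apply: open_measurableV; exact: open_B. Qed.

Lemma measurable_coset k (a : V) : measurable ([set x | B k (x - a)] : set VB).
Proof. by apply: open_measurableV; exact: open_coset. Qed.

Lemma measurable_translation (a : V) :
  measurable_fun [set: VB] ((fun x : V => x + a) : VB -> VB).
Proof.
apply: (@measurability _ _ VB VB _ _ (@open V)) => //.
move=> _ [A oA <-]; rewrite setTI; apply: open_measurableV.
rewrite openE => x /= Axa; apply/nbhsVP.
have /nbhsVP[k kA] : nbhs (x + a) A by exact: open_nbhs_nbhs.
by exists k => y yx; apply: kA; rewrite opprD addrACA subrr addr0.
Qed.

Hypothesis mu_haar : normalized_haar mu.

Lemma haar_translate (a : V) (A : set V) : measurable (A : set VB) ->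
  mu [set x | A (x - a)] = mu A.
Proof.
move=> mA; rewrite -(mu_haar.2 a A mA); congr (mu _); apply/seteqP; split=> x /=.
  by move=> Axa; exists (x - a) => //; rewrite subrK.
by move=> [y Ay <-]; rewrite addrK.
Qed.

Local Notation P := (p%:R : R).

Lemma PR_gt0 : 0 < P. Proof. by rewrite ltr0n prime_gt0. Qed.
Lemma PR_gt1 : 1 < P. Proof. by rewrite ltr1n prime_gt1. Qed.

(** A ball is the disjoint union of p^n translates of the next smaller one, indexed by digit
    vectors. *)
Lemma haar_B_step k : mu (B k : set V) = ((P ^+ n)%:E * mu (B (k - 1) : set V))%E.
Proof.
pose A (e : {ffun 'I_n -> 'I_p}) : set V := [set x | B (k - 1) (x - digit_vec p_pr k e)].
pose N := #|{: {ffun 'I_n -> 'I_p}}|.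
have BE : B k = \big[setU/set0]_(i < N) (A \o enum_val) i.
  rewrite -bigcup_seq B_split; apply/seteqP; split=> x [e _ /= xe].
    exists (enum_rank e); first by rewrite /= mem_index_enum.
    by rewrite /A/= enum_rankK.
  by exists (enum_val e).
rewrite BE measure_bigsetU_ord.
- rewrite (eq_bigr (fun=> mu (B (k - 1) : set V))); last first.
    by move=> i _; rewrite -(haar_translate (digit_vec p_pr k (enum_val i)))//; exact: measurable_B.
  rewrite sumr_const card_ord /N card_ffun !card_ord -natrX.
  elim: (p ^ n)%N => [|m IH]; first by rewrite mulr0n mul0e.
  by rewrite mulrS IH -nat1r EFinD ge0_muleDl ?mul1e// lee_fin.
- by move=> i; exact: measurable_coset.
- apply/trivIsetP => i j _ _ /eqP ij; apply/seteqP; split=> // x [/= Ai Aj]; apply: ij.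
  apply: enum_val_inj; apply: (@digit_vec_inj _ p_pr _ k).
  have Bi : B (k - 1) ((x : V) - digit_vec p_pr k (enum_val i)) by exact: Ai.
  have Bj : B (k - 1) ((x : V) - digit_vec p_pr k (enum_val j)) by exact: Aj.
  have := B_trans (BBC Bi) Bj; exact.
Qed.

Lemma haar_B k : mu (B k : set V) = (P ^ (k * n%:Z))%:E.
Proof.
have BZ0 : mu (B 0 : set V) = 1%E.
  by rewrite -mu_haar.1; congr (mu _).
have Pn k' : P ^ (k' * n%:Z) = (P ^+ n) * P ^ ((k' - 1) * n%:Z).
  rewrite -[P ^+ n]/(P ^ n%:Z) -expfzDr ?lt0r_neq0 ?PR_gt0//; congr (_ ^ _); ring.
have Pn0 : 0 < P ^+ n by rewrite exprn_gt0 ?PR_gt0.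
elim/int_rect: k => [|k IH|k IH].
- by rewrite BZ0 mul0r expr0z.
- rewrite haar_B_step Pn.
  have -> : k.+1%:Z - 1 = k%:Z by lia.
  by rewrite IH EFinM.
- have := haar_B_step (- k%:Z); rewrite IH Pn EFinM.
  have -> : - k%:Z - 1 = - k.+1%:Z by lia.
  by move/(congr1 (fun z : \bar R => (((P ^+ n)^-1)%:E * z)%E)); rewrite !muleA -!EFinM mulVf ?lt0r_neq0// mul1e mul1r => <-.
Qed.

Lemma haar_coset k (a : V) : mu ([set x | B k (x - a)] : set V) = (P ^ (k * n%:Z))%:E.
Proof. by rewrite haar_translate ?haar_B//; exact: measurable_B. Qed.

(** The origin lies in balls of mass p^(-k n), which tends to 0 only if n > 0; for n = 0 the whole
    space is one point of mass 1. *)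
Lemma haar_set1 : (0 < n)%N -> mu ([set 0] : set V) = 0%E.
Proof.
move=> n0; apply/eqP; rewrite eq_le measure_ge0 andbT; apply/lee_addgt0Pr => e e0.
rewrite add0e.
have [k ke] : exists k : nat, P ^- k < e.
  exists (Num.bound e^-1); rewrite invf_plt ?posrE ?exprn_gt0 ?PR_gt0//.
  have : e^-1 < (Num.bound e^-1)%:R by apply: archi_boundP; rewrite invr_ge0 ltW.
  move/lt_le_trans; apply; rewrite -natrX ler_nat ltnW// ltn_expl// prime_gt1//.
have m0 : measurable ([set 0] : set VB).
  rewrite -[X in measurable X]setCK; apply: measurableC; apply: open_measurableV.
  apply: open_B_invariant => x /= x0.
  have [m xm] : exists m : nat, ~ B (- m%:Z) x.
    by apply/existsNP => /B_inter0.
  exists m => y yx y0; apply: xm; rewrite -[x]subr0 -y0; exact: BBC.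
apply: (@le_trans _ _ (mu (B (- k%:Z) : set V))).
  apply: le_measure; rewrite ?inE//; first exact: measurable_B.
  by move=> x /= ->; exact: B0.
rewrite haar_B lee_fin; apply: le_trans (ltW ke).
rewrite exprnN ler_eXz2l ?PR_gt1// mulNr lerN2.
by rewrite -PoszM lez_nat leq_pmulr.
Qed.

Lemma pushforward_translation (a : V) A : measurable (A : set VB) ->
  pushforward mu ((fun x : V => x - a) : VB -> VB) A = mu A.
Proof. by move=> mA; rewrite /pushforward haar_translate. Qed.

Lemma ge0_integral_translation (a : V) (g : V -> \bar R) :
  measurable_fun [set: VB] (g : VB -> \bar R) -> (forall x, 0%E <= g x)%E ->
  integral mu [set: VB] (fun x : V => g (x - a)) = integral mu [set: VB] (g : VB -> \bar R).
Proof.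
move=> mg g0; have mt := measurable_translation (- a).
rewrite -[RHS](eq_measure_integral _ (fun A mA _ => pushforward_translation a mA)).
by rewrite (ge0_integral_pushforward mt mu measurableT mg).
Qed.

End HaarMeasure.

(** * Complex-valued integration and L^2 *)

Section NormC.
Variable R : realType.
Implicit Types (z w : R[i]) (r : R).
Local Notation nc := (@Normc.normc R).

Lemma ncD z w : nc (z + w) <= nc z + nc w.
Proof. exact: le_normcD. Qed.

Lemma ncN z : nc (- z) = nc z.
Proof. exact: normcN. Qed.

Lemma ncM z w : nc (z * w) = nc z * nc w.
Proof. exact: Normc.normcM. Qed.

Lemma nc_ge0 z : 0 <= nc z.
Proof. by case: z => a b /=; exact: sqrtr_ge0. Qed.

Lemma nc0 : nc 0 = 0.
Proof. exact: Normc.normc0. Qed.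

Lemma ncBC z w : nc (z - w) = nc (w - z).
Proof. by rewrite -ncN opprB. Qed.

Lemma ncB z w : nc (z - w) <= nc z + nc w.
Proof. by rewrite -(ncN w); exact: ncD. Qed.

Lemma nc_triangle y z w : nc (z - w) <= nc (z - y) + nc (y - w).
Proof. by rewrite -{1}(subrKA y); exact: ncD. Qed.

Lemma nc_real r : nc r%:C = `|r|.
Proof. by rewrite /= expr0n addr0 sqrtr_sqr. Qed.

Lemma nc_eq0 z : nc z = 0 -> z = 0.
Proof. exact: Normc.eq0_normc. Qed.

Lemma nc_sqr z : nc z ^+ 2 = complex.Re z ^+ 2 + complex.Im z ^+ 2.
Proof. by case: z => a b /=; rewrite sqr_sqrtr// addr_ge0 ?sqr_ge0. Qed.

Lemma Re_le_nc z : `|complex.Re z| <= nc z.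
Proof.
case: z => a b /=; rewrite -sqrtr_sqr ler_wsqrtr// lerDl sqr_ge0//.
Qed.

Lemma Im_le_nc z : `|complex.Im z| <= nc z.
Proof.
case: z => a b /=; rewrite -sqrtr_sqr ler_wsqrtr// lerDr sqr_ge0//.
Qed.

Lemma nc_le_ReIm z : nc z <= `|complex.Re z| + `|complex.Im z|.
Proof.
rewrite -(@ler_pXn2r _ 2)// ?nnegrE ?nc_ge0 ?addr_ge0// nc_sqr sqrrD !real_normK ?num_real//.
by rewrite [leRHS]addrAC lerDl mulrn_wge0// mulr_ge0.
Qed.

Lemma nc_sqrD z w : nc (z + w) ^+ 2 <= 2 * nc z ^+ 2 + 2 * nc w ^+ 2.
Proof.
have := ncD z w; have := nc_ge0 (z + w); have := nc_ge0 z; have := nc_ge0 w.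
move: (nc z) (nc w) (nc (z + w)) => a b c *.
have : c ^+ 2 <= (a + b) ^+ 2 by rewrite ler_pXn2r// nnegrE//; lra.
have := sqr_ge0 (a - b); lra.
Qed.

Lemma ReD z w : complex.Re (z + w) = complex.Re z + complex.Re w.
Proof. by case: z w => ? ? []. Qed.
Lemma ImD z w : complex.Im (z + w) = complex.Im z + complex.Im w.
Proof. by case: z w => ? ? []. Qed.
Lemma ReN z : complex.Re (- z) = - complex.Re z.
Proof. by case: z. Qed.
Lemma ImN z : complex.Im (- z) = - complex.Im z.
Proof. by case: z. Qed.
Lemma ReM z w : complex.Re (z * w) = complex.Re z * complex.Re w - complex.Im z * complex.Im w.
Proof. by case: z w => ? ? []. Qed.
Lemma ImM z w : complex.Im (z * w) = complex.Re z * complex.Im w + complex.Im z * complex.Re w.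
Proof. by case: z w => ? ? []. Qed.

Lemma complex_eq z w : complex.Re z = complex.Re w -> complex.Im z = complex.Im w -> z = w.
Proof. by case: z w => ? ? [? ?] /= -> ->. Qed.
End NormC.

Section ComplexIntegral.
Context d (T : measurableType d) (R : realType) (mu : {measure set T -> \bar R}).
Implicit Types (f g : T -> R[i]) (h : T -> R).
Local Notation nc := (@Normc.normc R).
Local Notation Re := (@complex.Re R).
Local Notation Im := (@complex.Im R).
Local Notation rintegrable h := (mu.-integrable [set: T] (EFin \o h)).

Lemma eq_cintegral f g : f =1 g -> cintegral mu f = cintegral mu g.
Proof. by move/funext => ->. Qed.

Lemma cmeasurableD f g : cmeasurable f -> cmeasurable g -> cmeasurable (fun x => f x + g x).
Proof.
move=> [fr fi] [gr gi]; split.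
  by under eq_fun do rewrite ReD; exact: measurable_funD.
by under eq_fun do rewrite ImD; exact: measurable_funD.
Qed.

Lemma cmeasurableN f : cmeasurable f -> cmeasurable (fun x => - f x).
Proof.
move=> [fr fi]; split.
  by under eq_fun do rewrite ReN; exact: measurableT_comp.
by under eq_fun do rewrite ImN; exact: measurableT_comp.
Qed.

Lemma cmeasurableB f g : cmeasurable f -> cmeasurable g -> cmeasurable (fun x => f x - g x).
Proof. by move=> mf mg; apply: cmeasurableD => //; exact: cmeasurableN. Qed.

Lemma cmeasurableM f g : cmeasurable f -> cmeasurable g -> cmeasurable (fun x => f x * g x).
Proof.
move=> [fr fi] [gr gi]; split.
  under eq_fun do rewrite ReM; apply: measurable_funB; exact: measurable_funM.
under eq_fun do rewrite ImM; apply: measurable_funD; exact: measurable_funM.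
Qed.

Lemma cmeasurable_cst (c : R[i]) : cmeasurable (fun _ : T => c).
Proof. by split; exact: measurable_cst. Qed.

Lemma cmeasurable_real h : measurable_fun [set: T] h -> cmeasurable (fun x => (h x)%:C).
Proof. by move=> mh; split => //=; exact: measurable_cst. Qed.

Lemma measurable_nc2 f : cmeasurable f -> measurable_fun [set: T] (fun x => nc (f x) ^+ 2).
Proof.
move=> [fr fi]; under eq_fun do rewrite nc_sqr.
by apply: measurable_funD; exact: measurable_funX.
Qed.

Lemma measurable_nc f : cmeasurable f -> measurable_fun [set: T] (fun x => nc (f x)).
Proof.
move=> /measurable_nc2 mf.
have -> : (fun x => nc (f x)) = (fun x => Num.sqrt (nc (f x) ^+ 2)).
  by apply/funext => x; rewrite sqrtr_sqr ger0_norm ?nc_ge0.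
apply: measurableT_comp mf; apply: continuous_measurable_fun; exact: sqrt_continuous.
Qed.

Lemma rintegrable_le h h' : measurable_fun [set: T] h ->
  (forall x, `|h x| <= `|h' x|) -> rintegrable h' -> rintegrable h.
Proof.
move=> mh hh'; apply: le_integrable => //; first exact/measurable_EFinP.
by move=> x _; rewrite /= lee_fin.
Qed.

Lemma rintegrableP h : measurable_fun [set: T] h ->
  (\int[mu]_x (`|h x|)%:E < +oo)%E -> rintegrable h.
Proof.
move=> mh hoo; apply/integrableP; split; first exact/measurable_EFinP.
by rewrite (eq_integral (fun x => (`|h x|)%:E)).
Qed.

Lemma cintegrable_le f h : cmeasurable f -> (forall x, nc (f x) <= h x) ->
  rintegrable h -> cintegrable mu f.
Proof.
move=> [fr fi] fh hi.
have hn x : `|h x| = h x by rewrite ger0_norm// (le_trans (nc_ge0 _) (fh x)).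
split; apply: rintegrable_le hi => // x; rewrite hn; apply: le_trans (fh x).
  exact: Re_le_nc.
exact: Im_le_nc.
Qed.

Lemma cintegrable_cmeasurable f : cintegrable mu f -> cmeasurable f.
Proof.
by move=> [/integrableP[/measurable_EFinP fr _] /integrableP[/measurable_EFinP fi _]].
Qed.

Lemma cintegrable_nc f : cintegrable mu f -> rintegrable (fun x => nc (f x)).
Proof.
move=> fint; have mf := cintegrable_cmeasurable fint; case: fint => fr fi.
apply: (@rintegrable_le _ (fun x => `|Re (f x)| + `|Im (f x)|)).
- exact: measurable_nc.
- move=> x; rewrite ger0_norm ?nc_ge0//.
  exact: le_trans (nc_le_ReIm _) (ler_norm _).
- have := integrableD measurableT (integrable_abse fr) (integrable_abse fi).
  by apply: eq_integrable.
Qed.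

Lemma cintegrableP f : cintegrable mu f <->
  cmeasurable f /\ rintegrable (fun x => nc (f x)).
Proof.
split=> [fi|[mf]]; first by split; [exact: cintegrable_cmeasurable|exact: cintegrable_nc].
by apply: cintegrable_le => // x; exact: lexx.
Qed.

Lemma cintegrableD f g : cintegrable mu f -> cintegrable mu g ->
  cintegrable mu (fun x => f x + g x).
Proof.
move=> [fr fi] [gr gi]; split.
  by apply: eq_integrable (integrableD measurableT fr gr) => // x _; rewrite /= ReD.
by apply: eq_integrable (integrableD measurableT fi gi) => // x _; rewrite /= ImD.
Qed.

Lemma cintegrable_bddM f g (M : R) : cintegrable mu f -> cmeasurable g ->
  (forall x, nc (g x) <= M) -> cintegrable mu (fun x => g x * f x).
Proof.
move=> fi mg gM; have mf := cintegrable_cmeasurable fi.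
have M0 : 0 <= M.
  have [[x]|] := pselect (inhabited T); first exact: le_trans (nc_ge0 _) (gM x).
  by move=> T0; exfalso; apply: T0; constructor; exact: point.
apply: (@cintegrable_le _ (fun x => M * nc (f x))).
- exact: cmeasurableM.
- by move=> x; rewrite ncM ler_wpM2r ?nc_ge0.
- by apply: eq_integrable (integrableZl measurableT M (cintegrable_nc fi)).
Qed.

Lemma cintegrableZ (c : R[i]) f : cintegrable mu f -> cintegrable mu (fun x => c * f x).
Proof.
by move=> fi; apply: (cintegrable_bddM (M := nc c)) => //; exact: cmeasurable_cst.
Qed.

Lemma cintegrableN f : cintegrable mu f -> cintegrable mu (fun x => - f x).
Proof.
by move=> /(cintegrableZ (-1)); congr cintegrable; apply/funext => x; rewrite mulN1r.
Qed.

Lemma cintegrableB f g : cintegrable mu f -> cintegrable mu g ->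
  cintegrable mu (fun x => f x - g x).
Proof. by move=> fi gi; apply: cintegrableD => //; exact: cintegrableN. Qed.

Lemma cintegralD f g : cintegrable mu f -> cintegrable mu g ->
  cintegral mu (fun x => f x + g x) = cintegral mu f + cintegral mu g.
Proof.
move=> [fr fi] [gr gi]; apply: complex_eq; rewrite ?ReD ?ImD/=.
  by rewrite -RintegralD//; apply: eq_Rintegral => x _; rewrite ReD.
by rewrite -RintegralD//; apply: eq_Rintegral => x _; rewrite ImD.
Qed.

Lemma cintegralZ (c : R[i]) f : cintegrable mu f ->
  cintegral mu (fun x => c * f x) = c * cintegral mu f.
Proof.
move=> [fr fi]; apply: complex_eq; rewrite ?ReM ?ImM/=.
  rewrite -!RintegralZl// -RintegralB//; last 2 first.
  - exact: (integrableZl measurableT (Re c) fr).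
  - exact: (integrableZl measurableT (Im c) fi).
  by apply: eq_Rintegral => x _; rewrite ReM.
rewrite -!RintegralZl// -RintegralD//; last 2 first.
- exact: (integrableZl measurableT (Re c) fi).
- exact: (integrableZl measurableT (Im c) fr).
by apply: eq_Rintegral => x _; rewrite ImM.
Qed.

Lemma cintegralB f g : cintegrable mu f -> cintegrable mu g ->
  cintegral mu (fun x => f x - g x) = cintegral mu f - cintegral mu g.
Proof.
move=> fi gi; rewrite cintegralD//; last exact: cintegrableN.
congr (_ + _); rewrite -mulN1r -cintegralZ//; congr cintegral.
by apply/funext => x; rewrite mulN1r.
Qed.

Lemma cintegral0 : cintegral mu (fun _ => 0) = 0.
Proof. by rewrite /cintegral /Rintegral/= !integral0. Qed.

Lemma cintegral_conj f :
  cintegrable mu f -> cintegral mu (fun x => (f x)^*%C) = (cintegral mu f)^*%C.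
Proof.
move=> [fr fi]; apply: complex_eq => /=.
  by apply: eq_Rintegral => x _; case: (f x).
rewrite -[RHS]mulN1r -RintegralZl//; apply: eq_Rintegral => x _.
by rewrite mulN1r; case: (f x).
Qed.

(* The factor [2] avoids the rotation argument and is harmless in all estimates. *)
Lemma nc_cintegral_le f h : cmeasurable f -> (forall x, nc (f x) <= h x) ->
  rintegrable h -> nc (cintegral mu f) <= 2 * \int[mu]_x h x.
Proof.
move=> mf fh hi; have [fr fi] := cintegrable_le mf fh hi.
apply: le_trans (nc_le_ReIm _) _; rewrite mulr_natl mulr2n /=.
apply: lerD; apply: le_trans (le_normr_Rintegral _ _) _ => //; apply: le_Rintegral => //.
- exact: integrable_norm fr.
- by move=> x _; apply: le_trans (fh x); exact: Re_le_nc.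
- exact: integrable_norm fi.
- by move=> x _; apply: le_trans (fh x); exact: Im_le_nc.
Qed.

End ComplexIntegral.

Lemma geometric_nneseries_le (R : realType) (C q : R) : 0 <= C -> 0 <= q -> q < 1 ->
  (\sum_(0 <= i <oo) (C * q ^+ i)%:E <= (C / (1 - q))%:E)%E.
Proof.
move=> C0 q0 q1; have u0 (i : nat) : (0 <= (C * q ^+ i)%:E)%E.
  by rewrite lee_fin mulr_ge0// exprn_ge0.
apply: lime_le; first by apply: is_cvg_nneseries.
apply: nearW => n; rewrite sumEFin lee_fin.
have q1' : 0 < 1 - q by rewrite subr_gt0.
have -> : C / (1 - q) = \sum_(0 <= i < n) C * q ^+ i + C * q ^+ n / (1 - q).
  elim: n => [|n IH]; first by rewrite big_geq// expr0 mulr1 add0r.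
  by rewrite big_nat_recr//= {1}IH exprS; field; rewrite lt0r_neq0.
by rewrite lerDl mulr_ge0 ?invr_ge0 ?mulr_ge0 ?exprn_ge0// ltW.
Qed.

(** * Weighted square norms, Fatou's lemma and completeness of L^2 *)

Section L2.
Context d (T : measurableType d) (R : realType) (mu : {measure set T -> \bar R}).
Implicit Types (f g : T -> R[i]) (w h : T -> R).
Local Notation nc := (@Normc.normc R).
Local Notation rintegrable h := (mu.-integrable [set: T] (EFin \o h)).

Lemma ge0_dominated_cvg0 (u : nat -> T -> R) h :
  (forall k, measurable_fun [set: T] (u k)) -> (forall k x, 0 <= u k x <= h x) ->
  {ae mu, forall x, u k x @[k --> \oo] --> (0 : R)} -> rintegrable h ->
  (\int[mu]_x (u k x)%:E)%E @[k --> \oo] --> 0%E.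
Proof.
move=> mu_ uh u0 hi.
have [] := @dominated_convergence _ _ _ mu setT measurableT
  (fun k x => (u k x)%:E) (cst 0%E) (EFin \o h).
- by move=> k; exact/measurable_EFinP.
- exact: measurable_cst.
- by apply: filterS u0 => x ux _; apply/fine_cvgP; split; first exact: nearW.
- exact: hi.
- by apply: aeW => x k _; have /andP[u0' uh'] := uh k x; rewrite /= ger0_norm// lee_fin.
by move=> _ _; rewrite integral0.
Qed.

Lemma wnorm2_ge0 w f : (forall x, 0 <= w x) -> (0 <= wnorm2 mu w f)%E.
Proof. by move=> w0; apply: integral_ge0 => x _; rewrite lee_fin mulr_ge0// sqr_ge0. Qed.

Lemma measurable_wnc2 w f : measurable_fun [set: T] w -> cmeasurable f ->
  measurable_fun [set: T] (fun x => w x * nc (f x) ^+ 2).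
Proof. by move=> mw mf; apply: measurable_funM => //; exact: measurable_nc2. Qed.

Lemma wnorm2_le w w' f g : measurable_fun [set: T] w -> cmeasurable f ->
  measurable_fun [set: T] w' -> cmeasurable g -> (forall x, 0 <= w x) ->
  (forall x, w x * nc (f x) ^+ 2 <= w' x * nc (g x) ^+ 2) ->
  (wnorm2 mu w f <= wnorm2 mu w' g)%E.
Proof.
move=> mw mf mw' mg w0 fg; apply: ge0_le_integral => //.
- by move=> x _; rewrite lee_fin mulr_ge0// sqr_ge0.
- by apply/measurable_EFinP; exact: measurable_wnc2.
- by apply/measurable_EFinP; exact: measurable_wnc2.
- by move=> x _; rewrite lee_fin.
Qed.

Lemma wnorm2D w f g : measurable_fun [set: T] w -> (forall x, 0 <= w x) ->
  cmeasurable f -> cmeasurable g ->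
  (wnorm2 mu w (fun x => (f x + g x)%R) <= 2%:E * wnorm2 mu w f + 2%:E * wnorm2 mu w g)%E.
Proof.
move=> mw w0 mf mg; have m2 f' : cmeasurable f' ->
    measurable_fun setT (fun x => (w x * nc (f' x) ^+ 2)%:E).
  by move=> mf'; apply/measurable_EFinP; exact: measurable_wnc2.
have p2 f' x : (0 <= (w x * nc (f' x) ^+ 2)%:E)%E by rewrite lee_fin mulr_ge0// sqr_ge0.
rewrite /wnorm2 -!ge0_integralZl_EFin//; try exact: m2.
rewrite -ge0_integralD//; last 4 first.
- by move=> x _; rewrite mule_ge0// lee_fin.
- by apply: measurable_funeM; exact: m2.
- by move=> x _; rewrite mule_ge0// lee_fin.
- by apply: measurable_funeM; exact: m2.
apply: ge0_le_integral => //.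
- by move=> x _; exact: (p2 (fun x => f x + g x)).

- by apply: m2; exact: cmeasurableD.
- by apply: emeasurable_funD; apply: measurable_funeM; exact: m2.
- move=> x _; rewrite -!EFinM -EFinD lee_fin.
  have := nc_sqrD (f x) (g x); have := w0 x.
  move: (w x) (nc _ ^+ 2) (nc (f x) ^+ 2) (nc (g x) ^+ 2) => a b c e a0 bce.
  by rewrite !mulrA ![2 * a]mulrC -!mulrA -mulrDr ler_wpM2l.
Qed.

Lemma wnorm2_triangle w f g (h : T -> R[i]) : measurable_fun [set: T] w -> (forall x, 0 <= w x) ->
  cmeasurable f -> cmeasurable g -> cmeasurable h ->
  (wnorm2 mu w (fun x => (f x - h x)%R) <=
   2%:E * wnorm2 mu w (fun x => (f x - g x)%R) + 2%:E * wnorm2 mu w (fun x => (g x - h x)%R))%E.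
Proof.
move=> mw w0 mf mg mh; have := wnorm2D mw w0 (cmeasurableB mf mg) (cmeasurableB mg mh).
by under [in X in wnorm2 _ _ X]eq_fun do rewrite subrKA.
Qed.

Lemma wnorm2C w f g : wnorm2 mu w (fun x => f x - g x) = wnorm2 mu w (fun x => g x - f x).
Proof. by apply: eq_integral => x _; rewrite ncBC. Qed.

(** Lower semicontinuity of the weighted norm. It is used to let one index of a Cauchy estimate tend
    to infinity once a pointwise limit is known. *)
Lemma wnorm2_fatou w (s : nat -> T -> R[i]) f (c : \bar R) :
  measurable_fun [set: T] w -> (forall x, 0 <= w x) ->
  (forall k, cmeasurable (s k)) -> cmeasurable f ->
  {ae mu, forall x, nc (s k x - f x) @[k --> \oo] --> (0 : R)} ->
  (forall k, wnorm2 mu w (s k) <= c)%E -> (wnorm2 mu w f <= c)%E.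
Proof.
move=> mw w0 ms mf sf sc.
pose F k x := (w x * nc (s k x) ^+ 2)%:E.
have mF k : measurable_fun setT (F k) by apply/measurable_EFinP; exact: measurable_wnc2.
have F0 k x : setT x -> (0 <= F k x)%E by rewrite lee_fin mulr_ge0// sqr_ge0.
apply: (@le_trans _ _ (\int[mu]_x limn_einf (F^~ x))%E); last first.
  apply: le_trans (fatou mu measurableT mF F0) _.
  rewrite limn_einf_lim; apply: lime_le; first exact: is_cvg_einfs.
  apply: nearW => k; apply: le_trans (sc k); apply: ereal_inf_lbound.
  by exists k => //=.
apply: ae_ge0_le_integral => //.
- by move=> x _; rewrite lee_fin mulr_ge0// sqr_ge0.
- by apply/measurable_EFinP; exact: measurable_wnc2.
- move=> x _; rewrite limn_einf_lim; apply: lime_ge; first exact: is_cvg_einfs.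
  by apply: nearW => k; apply: le_ereal_inf_tmp => _ [m _ <-]; exact: F0.
- apply: measurableT_comp => //.
  apply: (measurable_fun_limn_esup (f := fun k x => (- F k x)%E)) => k.
  by apply: measurableT_comp => //; exact: mF.
apply: filterS sf => x sfx _.
have ncs : nc (s k x) @[k --> \oo] --> nc (f x).
  apply/cvgrPdist_le => e e0; move/cvgrPdist_le : sfx => /(_ e e0).
  apply: filterS => k; rewrite sub0r normrN ger0_norm ?nc_ge0//; apply: le_trans.
  rewrite distrC ler_norml; apply/andP; split.
    by rewrite lerNl opprB lerBlDr ncBC -{1}(subrK (s k x) (f x)) ncD.
  by rewrite lerBlDr -{1}(subrK (f x) (s k x)) ncD.
have /cvg_limn_einf_sup[-> _] : F k x @[k --> \oo] --> (w x * nc (f x) ^+ 2)%:E.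
  by apply: cvg_EFin; [exact: nearW|exact: (cvgM (cvg_cst (w x)) (cvgM ncs ncs))].
exact: lexx.
Qed.

Lemma le_limn_cvg0 (u v : nat -> R) : (forall k, 0 <= u k <= v k) ->
  v k @[k --> \oo] --> (0 : R) -> u k @[k --> \oo] --> (0 : R).
Proof.
move=> uv v0; apply: (squeeze_cvgr (f := fun=> 0) (h := v)) => //; last exact: cvg_cst.
exact: nearW.
Qed.

Lemma geometric_increments_cvg (u : nat -> R) (C : R) :
  (forall i, `|u i.+1 - u i| <= C * 2^-1 ^+ i) -> cvgn u.
Proof.
move=> uC; have C0 : 0 <= C.
  by have := uC 0%N; rewrite expr0 mulr1; apply: le_trans.
have h1 : `|2^-1 : R| < 1 by rewrite ger0_norm ?invr_ge0// invf_lt1// ltr1n.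
have : cvgn (series (telescope u)).
  apply: normed_cvg; apply: series_le_cvg (is_cvg_geometric_series (a := C) h1).
  - by move=> k /=.
  - by move=> k; rewrite /geometric /= mulr_ge0// exprn_ge0// invr_ge0.
  - by move=> k; rewrite /telescope /geometric/=; exact: uC.
rewrite telescopeK => cu.
have -> : u = (fun k => (u k - u 0%N) + u 0%N) by apply/funext => k; rewrite subrK.
by apply: is_cvgD => //; exact: is_cvg_cst.
Qed.

Lemma cvg_abs0 (u : nat -> R) (l : R) : u k @[k --> \oo] --> l ->
  `|u k - l| @[k --> \oo] --> (0 : R).
Proof.
move=> ul; have := cvg_norm (cvgB ul (cvg_cst l)).
by rewrite subrr normr0; exact.
Qed.

Lemma ge0_cvge0P (u : nat -> \bar R) : (forall k, 0 <= u k)%E ->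
  u k @[k --> \oo] --> 0%E <->
  (forall e : R, 0 < e -> exists N, forall k, (N <= k)%N -> (u k <= e%:E)%E).
Proof.
move=> u0; split=> [/fine_cvgP[ufin /cvgrPdist_le ue] e e0|ue].
  have [N _ NP] := filterI ufin (ue e e0); exists N => k Nk.
  have [/= uk] := NP k Nk; rewrite sub0r normrN ger0_norm ?fine_ge0// => uke.
  by rewrite -(fineK uk) lee_fin.
apply/fine_cvgP; split.
  have [N NP] := ue 1 ltr01; exists N => // k /= Nk.
  by rewrite ge0_fin_numE// (le_lt_trans (NP k Nk))// ltry.
apply/cvgrPdist_le => e e0; have [N NP] := ue e e0; exists N => // k /= Nk.
rewrite sub0r normrN ger0_norm ?fine_ge0// -lee_fin fineK ?NP//.
by rewrite ge0_fin_numE// (le_lt_trans (NP k Nk))// ltry.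
Qed.

(** The Riesz-Fischer argument: a rapidly Cauchy subsequence converges almost everywhere, and
    Fatou's lemma turns this into convergence of the whole sequence in norm. *)
Lemma L2_complete (s : nat -> T -> R[i]) : (forall k, cmeasurable (s k)) ->
  (forall e : R, 0 < e -> exists N, forall i j, (N <= i)%N -> (N <= j)%N ->
    (wnorm2 mu (fun=> 1%R) (fun x => s i x - s j x)%R <= e%:E)%E) ->
  exists2 g, cmeasurable g & wnorm2 mu (fun=> 1%R) (fun x => s k x - g x) @[k --> \oo] --> 0%E.
Proof.
move=> ms sC.
have m1 : measurable_fun [set: T] (fun=> 1 : R) by exact: measurable_cst.
have p1 (x : T) : 0 <= 1 :> R by [].
have e0 i : 0 < 8^-1 ^+ i :> R by rewrite exprn_gt0// invr_gt0.
have /choice[K KP] : forall i : nat, exists N, forall k j, (N <= k)%N -> (N <= j)%N ->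
    (wnorm2 mu (fun=> 1%R) (fun x => s k x - s j x)%R <= (8^-1 ^+ i)%:E)%E.
  by move=> i; exact: sC.
(* Summing successors of the thresholds makes [kap] monotone and at least both [K i] and i. *)
pose kap i := (\sum_(j < i.+1) (K j).+1)%N.
have kapK i : (K i <= kap i)%N.
  by rewrite /kap big_ord_recr/= addnS leqW// leq_addl.
have kapS i : (kap i <= kap i.+1)%N by rewrite {2}/kap big_ord_recr/= leq_addr.
have kapi i : (i <= kap i)%N.
  elim: i => // i IH; rewrite {1}/kap big_ord_recr/= -/(kap i) addnS ltnS.
  by rewrite (leq_trans IH)// leq_addr.
(* The squared increments have integral at most 8^-i, so with weights 4^i they still sum to a finite
   integral. A finite sum M at x then gives increments at most (M + 1) 2^-i, because M <= (M +
   1)^2. *)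
pose D i x := 4 ^+ i * nc (s (kap i.+1) x - s (kap i) x) ^+ 2.
have mD i : measurable_fun setT (EFin \o D i).
  by apply/measurable_EFinP; apply: measurable_wnc2 => //; exact: cmeasurableB.
have D0 i x : 0 <= D i x by rewrite mulr_ge0 ?exprn_ge0 ?nc_ge0//.
have mG : measurable_fun setT (fun x => \sum_(0 <= i <oo) (D i x)%:E)%E.
  apply: ge0_emeasurable_sum; last by move=> *; exact: mD.
  by move=> k x _ _; rewrite lee_fin.
have GI : mu.-integrable setT (fun x => \sum_(0 <= i <oo) (D i x)%:E)%E.
  apply/integrableP; split=> //.
  rewrite (eq_integral (fun x => \sum_(0 <= i <oo) (D i x)%:E)%E); last first.
    by move=> x _; rewrite gee0_abs// nneseries_ge0// => *; rewrite lee_fin.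
  rewrite integral_nneseries//; last by move=> *; rewrite lee_fin.
  apply: (@le_lt_trans _ _ (\sum_(0 <= i <oo) (1 * (2^-1 : R) ^+ i)%:E)%E).
    apply: lee_nneseries => [i _ _|i _]; first by apply: integral_ge0 => *; rewrite lee_fin.
    have -> : (\int[mu]_x (D i x)%:E = (4 ^+ i)%:E *
        wnorm2 mu (fun=> 1%R) (fun x => (s (kap i.+1) x - s (kap i) x)%R))%E.
      rewrite /wnorm2 -ge0_integralZl_EFin ?exprn_ge0//.
      - by apply: eq_integral => x _; rewrite mul1r.
      - by move=> x _; rewrite lee_fin mul1r sqr_ge0.
      - by apply/measurable_EFinP; apply: measurable_wnc2 => //; exact: cmeasurableB.
    apply: (@le_trans _ _ ((4 ^+ i)%:E * (8^-1 ^+ i)%:E)%E).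
      rewrite lee_wpmul2l ?lee_fin ?exprn_ge0//; apply: KP; last exact: kapK.
      exact: leq_trans (kapK i) (kapS i).
    rewrite -EFinM lee_fin mul1r -exprMn.
    by rewrite (_ : 4 * 8^-1 = 2^-1 :> R)//; field.
  apply: (le_lt_trans (geometric_nneseries_le _ _ _)); rewrite ?ltry//.
  by rewrite invf_lt1// ltr1n.
(* Upper limits are measurable on the whole space, so no exceptional set has to be removed; wherever
   the subsequence converges they are its limit. *)
pose lr x := limn_esup (fun i => (complex.Re (s (kap i) x))%:E).
pose li x := limn_esup (fun i => (complex.Im (s (kap i) x))%:E).
pose g x := Complex (fine (lr x)) (fine (li x)).
have mg : cmeasurable g.
  have mlr : measurable_fun setT lr.
    apply: (measurable_fun_limn_esup (f := fun i x => (complex.Re (s (kap i) x))%:E)) => i.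
    by apply/measurable_EFinP; case: (ms (kap i)).
  have mli : measurable_fun setT li.
    apply: (measurable_fun_limn_esup (f := fun i x => (complex.Im (s (kap i) x))%:E)) => i.
    by apply/measurable_EFinP; case: (ms (kap i)).
  have mr : measurable_fun setT (fine \o lr) by apply: measurableT_comp.
  have mi : measurable_fun setT (fine \o li) by apply: measurableT_comp.
  by split; [exact: mr|exact: mi].
have sg : {ae mu, forall x, nc (s (kap i) x - g x) @[i --> \oo] --> (0 : R)}.
  apply: filterS (integrable_ae measurableT GI) => x /(_ I) Gfin.
  set M := fine (\sum_(0 <= i <oo) (D i x)%:E)%E.
  have DM i : D i x <= M.
    rewrite -lee_fin fineK//; apply: le_trans (nneseries_lim_ge i.+1 _); last by move=> *; rewrite lee_fin.
    rewrite big_nat_recr//= leeDr// sume_ge0// => *; exact: D0.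
  have M0 : 0 <= M by exact: le_trans (D0 0%N x) (DM 0%N).
  have inc i : nc (s (kap i.+1) x - s (kap i) x) <= (M + 1) * 2^-1 ^+ i.
    rewrite -(@ler_pXn2r _ 2)// ?nnegrE ?nc_ge0 ?mulr_ge0 ?exprn_ge0 ?invr_ge0 ?addr_ge0//.
    have := DM i; rewrite /D mulrC -ler_pdivlMr ?exprn_gt0// => /le_trans; apply.
    rewrite exprMn -exprM mulnC exprM (_ : 2^-1 ^+ 2 = 4^-1 :> R); last by field.
    rewrite exprVn ler_wpM2r// ?invr_ge0 ?exprn_ge0//.
    by clear -M0; nra.
  have cr : cvgn (fun i => complex.Re (s (kap i) x)).
    apply: (@geometric_increments_cvg _ (M + 1)) => i; apply: le_trans (inc i).
    by rewrite -ReN -ReD; exact: Re_le_nc.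
  have ci : cvgn (fun i => complex.Im (s (kap i) x)).
    apply: (@geometric_increments_cvg _ (M + 1)) => i; apply: le_trans (inc i).
    by rewrite -ImN -ImD; exact: Im_le_nc.
  have lrE : lr x = (limn (fun i => complex.Re (s (kap i) x)))%:E.
    by apply: (cvg_limn_einf_sup _).2; apply: cvg_EFin => //; exact: nearW.
  have liE : li x = (limn (fun i => complex.Im (s (kap i) x)))%:E.
    by apply: (cvg_limn_einf_sup _).2; apply: cvg_EFin => //; exact: nearW.
  have ar := cvg_abs0 cr; have ai := cvg_abs0 ci.
  have ari := cvgD ar ai; rewrite addr0 in ari.
  apply: (le_limn_cvg0 _ (ari _)) => i.
  by rewrite nc_ge0/= /g lrE liE (le_trans (nc_le_ReIm _))// ReD ImD ReN ImN.
exists g => //; apply/ge0_cvge0P; first by move=> k; exact: wnorm2_ge0.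
move=> e e1; have [N NP] := sC e e1; exists N => k Nk.
apply: (wnorm2_fatou (s := fun i x => s k x - s (kap (i + N)%N) x)) => //.
- by move=> i; exact: cmeasurableB.
- exact: cmeasurableB.
- apply: filterS sg => x sx.
  have sx' : nc (s (kap (i + N)%N) x - g x) @[i --> \oo] --> (0 : R).
    by rewrite (cvg_shiftn N (fun i => nc (s (kap i) x - g x))).
  apply: (le_limn_cvg0 _ sx') => i; rewrite nc_ge0/=.
  by rewrite ncBC (_ : _ - _ = s (kap (i + N)%N) x - g x)//; ring.
- by move=> i; apply: NP => //; rewrite (leq_trans _ (kapi _))// leq_addl.
Qed.

End L2.

Lemma conjM (R : realType) (z w : R[i]) : (z * w)^*%C = z^*%C * w^*%C.
Proof. by case: z w => a b [c e]; apply: complex_eq => /=; ring. Qed.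

(** * Fourier transform of step functions *)

Section FourierSteps.
Context (R : realType) (p : nat) (p_pr : prime p) (n : nat).
Local Notation K := (Qp p_pr).
Local Notation V := ('rV[K]_n).
Local Notation VB := (QpnBorel p_pr n).
Local Notation P := (p%:R : R).
Local Notation nc := (@Normc.normc R).
Implicit Types (x y xi h : V) (f g : V -> R[i]).

Definition vcont f := forall x (e : R), 0 < e ->
  exists k : nat, forall y, B (- k%:Z) (y - x) -> nc (f y - f x) < e.

Lemma measurable_rcont (u : V -> R) : (forall x (e : R), 0 < e ->
    exists k : nat, forall y, B (- k%:Z) (y - x) -> `|u y - u x| < e) ->
  measurable_fun [set: VB] (u : VB -> R).
Proof.
move=> uc _; apply: (measurability _ (RGenOInfty.measurableE R)) => //.
move=> _ [_ [a ->] <-]; rewrite setTI; apply: open_measurableV.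
apply: open_B_invariant => x /=; rewrite in_itv/= andbT => ax.
have [k kP] := uc x (u x - a) (ltac:(by rewrite subr_gt0)).
exists k => y /kP; rewrite /= in_itv/= andbT ltr_norml => /andP[+ _].
by rewrite opprB ltrBrDr subrK.
Qed.

Lemma vcont_cmeasurable f : vcont f -> cmeasurable (f : VB -> R[i]).
Proof.
move=> fc; split; apply: measurable_rcont => x e e0; have [k kP] := fc x e e0;
  exists k => y /kP; apply: le_lt_trans.
  by rewrite -ReN -ReD; exact: Re_le_nc.
by rewrite -ImN -ImD; exact: Im_le_nc.
Qed.

Lemma locally_constant_vcont f : (forall x, exists k : nat,
  forall y, B (- k%:Z) (y - x) -> f y = f x) -> vcont f.
Proof.
move=> fc x e e0; have [k kP] := fc x; exists k => y /kP ->.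
by rewrite subrr nc0.
Qed.

(* [chr false] is the character of the inverse transform, [chr true] that of
   the direct one. *)
Definition chr (b : bool) x xi : R[i] := Psi R ((-1) ^+ b * dotp x xi).

Lemma chr_false x xi : chr false x xi = Psi R (dotp x xi).
Proof. by rewrite /chr expr0 mul1r. Qed.

Lemma chrC b x y : chr b x y = chr b y x.
Proof. by rewrite /chr dotpC. Qed.

Lemma chrDr b x y z : chr b x (y + z) = chr b x y * chr b x z.
Proof. by rewrite /chr dotpDr mulrDr PsiD. Qed.

Lemma chrDl b x y z : chr b (x + y) z = chr b x z * chr b y z.
Proof. by rewrite chrC chrDr !(chrC _ z). Qed.

Lemma nc_chr b x y : nc (chr b x y) = 1.
Proof. exact: normc_Psi. Qed.

Lemma chr0r b x : chr b x 0 = 1.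
Proof. by rewrite /chr dotp0r mulr0 Psi0. Qed.

Lemma chrN b x y : chr (~~ b) x y = chr b (- x) y.
Proof. by rewrite /chr dotpNl mulrN -mulNr; case: b; rewrite /= ?expr1 ?expr0 ?opprK. Qed.

Lemma chr_conj b x y : (chr b x y)^*%C = chr (~~ b) x y.
Proof. by rewrite chrN /chr dotpNl mulrN PsiN. Qed.

Lemma chr_eq1 b j x y : B j x -> B (- j) y -> chr b x y = 1.
Proof.
move=> xj yj; rewrite /chr Psi_Zp//.
have : Qball 0 ((-1) ^+ b * dotp x y).
  have := dotp_Qball xj yj; rewrite subrr => d0; case: b => /=.
    by rewrite expr1 mulN1r; exact: QballN.
  by rewrite expr0 mul1r.
by rewrite QballE expr0z.
Qed.

Lemma chr_neq1 b j x : ~ B (j - 1) x -> exists2 h, B (1 - j) h & chr b x h <> 1.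
Proof.
move=> /(dual_vector R)[h hj h1]; exists h; first exact: hj.
rewrite /chr; case: b; last first.
  by rewrite expr0 mul1r.
rewrite expr1 mulN1r PsiN => c1; apply: h1.
by rewrite -[LHS]conjcK c1 conjc1.
Qed.

Lemma vcont_chr b x : vcont (chr b x).
Proof.
apply: locally_constant_vcont => y; have [j xj] := B_bounded x.
exists j => z zy; rewrite -(subrK y z) chrDr (chr_eq1 b xj zy) mul1r//.
Qed.

Lemma cmeasurable_chr b x : cmeasurable (chr b x : VB -> R[i]).
Proof. exact: vcont_cmeasurable (vcont_chr b x). Qed.

Variable mu : {measure set VB -> \bar R}.
Local Notation rintegrable u := (mu.-integrable [set: VB] (EFin \o (u : VB -> R))).
Local Notation cint f := (cintegral mu (f : VB -> R[i])).
Local Notation cintble f := (cintegrable mu (f : VB -> R[i])).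

Definition FT b g x : R[i] := cint (fun xi => chr b x xi * g xi).

Lemma eq_FT b b' g g' x x' : (forall y, chr b x y * g y = chr b' x' y * g' y) ->
  FT b g x = FT b' g' x'.
Proof. by move=> e; apply: eq_cintegral => y; exact: e. Qed.

Lemma fourier_FT g : fourier mu g = FT true g.
Proof.
apply/funext => xi; apply: eq_cintegral => x.
by rewrite /chr expr1 mulN1r dotpC.
Qed.

Lemma cintegrable_chr b g x : cintble g -> cintble (fun xi => chr b x xi * g xi).
Proof.
move=> gi; apply: (cintegrable_bddM (M := 1)) => //; first exact: cmeasurable_chr.
by move=> y; rewrite nc_chr.
Qed.

Lemma FTD b f g : cintble f -> cintble g -> FT b (fun x => f x + g x) = fun x => FT b f x + FT b g x.
Proof.
move=> fi gi; apply/funext => x; rewrite /FT -cintegralD; try exact: cintegrable_chr.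
by apply: eq_cintegral => y; rewrite mulrDr.
Qed.

Lemma FTB b f g : cintble f -> cintble g -> FT b (fun x => f x - g x) = fun x => FT b f x - FT b g x.
Proof.
move=> fi gi; apply/funext => x; rewrite /FT -cintegralB; try exact: cintegrable_chr.
by apply: eq_cintegral => y; rewrite mulrBr.
Qed.

Lemma FTZ b (c : R[i]) f : cintble f -> FT b (fun x => c * f x) = fun x => c * FT b f x.
Proof.
move=> fi; apply/funext => x; rewrite /FT -cintegralZ; last exact: cintegrable_chr.
by apply: eq_cintegral => y; rewrite mulrCA.
Qed.

Lemma FT0 b : FT b (fun=> 0) = fun=> 0.
Proof.
apply/funext => x; rewrite /FT -[RHS](cintegral0 mu); congr (cintegral mu _).
by apply/funext => y; rewrite mulr0.
Qed.

Lemma FT_conj b g x : cintble g -> (FT b g x)^*%C = FT (~~ b) (fun y => (g y)^*%C) x.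
Proof.
move=> gi; rewrite /FT -cintegral_conj; last exact: cintegrable_chr.
by apply: eq_cintegral => y; rewrite conjM chr_conj.
Qed.

Lemma nc_FT_le b g x (u : V -> R) : cmeasurable (g : VB -> R[i]) ->
  (forall y, nc (g y) <= u y) -> rintegrable u ->
  nc (FT b g x) <= 2 * Rintegral mu [set: VB] (u : VB -> R).
Proof.
move=> mg gu ui; apply: nc_cintegral_le => //.
- by apply: cmeasurableM => //; exact: cmeasurable_chr.
- by move=> y; rewrite ncM nc_chr mul1r.
Qed.

Hypothesis mu_haar : normalized_haar mu.

Lemma Rintegral_translate (a : V) (u : V -> R) : measurable_fun [set: VB] (u : VB -> R) ->
  Rintegral mu [set: VB] (fun x : V => u (x - a)) = Rintegral mu [set: VB] (u : VB -> R).
Proof.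
move=> mu_; rewrite /Rintegral; congr fine.
have mE : measurable_fun [set: VB] (EFin \o (u : VB -> R)) by exact/measurable_EFinP.
rewrite integralE [RHS]integralE; congr (_ - _)%E.
  apply: etrans (ge0_integral_translation mu_haar a (measurable_funepos mE) _).
    by apply: eq_integral => x _; rewrite !funepos.unlock.
  by move=> x; exact: funepos_ge0.
apply: etrans (ge0_integral_translation mu_haar a (measurable_funeneg mE) _).
  by apply: eq_integral => x _; rewrite !funeneg.unlock.
by move=> x; exact: funeneg_ge0.
Qed.

Lemma cintegral_translate (a : V) g : cmeasurable (g : VB -> R[i]) ->
  cint (fun x => g (x - a)) = cint g.
Proof.
move=> [gr gi]; apply: complex_eq => /=.
  exact: (Rintegral_translate a gr).
exact: (Rintegral_translate a gi).
Qed.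

(* Translating [g] by [h] multiplies its transform at [x] by [chr b x h]. *)
Lemma FT_vanish b g x h : cintble g -> (forall y, g (y + h) = g y) ->
  chr b x h <> 1 -> FT b g x = 0.
Proof.
move=> gi gh xh; have E : FT b g x = chr b x h * FT b g x.
  rewrite {1}/FT -(cintegral_translate (- h)); last first.
    by have := cintegrable_cmeasurable (cintegrable_chr b x gi).
  apply: etrans _ (cintegralZ (chr b x h) (cintegrable_chr b x gi)).
  apply: eq_cintegral => y; rewrite opprK gh chrDr mulrAC.
  by rewrite mulrC mulrA.
apply/eqP; apply: contraT => I0; exfalso; apply: xh.
by apply: (mulIf I0); rewrite mul1r -E.
Qed.

Definition ballf (k : int) (a : V) x : R[i] := (\1_([set y | B k (y - a)]) x)%:C.

Lemma ballfE k a x : ballf k a x = if `[< B k (x - a) >] then 1 else 0.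
Proof.
rewrite /ballf indicE; case: asboolP => h; first by rewrite mem_set.
by rewrite memNset.
Qed.

Lemma ballf1 k a x : B k (x - a) -> ballf k a x = 1.
Proof. by move=> h; rewrite ballfE asboolT. Qed.

Lemma ballf0 k a x : ~ B k (x - a) -> ballf k a x = 0.
Proof. by move=> h; rewrite ballfE asboolF. Qed.

Lemma rintegrable_ball k a : rintegrable (\1_([set y : V | B k (y - a)]) : V -> R).
Proof.
have mA := measurable_coset (p_pr := p_pr) k a.
apply: rintegrableP; first exact: measurable_indic.
under eq_integral do rewrite ger0_norm//.
by rewrite integral_indic// setIT haar_coset// ltry.
Qed.

Lemma Rintegral_ball k a :
  Rintegral mu [set: VB] (\1_([set y : V | B k (y - a)]) : V -> R) = P ^ (k * n%:Z).
Proof.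
rewrite /Rintegral integral_indic//; last exact: measurable_coset.
by rewrite setIT haar_coset.
Qed.

Lemma cintegrable_ballf k a : cintble (ballf k a).
Proof.
split=> /=; first exact: rintegrable_ball.
exact: integrable0.
Qed.

Lemma cintegral_ballf k a : cint (ballf k a) = (P ^ (k * n%:Z))%:C.
Proof.
apply: complex_eq => /=; first exact: Rintegral_ball.
by rewrite /Rintegral integral0.
Qed.

Lemma ballfDr k a x h : B k h -> ballf k a (x + h) = ballf k a x.
Proof.
move=> hk; rewrite !ballfE addrAC.
by have /asbool_equiv_eq -> := BDr (x - a) hk.
Qed.

Lemma ballf_sym k a x : ballf k 0 (a - x) = ballf k a x.
Proof.
have [h|h] := pselect (B k (x - a)).
  have h' : B k (a - x - 0) by rewrite subr0; exact (BBC h).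
  exact: etrans (ballf1 h') (esym (ballf1 h)).
have h' : ~ B k (a - x - 0) by rewrite subr0 => /BBC.
exact: etrans (ballf0 h') (esym (ballf0 h)).
Qed.

(** For x in [B k] the character is constant on the ball, so only its volume remains. For other x
    some period of the ball has a nontrivial character value, and [FT_vanish] applies. *)
Lemma FT_ballf b (k : int) a x :
  FT b (ballf (- k) a) x = (P ^ (- k * n%:Z))%:C * chr b x a * ballf k 0 x.
Proof.
have [xk|xk] := pselect (B k x).
  rewrite (ballf1 (a := 0)) ?subr0// mulr1 mulrC -(cintegral_ballf (- k) a).
  apply: etrans _ (cintegralZ (chr b x a) (cintegrable_ballf (- k) a)).
  apply: eq_cintegral => y.
  case: (pselect (B (- k) (y - a))) => ya; last first.
    by rewrite (ballf0 ya); exact: etrans (mulr0 _) (esym (mulr0 _)).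
  have -> : chr b x y = chr b x (y - a) * chr b x a by rewrite -chrDr subrK.
  by rewrite (chr_eq1 b xk ya) mul1r.
rewrite (ballf0 (a := 0)) ?subr0// mulr0.
have [|h hk h1] := @chr_neq1 b (k + 1) x; first by rewrite addrK.
apply: (FT_vanish _ _ h1); first exact: cintegrable_ballf.
by move=> y; rewrite ballfDr//; move: hk; rewrite opprD addrCA subrr addr0.
Qed.
End FourierSteps.
#[global] Opaque chr ballf Psi padic_abs.

(** * Step functions, stable under the Fourier transform, and inversion on them *)

Section Steps.
Context (R : realType) (p : nat) (p_pr : prime p) (n : nat).
Local Notation K := (Qp p_pr).
Local Notation V := ('rV[K]_n).
Local Notation VB := (QpnBorel p_pr n).
Local Notation P := (p%:R : R).
Implicit Types (x y h a : V) (f g s : V -> R[i]) (k m : nat).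

(** One index bounds both the support and the periods, because the Fourier transform exchanges the
    two conditions and so preserves each level k. *)
Definition step k s := (forall x, ~ B k x -> s x = 0) /\
  (forall x h, B (- k%:Z) h -> s (x + h) = s x).

Lemma step0 k : step k (fun=> 0).
Proof. by []. Qed.

Lemma stepD k f g : step k f -> step k g -> step k (fun x => f x + g x).
Proof.
move=> [f0 fk] [g0 gk]; split=> [x xk|x h hk]; first by rewrite (f0 x xk) (g0 x xk) addr0.
by rewrite (fk x h hk) (gk x h hk).
Qed.

Lemma stepB k f g : step k f -> step k g -> step k (fun x => f x - g x).
Proof.
move=> [f0 fk] [g0 gk]; split=> [x xk|x h hk]; first by rewrite (f0 x xk) (g0 x xk) subr0.
by rewrite (fk x h hk) (gk x h hk).
Qed.

Lemma step_conj k f : step k f -> step k (fun x => (f x)^*%C).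
Proof.
move=> [f0 fk]; split=> [x xk|x h hk]; first by rewrite (f0 x xk) conjc0.
by rewrite (fk x h hk).
Qed.

Lemma step_le k m f : (k <= m)%N -> step k f -> step m f.
Proof.
move=> km [f0 fk]; split=> [x xm|x h hm].
  by apply: f0 => xk; apply: xm; apply: B_le xk; lia.
by apply: fk; apply: B_le hm; lia.
Qed.

Lemma step_mul k (u : V -> R[i]) f : (forall x h, B k x -> B (- k%:Z) h -> u (x + h) = u x) ->
  step k f -> step k (fun x => u x * f x).
Proof.
move=> uk [f0 fk]; split=> [x xk|x h hk]; first by rewrite (f0 x xk) mulr0.
rewrite (fk x h hk); have [xk|xk] := pselect (B k x); first by rewrite (uk x h xk hk).
by rewrite (f0 x xk) !mulr0.
Qed.

Lemma step_ballf k a : B k a -> step k (ballf R (- k%:Z) a).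
Proof.
move=> ak; split=> [x xk|x h hk]; last exact: ballfDr.
apply: ballf0 => xa; apply: xk; rewrite -(subrK a x); apply: BD ak.
by apply: B_le xa; lia.
Qed.

Lemma step_vcont k s : step k s -> vcont s.
Proof.
move=> [_ sk]; apply: locally_constant_vcont => x; exists k => y yx.
by rewrite -{1}(subrK x y) addrC sk.
Qed.

Lemma step_cmeasurable k s : step k s -> cmeasurable (s : VB -> R[i]).
Proof. by move/step_vcont/vcont_cmeasurable. Qed.

(* A step function on a coset of [B (m - k)] splits along its [p ^ n] sub-cosets. *)
Lemma step_ind k (Pr : (V -> R[i]) -> Prop) : Pr (fun=> 0) ->
  (forall (c : R[i]) a, B k a -> Pr (fun x => c * ballf R (- k%:Z) a x)) ->
  (forall f g, step k f -> step k g -> Pr f -> Pr g -> Pr (fun x => f x + g x)) ->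
  forall s, step k s -> Pr s.
Proof.
move=> Pr0 Prb PrD.
have Prsum (I : Type) (r : seq I) (F : I -> V -> R[i]) : (forall i, step k (F i)) ->
    (forall i, Pr (F i)) -> step k (fun x => \sum_(i <- r) F i x) /\ Pr (fun x => \sum_(i <- r) F i x).
  move=> Fk FPr; elim: r => [|i r [IHk IHP]].
    have -> : (fun x : V => \sum_(i <- [::]) F i x) = fun=> 0.
      by apply/funext => x; rewrite big_nil.
    by split; [exact: step0|exact: Pr0].
  have -> : (fun x : V => \sum_(j <- i :: r) F j x) = fun x => F i x + \sum_(j <- r) F j x.
    by apply/funext => x; rewrite big_cons.
  by split; [exact: stepD|exact: PrD].
have claim m : (m <= k + k)%N -> forall a, B k a -> forall s, step k s ->
    (forall x, ~ B (m%:Z - k%:Z) (x - a) -> s x = 0) -> Pr s.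
  elim: m => [_ a ak s sk s0|m IH mk a ak s sk s0].
    rewrite sub0r in s0.
    have -> : s = (fun x => s a * ballf R (- k%:Z) a x).
      apply/funext => x; have [xa|xa] := pselect (B (- k%:Z) (x - a)).
        by rewrite (ballf1 _ xa) mulr1 -{1}(subrK a x) addrC (sk.2 a _ xa).
      by rewrite (ballf0 _ xa) mulr0 (s0 x xa).
    exact: Prb.
  pose j : int := m.+1%:Z - k%:Z.
  have jm : j - 1 = m%:Z - k%:Z by rewrite /j; lia.
  pose F (e : {ffun 'I_n -> 'I_p}) x := ballf R (j - 1) (a + digit_vec p_pr j e) x * s x.
  have -> : s = fun x => \sum_(e <- index_enum {ffun 'I_n -> 'I_p}) F e x.
    apply/funext => x; have [xa|xa] := pselect (B j (x - a)); last first.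
      by rewrite (s0 x xa) big1// => e _; rewrite /F (s0 x xa) mulr0.
    have [e xe] := B_digit xa; rewrite (bigD1 e)//= big1 ?addr0.
      have xae : B (j - 1) (x - (a + digit_vec p_pr j e)) by rewrite opprD addrA; exact: xe.
      by rewrite /F (ballf1 _ xae) mul1r.
    move=> e' /eqP ee; rewrite /F ballf0 ?mul0r// => xe'; apply: ee.
    rewrite opprD addrA in xe'; apply: (@digit_vec_inj _ p_pr _ j).
    exact: (B_trans (BBC xe') xe).
  apply: (Prsum _ _ F _ _).2 => e.
    apply: step_mul sk => x h _ hk; apply: ballfDr; apply: B_le hk; lia.
  apply: (IH _ (a + digit_vec p_pr j e)); first by lia.
  - apply: BD ak _; apply: B_le (digit_vecB p_pr j e); lia.
  - apply: step_mul sk => x h _ hk; apply: ballfDr; apply: B_le hk; lia.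
  - by move=> x; rewrite -jm => xe; rewrite /F (ballf0 _ xe) mul0r.
move=> s sk; have B00 : B k (0 : V) by exact: B0.
apply: (claim (k + k)%N (leqnn _) 0 B00 s sk) => x.
by rewrite subr0 PoszD addrK; exact: sk.1.
Qed.

Variable mu : {measure set VB -> \bar R}.
Hypothesis mu_haar : normalized_haar mu.
Local Notation cint f := (cintegral mu (f : VB -> R[i])).
Local Notation cintble f := (cintegrable mu (f : VB -> R[i])).
Local Notation FT := (FT mu).

Lemma step_cintegrable k s : step k s -> cintble s.
Proof.
apply: (step_ind (k := k)).
- by split; exact: integrable0.
- by move=> c a ak; apply: cintegrableZ; exact: cintegrable_ballf.
- by move=> f g _ _; exact: cintegrableD.
Qed.

(** Support in [B k] makes [B (- k)] a group of periods of the transform, since the characters are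
    trivial there; conversely the periods [B (- k)] of s kill the transform outside [B k]. *)
Lemma step_FT b k s : step k s -> step k (FT b s).
Proof.
move=> sk; have si := step_cintegrable sk; split=> [x xk|x h hk]; last first.
  apply: eq_FT => y; have [yk|yk] := pselect (B k y).
    by rewrite chrDl (@chr_eq1 _ _ _ _ b (- k%:Z) h y hk) ?opprK// mulr1.
  rewrite (sk.1 y yk); exact: etrans (mulr0 _) (esym (mulr0 _)).
have [|h hk h1] := @chr_neq1 R p p_pr n b (k%:Z + 1) x; first by rewrite addrK.
apply: (FT_vanish mu_haar si _ h1) => y; apply: sk.2.
by move: hk; rewrite opprD addrCA subrr addr0.
Qed.

Lemma FT_ballf_step b k a : B k a -> FT b (ballf R (- k%:Z) a) =
  fun x => (P ^ (- k%:Z * n%:Z))%:C * chr R b x a * ballf R k 0 x.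
Proof. by move=> ak; apply/funext => x; exact: FT_ballf. Qed.

Lemma cintegral_chr_ballf b k a x : B k x ->
  cint (fun y => chr R b x y * ballf R (- k%:Z) a y) = (P ^ (- k%:Z * n%:Z))%:C * chr R b x a.
Proof.
move=> xk; rewrite -[LHS]/(FT b (ballf R (- k%:Z) a) x) FT_ballf// ballf1 ?mulr1//.
by rewrite subr0.
Qed.

(** On the indicator of a ball around a, the first transform produces a character at a, which acts
    in the second one as a translation of the argument; the two volumes p^(-k n) and p^(k n)
    cancel. *)
Lemma FT_FT b k s : step k s -> FT (~~ b) (FT b s) = s.
Proof.
apply: (step_ind (k := k) (Pr := fun s => FT (~~ b) (FT b s) = s)).
- by rewrite !FT0.
- move=> c a ak; have si := step_cintegrable (step_ballf ak).
  rewrite (FTZ b c si) FTZ; last exact: step_cintegrable (step_FT b (step_ballf ak)).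
  apply/funext => x; congr (_ * _); rewrite FT_ballf_step//.
  have -> : (fun x => (P ^ (- k%:Z * n%:Z))%:C * chr R b x a * ballf R k 0 x) =
      fun x => (P ^ (- k%:Z * n%:Z))%:C * (chr R b a x * ballf R k 0 x).
    by apply/funext => y; rewrite mulrA (chrC _ b a).
  have bi : cintble (ballf R k 0) by exact: cintegrable_ballf.
  rewrite FTZ; last exact: cintegrable_chr.
  have -> : FT (~~ b) (fun y => chr R b a y * ballf R k 0 y) x = FT b (ballf R k 0) (a - x).
    apply: eq_FT => y; apply: etrans (mulrA _ _ _) _; congr (_ * _).
    by rewrite chrN -chrDl addrC.
  have := @FT_ballf R p p_pr n mu mu_haar b (- k%:Z) 0 (a - x).
  rewrite opprK => ->; rewrite chr0r mulr1 mulrA -rmorphM/= -expfzDr; last first.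
    by rewrite lt0r_neq0// PR_gt0.
  by rewrite -mulrDl addNr mul0r expr0z mul1r ballf_sym.
- move=> f g fk gk Hf Hg; have fi := step_cintegrable fk; have gi := step_cintegrable gk.
  rewrite (FTD b fi gi) FTD ?Hf ?Hg//.
    exact: step_cintegrable (step_FT b fk).
  exact: step_cintegrable (step_FT b gk).
Qed.

End Steps.

(** * The multiplication formula, Parseval's identity and continuity of transforms *)

Section Plancherel.
Context (R : realType) (p : nat) (p_pr : prime p) (n : nat).
Local Notation K := (Qp p_pr).
Local Notation V := ('rV[K]_n).
Local Notation VB := (QpnBorel p_pr n).
Local Notation P := (p%:R : R).
Local Notation nc := (@Normc.normc R).
Implicit Types (x y h a : V) (f g s : V -> R[i]) (k m : nat).
Variable mu : {measure set VB -> \bar R}.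
Hypothesis mu_haar : normalized_haar mu.
Local Notation rintegrable u := (mu.-integrable [set: VB] (EFin \o (u : VB -> R))).
Local Notation cint f := (cintegral mu (f : VB -> R[i])).
Local Notation cintble f := (cintegrable mu (f : VB -> R[i])).
Local Notation FT := (FT mu).
Local Notation Rint u := (Rintegral mu [set: VB] (u : VB -> R)).
Local Notation N2 f := (wnorm2 mu (fun=> 1%R) (f : VB -> R[i])).

Lemma step_bounded k s : step k s -> exists M : R, forall x, nc (s x) <= M.
Proof.
apply: (step_ind (k := k) (Pr := fun s => exists M : R, forall x, nc (s x) <= M)).
- by exists 0 => x; rewrite nc0.
- move=> c a _; exists (nc c) => x; rewrite ncM ballfE -[leRHS]mulr1.
  rewrite ler_wpM2l ?nc_ge0//; case: ifP => _; first by rewrite Normc.normc1.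
  by rewrite nc0.
- move=> f g _ _ [M fM] [N gN]; exists (M + N) => x; apply: le_trans (ncD _ _) _.
  exact: lerD.
Qed.

Lemma step_cintegrableM k f g : step k f -> cintble g -> cintble (fun x => f x * g x).
Proof.
move=> fk gi; have [M fM] := step_bounded fk.
by apply: (cintegrable_bddM (M := M)) => //; exact: step_cmeasurable fk.
Qed.

Lemma pairing_Dl k f g r : step k f -> step k g -> cintble r ->
  cint (fun x => (f x + g x) * r x) = cint (fun x => f x * r x) + cint (fun x => g x * r x).
Proof.
move=> fk gk hi.
rewrite -(cintegralD (step_cintegrableM fk hi) (step_cintegrableM gk hi)).
by apply: eq_cintegral => x; rewrite mulrDl.
Qed.

Lemma pairing_Zl k (c : R[i]) f r : step k f -> cintble r ->
  cint (fun x => (c * f x) * r x) = c * cint (fun x => f x * r x).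
Proof.
move=> fk hi; rewrite -(cintegralZ c (step_cintegrableM fk hi)).
by apply: eq_cintegral => x; rewrite mulrA.
Qed.

Lemma pairingC f g : cint (fun x => f x * g x) = cint (fun x => g x * f x).
Proof. by apply: eq_cintegral => x; rewrite mulrC. Qed.

Lemma FT_mult_ballf b k a a' : B k a -> B k a' ->
  cint (fun x => FT b (ballf R (- k%:Z) a) x * ballf R (- k%:Z) a' x) =
  (P ^ (- k%:Z * n%:Z))%:C * ((P ^ (- k%:Z * n%:Z))%:C * chr R b a a').
Proof.
move=> ak ak'; rewrite -(cintegral_chr_ballf mu_haar b a' ak).
rewrite -cintegralZ; last first.
  apply: cintegrable_chr; exact: cintegrable_ballf.
apply: eq_cintegral => x; rewrite FT_ballf//.
have [xa|xa] := pselect (B (- k%:Z) ((x : V) - a')); last first.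
  rewrite (ballf0 R xa); apply: etrans (mulr0 _) _.
  by apply: esym; apply: etrans (congr1 _ (mulr0 _)) (mulr0 _).
have xk : B k ((x : V) - 0).
  rewrite subr0 -(subrK a' (x : V)); apply: BD ak'; apply: B_le xa; lia.
rewrite (ballf1 R xa) (ballf1 R xk) (chrC _ b x a).
by apply: etrans (mulr1 _) _; apply: etrans (mulr1 _) _; apply: esym; apply: congr1; exact: mulr1.
Qed.

(** Both sides are bilinear, so indicators of balls suffice. There [FT_mult_ballf] gives a value
    symmetric in the two centres, which is the formula; no double integral appears. *)
Lemma FT_mult b k f g : step k f -> step k g ->
  cint (fun x => FT b f x * g x) = cint (fun x => f x * FT b g x).
Proof.
move=> fk gk; pose Pr f g := cint (fun x => FT b f x * g x) = cint (fun x => f x * FT b g x).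
have SFT s : step k s -> step k (FT b s) by exact: step_FT.
have SI s : step k s -> cintble s by exact: step_cintegrable.
have Prsym f' g' : Pr f' g' -> Pr g' f'.
  by move=> H; rewrite /Pr pairingC -H; exact: pairingC.
have Pr0 g' : Pr (fun=> 0) g'.
  rewrite /Pr FT0; apply: etrans (_ : 0 = _).
    by rewrite -[RHS](cintegral0 mu); apply: eq_cintegral => x; exact: mul0r.
  by rewrite -[LHS](cintegral0 mu); apply: eq_cintegral => x; rewrite mul0r.
have PrD f1 f2 g' : step k f1 -> step k f2 -> step k g' -> Pr f1 g' -> Pr f2 g' ->
    Pr (fun x => f1 x + f2 x) g'.
  move=> h1 h2 hg H1 H2; rewrite /Pr FTD; [|exact: SI|exact: SI].
  rewrite (pairing_Dl (SFT _ h1) (SFT _ h2) (SI _ hg)) H1 H2.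
  by rewrite (pairing_Dl h1 h2 (SI _ (SFT _ hg))).
have PrZ c f1 g' : step k f1 -> step k g' -> Pr f1 g' -> Pr (fun x => c * f1 x) g'.
  move=> h1 hg H1; rewrite /Pr FTZ; last exact: SI.
  rewrite (pairing_Zl c (SFT _ h1) (SI _ hg)) H1.
  by rewrite (pairing_Zl c h1 (SI _ (SFT _ hg))).
apply: (step_ind (k := k) (Pr := fun f => Pr f g)) fk.
- exact: Pr0.
- move=> c a ak; apply: (PrZ _ _ _ (step_ballf R ak) gk).
  apply: (step_ind (k := k) (Pr := fun g => Pr (ballf R (- k%:Z) a) g)) gk.
  + by apply: Prsym; exact: Pr0.
  + move=> c' a' ak'; apply: Prsym; apply: PrZ; [exact: step_ballf|exact: step_ballf|].
    rewrite /Pr (FT_mult_ballf b ak' ak) pairingC (FT_mult_ballf b ak ak').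
    by rewrite (chrC _ b a a').
  + move=> g1 g2 h1 h2 H1 H2; apply: (Prsym _ _ _); apply: (PrD _ _ _ h1 h2).
    * exact: step_ballf.
    * exact: Prsym.
    * exact: Prsym.
- by move=> f1 f2 h1 h2; exact: PrD.
Qed.

Lemma step_rintegrable2 k s : step k s -> rintegrable (fun x => nc (s x) ^+ 2).
Proof.
move=> sk; have [M sM] := step_bounded sk.
have si := cintegrable_nc (step_cintegrable mu_haar sk).
apply: (rintegrable_le (h' := (fun x => M * nc (s x)) : VB -> R)).
- by apply: measurable_nc2; exact: step_cmeasurable sk.
- move=> x; rewrite ger0_norm ?sqr_ge0//; apply: le_trans (ler_norm _).
  by rewrite expr2 ler_wpM2r ?nc_ge0.
- by apply: eq_integrable (integrableZl measurableT M si).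
Qed.

Lemma step_N2 k s : step k s -> N2 s = (Rint (fun x => nc (s x) ^+ 2))%:E.
Proof.
move=> sk; have si := step_rintegrable2 sk.
rewrite /wnorm2 /Rintegral fineK; last exact: integrable_fin_num.
by apply: eq_integral => x _; rewrite mul1r.
Qed.

Lemma step_N2_lty k s : step k s -> (N2 s < +oo)%E.
Proof. by move=> /step_N2 ->; rewrite ltry. Qed.

Lemma Re_mul_conj (z : R[i]) : complex.Re (z * z^*%C) = nc z ^+ 2.
Proof. by rewrite nc_sqr; case: z => a b /=; ring. Qed.

(** The conjugate of the transform of s is the opposite transform of the conjugate of s; moving the
    first transform across the pairing undoes it by inversion. *)
Lemma FT_parseval b k s : step k s -> N2 (FT b s) = N2 s.
Proof.
move=> sk; have Fk := step_FT mu_haar b sk.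
rewrite (step_N2 Fk) (step_N2 sk).
have si := step_cintegrable mu_haar sk.
congr EFin; have RE f : Rint (fun x => nc (f x) ^+ 2) = complex.Re (cint (fun x => f x * (f x)^*%C)).
  by apply: eq_Rintegral => x _; rewrite Re_mul_conj.
rewrite !RE; congr complex.Re.
have ck := step_FT mu_haar (~~ b) (step_conj sk).
transitivity (cint (fun x => FT b s x * FT (~~ b) (fun y => (s y)^*%C) x)).
  by apply: eq_cintegral => x; rewrite FT_conj.
rewrite (FT_mult b sk ck); apply: eq_cintegral => x; congr (_ * _).
by rewrite -{1}(negbK b) (FT_FT mu_haar (~~ b) (step_conj sk)).
Qed.

Lemma step_schwartz_bruhat k s : step k s -> schwartz_bruhat s.
Proof.
move=> [s0 sk]; split.
  move=> x; apply/nbhsVP; exists k => y yx.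
  by rewrite -{1}(subrK x y) addrC; exact: sk.
apply: (@subclosed_compact _ _ (B k)); [exact: closed_closure|exact: compact_B|].
have -> : B k = closure (B k : set V) by apply/closure_id; exact: closed_B.
apply: closure_subset => x /= sx; apply: contrapT => xk; move: sx.
by rewrite (s0 x xk) eqxx.
Qed.

(** Choose [B m] carrying almost all of the mass of g. If x - y lies in [B (- m)], the characters at
    x and y agree on [B m], and only the small outer mass contributes. *)
Lemma FT_unif_cont b g : cintble g -> forall e : R, 0 < e -> exists m : nat,
  forall x y, B (- m%:Z) (x - y) -> nc (FT b g x - FT b g y) < e.
Proof.
move=> gi e e0; have mg := cintegrable_cmeasurable gi.
have gn := cintegrable_nc gi.
pose u (m : nat) (z : V) := (1 - \1_([set z : V | B m (z - 0)]) z) * nc (g z) : R.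
have u01 m z : 0 <= u m z <= nc (g z).
  rewrite /u indicE; case: (_ \in _) => /=; rewrite ?subrr ?mul0r ?subr0 ?mul1r ?nc_ge0 ?lexx//.
have mu_ m : measurable_fun [set: VB] (u m : VB -> R).
  apply: measurable_funM; last exact: measurable_nc.
  apply: measurable_funB; first exact: measurable_cst.
  apply: measurable_indic; exact: measurable_coset.
have u0 : (\int[mu]_x (u k x)%:E)%E @[k --> \oo] --> 0%E.
  apply: (ge0_dominated_cvg0 (h := (fun x => nc (g x)) : VB -> R)) => //.
  apply: aeW => z; have [k zk] := B_bounded (z : V).
  apply/cvgrPdist_le => d d0; exists k => // m /= km.
  rewrite /u indicE mem_set/=; last by rewrite subr0; apply: B_le zk; lia.
  by rewrite subrr mul0r subr0 normr0 ltW.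
have I0 m : (0 <= \int[mu]_(x in [set: VB]) (u m x)%:E)%E.
  by apply: integral_ge0 => z _; rewrite lee_fin; case/andP: (u01 m z).
(* One factor 2 comes from the difference of two characters and another from [nc_cintegral_le]: the
   total is 4 e / 5, strictly below e. *)
have [m mP] := (ge0_cvge0P I0).1 u0 (e / 5) (ltac:(by rewrite divr_gt0)).
exists m => x y xy.
have ui : rintegrable (u m).
  apply: rintegrable_le gn => // z; have /andP[z0 zg] := u01 m z.
  by rewrite !ger0_norm// nc_ge0.
have uR : Rint (u m) <= e / 5.
  by rewrite -lee_fin /Rintegral fineK; [exact: mP|exact: integrable_fin_num].
have u2i : rintegrable (fun z => 2 * u m z).
  by apply: eq_integrable (integrableZl measurableT 2 ui).
have -> : FT b g x - FT b g y = cint (fun z => (chr R b x z - chr R b y z) * g z).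
  rewrite -cintegralB; try exact: cintegrable_chr.
  by apply: eq_cintegral => z; rewrite mulrBl.
apply: (@le_lt_trans _ _ (2 * Rint (fun z => 2 * u m z))).
  apply: nc_cintegral_le => //.
    by apply: cmeasurableM => //; apply: cmeasurableB; exact: cmeasurable_chr.
  move=> z; rewrite ncM /u mulrA; apply: ler_wpM2r; first exact: nc_ge0.
  rewrite indicE; have [zm|zm] := pselect (B m ((z : V) - 0)).
    have -> : (z \in [set z0 : V | B m (z0 - 0)]) = true by exact: mem_set.
    rewrite (subrr (1 : R)) (mulr0 (2 : R)).
    have c1 : chr R b (x - y) z = 1.
      by apply: chr_eq1 xy _; rewrite opprK; move: zm; rewrite subr0.
    have -> : chr R b x z = chr R b y z by rewrite -[RHS]mul1r -c1 -chrDl subrK.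
    by rewrite subrr nc0.
  have -> : (z \in [set z0 : V | B m (z0 - 0)]) = false by exact: memNset.
  rewrite subr0 mulr1; apply: le_trans (ncB _ _) _.
  have c1 v : nc (chr R b v z) <= 1 by rewrite nc_chr.
  exact: lerD (c1 x) (c1 y).
rewrite RintegralZl//; lra.
Qed.

Lemma FT_vcont b g : cintble g -> vcont (FT b g).
Proof.
by move=> gi x e e0; have [m mP] := FT_unif_cont b gi e0; exists m => y yx; exact: mP.
Qed.

End Plancherel.

Import (canonicals, coercions) mpoly.

(** * The symbol *)

Section EllipticPolynomials.
Context (R : realType) (p : nat) (p_pr : prime p) (n d : nat).
Local Notation K := (Qp p_pr).
Local Notation V := ('rV[K]_n).
Implicit Types (x y h : V) (j : int).
Variable f : mpoly.mpoly n K.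
Hypothesis f_Zp : Zp_coefs f.
Hypothesis f_elliptic : elliptic f d.

(** The sphere of radius p^j for the maximum norm. *)
Definition level j x := B j x /\ ~ B (j - 1) x.

(** In zero variables every polynomial is constant. Positivity of n is what makes {0} a null set
    later. *)
Lemma elliptic_dim_gt0 : (0 < n)%N.
Proof.
rewrite lt0n; apply/eqP => n0; case: f_elliptic => /(_ (mpoly.mcoeff mpoly.mnm0 f)) + _ _.
apply; apply/mpoly.mpolyP => m; have -> : m = mpoly.mnm0.
  by apply/mpoly.mnmP => i; exfalso; have : (0 < n)%N := leq_ltn_trans (leq0n i) (ltn_ord i); rewrite n0.
by rewrite mpoly.mcoeffC eqxx mulr1.
Qed.

(** A polynomial homogeneous of degree 0 is its constant term. Positivity of d is what makes q =
    p^(alpha d) exceed 1. *)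
Lemma elliptic_degree_gt0 : (0 < d)%N.
Proof.
rewrite lt0n; apply/eqP => d0; case: f_elliptic => /(_ (mpoly.mcoeff mpoly.mnm0 f)) fC fd _.
apply: fC; apply/mpoly.mpolyP => m; rewrite mpoly.mcoeffC.
rewrite -mpoly.mdeg_eq0; case: eqP => [/eqP|md0].
  by rewrite mpoly.mdeg_eq0 => /eqP ->; rewrite mulr1.
rewrite mulr0; apply/eqP; apply: contraT => /fd md.
by exfalso; apply: md0; rewrite md.
Qed.

Lemma fpolyZ (c : K) x : fpoly f (c *: x) = c ^+ d * fpoly f x.
Proof.
case: f_elliptic => _ fd _; rewrite /fpoly !mpoly.mevalE mulr_sumr.
apply: eq_big_seq => m; rewrite mpoly.mcoeff_msupp => /fd md.
rewrite mulrCA; congr (_ * _).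
rewrite -md mpoly.mdegE -prodrXr -big_split/=; apply: eq_bigr => i _.
by rewrite mxE exprMn.
Qed.

(** Congruence modulo p^m between p-adic integers, [rel], is compatible with sums and products, and
    the coefficients of f are integral. *)
Lemma fpoly_congr (m : nat) x y : B 0 x -> B 0 y -> B (- m%:Z) (x - y) ->
  Qball 0 (fpoly f x) /\ Qball (- m%:Z) (fpoly f x - fpoly f y).
Proof.
move=> /B_coordP x0 /B_coordP y0 /B_coordP xy.
pose rel (a b : K) := [/\ Qball 0 a, Qball 0 b & Qball (- m%:Z) (a - b)].
have rel_refl a : Qball 0 a -> rel a a by split=> //; rewrite subrr; exact: Qball0.
have relM a b a' b' : rel a b -> rel a' b' -> rel (a * a') (b * b').
  move=> [a0 b0 ab] [a0' b0' ab']; split.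
  - by have := QballM a0 a0'; rewrite addr0.
  - by have := QballM b0 b0'; rewrite addr0.
  - have -> : a * a' - b * b' = (a - b) * a' + b * (a' - b') by ring.
    apply: QballD; first by have := QballM ab a0'; rewrite addr0.
    by have := QballM b0 ab'; rewrite add0r.
have relD a b a' b' : rel a b -> rel a' b' -> rel (a + a') (b + b').
  move=> [a0 b0 ab] [a0' b0' ab']; split; try exact: QballD.
  by rewrite opprD addrACA; exact: QballD.
have Q1 : Qball 0 (1 : K) by rewrite QballE expr0z padic_abs1.
suff [a0 _ ab] : rel (fpoly f x) (fpoly f y) by [].
rewrite /fpoly !mpoly.mevalE; elim/big_ind2: _ => [|a b a' b'|mm _].
- by apply: rel_refl; exact: Qball0.
- exact: relD.
apply: (relM _ _ _ _ _ _); first by apply: (rel_refl _ _); rewrite QballE expr0z.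
elim/big_ind2: _ => [|a b a' b'|i _]; [exact: rel_refl|exact: relM|].
elim: (mm i) => [|e IH]; first by rewrite !expr0; exact: rel_refl.
by rewrite !exprS; apply: relM IH; split; rewrite ?x0 ?y0//; have := xy i; rewrite !mxE.
Qed.

Lemma pz_scale j x : x = (p%:R : K) ^ (- j) *: ((p%:R : K) ^ j *: x).
Proof. by rewrite scalerA -expfzDr ?p_neq0// addNr expr0z scale1r. Qed.

Lemma B_pz_scale j k x : B k x <-> B (k - j) ((p%:R : K) ^ j *: x).
Proof.
split=> [xk|xk].
  by rewrite addrC; apply: BZ xk; exact: Qball_pz.
rewrite (pz_scale j x); have -> : k = j + (k - j) by lia.
by apply: BZ xk; have := Qball_pz p_pr (- j); rewrite opprK.
Qed.

Lemma fpoly_pz j x : fpoly f x = (p%:R : K) ^ (- j * d%:Z) * fpoly f ((p%:R : K) ^ j *: x).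
Proof. by rewrite {1}(pz_scale j x) fpolyZ [_ ^+ d]exprnP exprz_exp. Qed.

Lemma fpoly_upper j x : B j x -> Qball (j * d%:Z) (fpoly f x).
Proof.
move=> xj; rewrite (fpoly_pz j) -[j * d%:Z]addr0; apply: QballM.
  by have := Qball_pz p_pr (- j * d%:Z); rewrite -mulNr opprK.
have x0 := (B_pz_scale j j x).1 xj; rewrite subrr in x0.
by apply: (fpoly_congr (m := 0%N) x0 x0 _).1; rewrite subrr; exact: B0.
Qed.

(* The unit sphere is compact and [f] has no zero on it. *)
Lemma fpoly_lower_sphere : exists l : nat, forall x, level 0 x -> ~ Qball (- l%:Z) (fpoly f x).
Proof.
apply: contrapT => /forallNP nl.
have /choice[u uP] : forall l : nat, exists x, level 0 x /\ Qball (- l%:Z) (fpoly f x).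
  move=> l; apply: contrapT => /forallNP h; apply: (nl l) => x x0 fx.
  by apply: (h x).
have uB i : B 0 (u i) by case: (uP i) => -[].
have FB : (u @ \oo) (B 0) by exists 0%N => // i _; exact: uB.
have [z [zB zcl]] := @compact_B p p_pr n 0 (u @ \oo) _ FB.
have near_z (l : nat) : exists2 i, (l <= i)%N & B (- l%:Z) (u i - z).
  have zl : nbhs z [set y | B (- l%:Z) (y - z)] by apply/nbhsVP; exists l.
  have ul : (u @ \oo) [set y | exists2 i, (l <= i)%N & y = u i].
    by exists l => // i /= li; exists i.
  have [y [[i li ->] yz]] := zcl _ _ ul zl.
  by exists i.
have fz : fpoly f z = 0.
  apply: Qball_inter0 => l; have [i li uiz] := near_z l.
  have [_ fiz] := fpoly_congr (uB i) zB uiz.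
  rewrite -(subKr (fpoly f (u i)) (fpoly f z)); apply: QballD (QballN fiz).
  by apply: Qball_le (uP i).2; lia.
have z0 : z = 0 by case: f_elliptic => _ _ fz0; apply/fz0.
have [i _] := near_z 1%N; rewrite z0 subr0 => ui.
by case: (uP i) => -[_ + _]; apply; rewrite sub0r.
Qed.

Lemma level_scale j x : level j x -> level 0 ((p%:R : K) ^ j *: x).
Proof.
move=> [xj nxj]; split; first by have := (B_pz_scale j j x).1 xj; rewrite subrr.
move=> h; apply: nxj; apply/(B_pz_scale j).
by have -> : j - 1 - j = 0 - 1 by lia.
Qed.

Lemma fpoly_lower : exists l : nat, forall j x, level j x ->
  ~ Qball (j * d%:Z - l%:Z) (fpoly f x).
Proof.
have [l lP] := fpoly_lower_sphere; exists l => j x /level_scale xj fx.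
apply: (lP _ xj); have -> : fpoly f ((p%:R : K) ^ j *: x) = (p%:R : K) ^ (j * d%:Z) * fpoly f x.
  by rewrite (fpoly_pz j x) mulrA -expfzDr ?p_neq0// mulNr subrr expr0z mul1r.
by have := QballM (Qball_pz p_pr (j * d%:Z)) fx; rewrite addrA addNr sub0r.
Qed.

(** Ultrametric triangles are isosceles: a strictly smaller summand does not change the absolute
    value. *)
Lemma padic_abs_dominant k (a b : K) : ~ Qball k a -> Qball k b ->
  padic_abs (a + b) = padic_abs a.
Proof.
rewrite !QballE => /negP; rewrite -ltNge => ka bk.
have ba : padic_abs b < padic_abs a by exact: le_lt_trans bk ka.
apply/eqP; rewrite eq_le; apply/andP; split.
  by apply: le_trans (padic_absD _ _) _; rewrite ge_max lexx ltW.
have := padic_absD (a + b) (- b); rewrite addrK padic_absN le_max => /orP[//|].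
by rewrite leNgt ba.
Qed.

(** After scaling to the unit sphere, moving x by [B (j - l)] changes f(x) by at most p^(jd - l),
    while |f(x)| is larger than this; [padic_abs_dominant] concludes. *)
Lemma fpoly_locally_constant l : (forall j x, level j x ->
    ~ Qball (j * d%:Z - l%:Z) (fpoly f x)) ->
  forall j x h, level j x -> B (j - l%:Z) h -> padic_abs (fpoly f (x + h)) = padic_abs (fpoly f x).
Proof.
move=> low j x h xj hj.
have fxh : Qball (j * d%:Z - l%:Z) (fpoly f (x + h) - fpoly f x).
  rewrite (fpoly_pz j (x + h)) (fpoly_pz j x) -mulrBr; apply: QballM.
    by have := Qball_pz p_pr (- j * d%:Z); rewrite -mulNr opprK.
  have [x0 _] := level_scale xj.
  have h0 : B (- l%:Z) ((p%:R : K) ^ j *: h).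
    by have := (B_pz_scale j _ h).1 hj; rewrite addrAC subrr sub0r.
  have xh0 : B 0 ((p%:R : K) ^ j *: (x + h)).
    by rewrite scalerDr; apply: BD x0 _; apply: B_le h0; lia.
  apply: (fpoly_congr xh0 x0 _).2.
  by rewrite -scalerBr addrAC subrr add0r.
by rewrite -(padic_abs_dominant (low j x xj) fxh) addrCA subrr addr0.
Qed.
End EllipticPolynomials.

Section Symbol.
Context (R : realType) (p : nat) (p_pr : prime p) (n : nat).
Local Notation K := (Qp p_pr).
Local Notation V := ('rV[K]_n).
Local Notation VB := (QpnBorel p_pr n).
Local Notation P := (p%:R : R).
Implicit Types (x y h : V) (j : int).

Lemma ratr_pz (k : int) : ratr (p%:R ^ k) = P ^ k.
Proof. by rewrite fmorphXz rmorph_nat. Qed.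

Lemma pabs_le (a : K) (k : int) : (pabs R a <= P ^ k) <-> Qball k a.
Proof. by rewrite /pabs -ratr_pz ler_rat QballE. Qed.

Lemma pabs_ge0 (a : K) : 0 <= pabs R a.
Proof. by rewrite /pabs ler0q; exact: padic_abs_ge0. Qed.

Lemma pabs0 : pabs R (0 : K) = 0.
Proof. by rewrite /pabs padic_abs0 rmorph0. Qed.

Lemma pabs_gt (a : K) (k : int) : ~ Qball k a -> P ^ k < pabs R a.
Proof. by move=> h; rewrite ltNge; apply/negP => /pabs_le. Qed.

(** Nothing is required at the zeros of u: for a >= 0 the set where u > a contains none of them, and
    for a < 0 it is the whole space. This accommodates the symbol, whose radius of constancy shrinks
    to 0 at the origin. *)
Lemma measurable_locally_constant_pos (u : V -> R) : (forall x, 0 <= u x) ->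
  (forall x, 0 < u x -> exists k : nat, forall y, B (- k%:Z) (y - x) -> u y = u x) ->
  measurable_fun [set: VB] (u : VB -> R).
Proof.
move=> u0 uc _; apply: (measurability _ (RGenOInfty.measurableE R)) => //.
move=> _ [_ [a ->] <-]; rewrite setTI; apply: open_measurableV.
apply: open_B_invariant => x /=; rewrite in_itv/= andbT => ax.
have [a0|a0] := leP 0 a.
  have [k kP] := uc x (le_lt_trans a0 ax); exists k => y /kP.
  by rewrite /= in_itv/= andbT => ->.
by exists 0%N => y _; rewrite in_itv/= andbT (lt_le_trans a0).
Qed.

Lemma measurable_pabs_coord (i : 'I_n) :
  measurable_fun [set: VB] ((fun x : V => pabs R (x 0 i)) : VB -> R).
Proof.
apply: measurable_locally_constant_pos => [x|x px]; first exact: pabs_ge0.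
have xi0 : x 0 i != 0 by apply/eqP => xi0; move: px; rewrite xi0 pabs0 ltxx.
have [k [_ nk _]] := Qball_neq0 xi0; exists `|k - 1|%N => y /B_coordP/(_ i).
rewrite !mxE => yx; rewrite -(subrK (x 0 i) (y 0 i)) addrC /pabs.
by rewrite (padic_abs_dominant nk)//; apply: Qball_le yx; lia.
Qed.

Lemma measurable_Xi d : measurable_fun [set: VB] (Xi R d : VB -> R).
Proof.
apply: measurable_sum => i; apply: measurable_funX; exact: measurable_pabs_coord.
Qed.

Lemma Xi_ge0 d x : 0 <= Xi R d x.
Proof. by apply: sumr_ge0 => i _; rewrite exprn_ge0// pabs_ge0. Qed.

Lemma measurable_Xi_weight d (beta : R) : measurable_fun [set: VB] (Xi_weight d beta : VB -> R).
Proof.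
have mX : measurable_fun [set: VB] (Xi R d : VB -> R) by exact: measurable_Xi.
exact: (measurableT_comp (measurable_powR (2 * beta)) mX).
Qed.

Lemma Xi_level_le d j x : B j x -> Xi R d x <= n%:R * P ^ (j * d%:Z).
Proof.
move=> /B_coordP xj; rewrite -[n%:R]/(n%:R) -[X in X%:R]card_ord -sumr_const mulr_suml.
apply: ler_sum => i _; rewrite mul1r -exprz_exp -exprnP.
by apply: lerXn2r; rewrite ?nnegrE ?pabs_ge0 ?exprz_ge0//; exact/pabs_le.
Qed.

(** The later estimates see |f|^alpha only through these fields, with q = p^(alpha d). A positive l
    makes the ball of constancy in [hs_const] stay inside the sphere of radius p^j. *)
Record homogeneous_symbol (sigma : V -> R) (c q : R) (l : nat) : Prop := HomogeneousSymbol {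
  hs_c_gt0 : 0 < c;
  hs_q_gt1 : 1 < q;
  hs_l_gt0 : (0 < l)%N;
  hs_0 : sigma 0 = 0;
  hs_lower : forall j x, level j x -> c * q ^ j <= sigma x;
  hs_upper : forall j x, B j x -> sigma x <= q ^ j;
  hs_const : forall j x h, level j x -> B (j - l%:Z) h -> sigma (x + h) = sigma x }.

Variables (d : nat) (f : mpoly.mpoly n K).
Hypothesis f_Zp : Zp_coefs f.
Hypothesis f_elliptic : elliptic f d.
Variable alpha : R.
Hypothesis alpha_gt0 : 0 < alpha.

Let PR0 : 0 < P. Proof. exact: PR_gt0. Qed.

Lemma powR_pz (k : int) : (P ^ k) `^ alpha = (P `^ alpha) ^ k.
Proof.
by rewrite -(powR_intmul k (ltW PR0)) -powRrM mulrC powRrM powR_intmul// powR_ge0.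
Qed.

Lemma elliptic_symbol : exists (c : R) (l : nat),
  homogeneous_symbol (symbol f alpha) c ((P `^ alpha) ^+ d) l.
Proof.
have [l low] := fpoly_lower f_Zp f_elliptic.
have d0 := elliptic_degree_gt0 f_elliptic.
have Pa0 : 0 < P `^ alpha by exact: powR_gt0.
have pz j : (P `^ alpha) ^+ d ^ j = (P ^ (j * d%:Z)) `^ alpha.
  by rewrite powR_pz exprnP exprz_exp mulrC.
have low' : forall j x, level j x -> ~ Qball (j * d%:Z - l.+1%:Z) (fpoly f x).
  move=> j x xj fx; apply: (low j x xj); apply: Qball_le fx; lia.
(* The exponent l found by compactness may be 0; its successor provides [hs_l_gt0] and only weakens
   the lower bound. *)
exists ((P `^ alpha) ^ (- l.+1%:Z)), l.+1; split.
- by rewrite exprz_gt0.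
- rewrite exprn_egt1 -?lt0n// /powR gt_eqF// expR_gt1 mulr_gt0// ln_gt0//.
  exact: PR_gt1.
- by [].
- rewrite /symbol; have -> : fpoly f 0 = 0 by case: f_elliptic => _ _ fz; apply/fz.
  by rewrite pabs0 powR0// lt0r_neq0.
- move=> j x xj; rewrite pz powR_pz -expfzDr ?lt0r_neq0// addrC -powR_pz.
  apply: ge0_ler_powR; rewrite ?nnegrE ?exprz_ge0 ?pabs_ge0 ?(ltW alpha_gt0) ?(ltW PR0)//.
  by apply/ltW/pabs_gt; exact: low'.
- move=> j x xj; rewrite pz.
  apply: ge0_ler_powR; rewrite ?nnegrE ?exprz_ge0 ?pabs_ge0 ?(ltW alpha_gt0) ?(ltW PR0)//.
  by apply/pabs_le; exact: fpoly_upper.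
- move=> j x h xj hj; rewrite /symbol /pabs.
  by rewrite (fpoly_locally_constant f_Zp f_elliptic low' xj hj).
Qed.
End Symbol.

Lemma expn_unbounded (R : realType) (q a : R) : 1 < q -> exists m : nat, a < q ^+ m.
Proof.
move=> q1; have bern (m : nat) : 1 + m%:R * (q - 1) <= q ^+ m.
  elim: m => [|m IH]; first by rewrite mul0r addr0 expr0.
  rewrite exprS -natr1; apply: le_trans (_ : q * (1 + m%:R * (q - 1)) <= _); last first.
    by rewrite ler_wpM2l// ltW// (lt_trans ltr01).
  have := mulr_ge0 (ler0n R m) (sqr_ge0 (q - 1)); lra.
have q0 : 0 < q - 1 by rewrite subr_gt0.
exists (Num.bound (`|a| / (q - 1))); apply: lt_le_trans (bern _).
have := archi_boundP (_ : 0 <= `|a| / (q - 1)); rewrite divr_ge0 ?(ltW q0)// => /(_ isT).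
by rewrite ltr_pdivrMr// => h; have := ler_norm a; lra.
Qed.

(** * The heat kernel *)

Section Kernel.
Context (R : realType) (p : nat) (p_pr : prime p) (n : nat).
Local Notation K := (Qp p_pr).
Local Notation V := ('rV[K]_n).
Local Notation VB := (QpnBorel p_pr n).
Local Notation P := (p%:R : R).
Implicit Types (x y h : V) (j N J : int).
Variable mu : {measure set VB -> \bar R}.
Hypothesis mu_haar : normalized_haar mu.
Local Notation rintegrable u := (mu.-integrable [set: VB] (EFin \o (u : VB -> R))).
Local Notation Rint u := (Rintegral mu [set: VB] (u : VB -> R)).

Lemma level_inj j j' x : level j x -> level j' x -> j = j'.
Proof.
wlog jj : j j' / j <= j' => [hw|].
  move=> xj xj'; case: (leP j j') => [h|/ltW h]; first exact: hw h xj xj'.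
  exact: esym (hw _ _ h xj' xj).
move=> [xj nxj] [xj' nxj'].
apply/eqP; rewrite eq_le jj/= leNgt; apply/negP => lt_jj.
by apply: nxj'; apply: B_le xj; lia.
Qed.

Lemma level_near j x y : level j x -> B (j - 1) (y - x) -> level j y.
Proof.
move=> [xj nxj] yx; split.
  by rewrite -(subrK x y); apply: BD xj; apply: B_le yx; lia.
by move=> yj; apply: nxj; rewrite -(subKr y x); exact: BB yj yx.
Qed.

Lemma level_exists N x : ~ B N x -> exists2 j, level j x & N < j.
Proof.
move=> xN; have x0 : x != 0 by apply/eqP => x0; apply: xN; rewrite x0; exact: B0.
have [j [xj nxj]] := B_level x0; exists j => //.
by rewrite ltNge; apply/negP => jN; apply: xN; apply: B_le xj.
Qed.

(** The origin has no level and gets the default 0; [tailf] never consults it there, since every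
    ball [B N] contains the origin. *)
Definition lev x : int := xget 0 [set j | level j x].

Lemma lev_level j x : level j x -> lev x = j.
Proof. move=> xj; apply: (level_inj _ xj).
by have := @xgetPex _ 0 [set k | level k x] (ex_intro _ j xj). Qed.

Variables (sigma : V -> R) (c q : R) (l : nat).
Hypothesis hs : homogeneous_symbol sigma c q l.

Let c0 : 0 < c. Proof. exact: hs_c_gt0 hs. Qed.
Let q1 : 1 < q. Proof. exact: hs_q_gt1 hs. Qed.
Let q0 : 0 < q. Proof. exact: lt_trans ltr01 q1. Qed.
Let qn0 : q != 0. Proof. exact: lt0r_neq0 q0. Qed.
Let qB0 : 0 < q - 1. Proof. by rewrite subr_gt0. Qed.
Let P0 : 0 < P. Proof. exact: PR_gt0. Qed.
Let Pn0 : P != 0. Proof. exact: lt0r_neq0 P0. Qed.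

(** With q = p^(alpha d), the power s^j is |x|^(-n - alpha d) on the sphere of radius p^j; [tailf N]
    is this function cut off on [B N]. *)
Definition decay : R := (P ^+ n * q)^-1.
Local Notation s := decay.

Lemma decay_gt0 : 0 < s.
Proof. by rewrite invr_gt0 mulr_gt0// exprn_gt0. Qed.

Lemma decay_expz j : s ^ j = P ^ (- j * n%:Z) * q ^ (- j).
Proof.
rewrite /decay exprz_inv expfzMl; congr (_ * _).
by rewrite exprnP exprz_exp mulrC.
Qed.

Definition tailf N x : R := if `[< B N x >] then 0 else s ^ lev x.

Lemma tailf_ge0 N x : 0 <= tailf N x.
Proof. by rewrite /tailf; case: ifP => // _; rewrite exprz_ge0// ltW// decay_gt0. Qed.

Lemma tailf_level N j x : N < j -> level j x -> tailf N x = s ^ j.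
Proof.
move=> Nj xj; rewrite /tailf (lev_level xj) asboolF// => xN.
by case: xj => _; apply; apply: B_le xN; lia.
Qed.

Lemma measurable_tailf N : measurable_fun [set: VB] (tailf N : VB -> R).
Proof.
apply: measurable_locally_constant_pos => [x|x x0]; first exact: tailf_ge0.
have [xN|xN] := pselect (B N x); first by move: x0; rewrite /tailf asboolT// ltxx.
have [j xj Nj] := level_exists xN; exists `|j - 1|%N => y yx.
rewrite (tailf_level Nj xj); apply: tailf_level Nj _.
by apply: level_near xj _; apply: B_le yx; lia.
Qed.

Lemma integral_tailf_le N : (\int[mu]_x (tailf N x)%:E <= (q ^ (- N) / (q - 1))%:E)%E.
Proof.
(* Spheres are enlarged to balls, whose volumes are known. The term of radius p^j has integral s^j
   p^(jn) = q^(-j), and the sum over j > N is q^(-N) / (q - 1). *)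
pose F (i : nat) x : R := s ^ (N + 1 + i%:Z) * \1_([set y : V | B (N + 1 + i%:Z) (y - 0)]) x.
have F0 i x : 0 <= F i x by rewrite mulr_ge0 ?exprz_ge0 ?(ltW decay_gt0)// indicE.
have mI i : measurable_fun [set: VB] (\1_([set y : V | B (N + 1 + i%:Z) (y - 0)]) : VB -> R).
  by apply: measurable_indic; exact: measurable_coset.
have mF i : measurable_fun [set: VB] (EFin \o (F i : VB -> R)).
  by apply/measurable_EFinP; apply: measurable_funM => //; exact: measurable_cst.
apply: (@le_trans _ _ (\int[mu]_x (\sum_(0 <= i <oo) (F i x)%:E))%E).
  apply: ge0_le_integral => //.
  - by move=> x _; rewrite lee_fin tailf_ge0.
  - by apply/measurable_EFinP; exact: measurable_tailf.
  - apply: ge0_emeasurable_sum; last by move=> *; exact: mF.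
    by move=> i x _ _; rewrite lee_fin.
  - move=> x _; have [xN|xN] := pselect (B N (x : V)).
      by rewrite /tailf asboolT// nneseries_ge0// => *; rewrite lee_fin.
    have [j xj Nj] := level_exists xN; rewrite (tailf_level Nj xj).
    have [i ji] : exists i : nat, j = N + 1 + i%:Z by exists (absz (j - N - 1)%R); lia.
    apply: le_trans (nneseries_lim_ge i.+1 _); last by move=> *; rewrite lee_fin.
    have -> : s ^ j = F i x.
      rewrite /F indicE mem_set ?mulr1 -?ji//=.
      by rewrite subr0; case: xj.
    by rewrite big_nat_recr//= leeDr// sume_ge0// => *; rewrite lee_fin.
rewrite integral_nneseries//; last by move=> *; rewrite lee_fin.
have rq0 : 0 <= q^-1 by rewrite invr_ge0 ltW.
have rq1 : q^-1 < 1 by rewrite invf_lt1.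
apply: le_trans (_ : \sum_(0 <= i <oo) (q ^ (- (N + 1)) * q^-1 ^+ i)%:E <= _)%E.
  apply: lee_nneseries => [i _ _|i _]; first by apply: integral_ge0 => *; rewrite lee_fin.
  have -> : (\int[mu]_x (F i x)%:E = (s ^ (N + 1 + i%:Z))%:E *
      \int[mu]_x (\1_([set y : V | B (N + 1 + i%:Z) (y - 0)]) x)%:E)%E.
    rewrite -ge0_integralZl_EFin ?exprz_ge0 ?(ltW decay_gt0)//.
    exact/measurable_EFinP.
  rewrite integral_indic//; last exact: measurable_coset.
  rewrite setIT haar_coset// -EFinM lee_fin decay_expz mulrAC -expfzDr// mulNr addNr expr0z mul1r.
  by rewrite exprVn exprnN -expfzDr// opprD.
apply: le_trans (geometric_nneseries_le _ rq0 rq1) _; first by rewrite exprz_ge0// ltW.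
rewrite lee_fin opprD expfzDr// -mulrA ler_wpM2l ?exprz_ge0 ?(ltW q0)//.
rewrite le_eqVlt; apply/orP; left; apply/eqP.
rewrite exprN1; field.
by rewrite qn0 lt0r_neq0.
Qed.

Lemma rintegrable_tailf N : rintegrable (tailf N).
Proof.
apply: rintegrableP; first exact: measurable_tailf.
under eq_integral do rewrite ger0_norm ?tailf_ge0//.
by apply: le_lt_trans (integral_tailf_le N) _; rewrite ltry.
Qed.

Lemma Rintegral_tailf_le N : Rint (tailf N) <= q ^ (- N) / (q - 1).
Proof.
rewrite -lee_fin /Rintegral fineK; first exact: integral_tailf_le.
apply: integrable_fin_num => //; exact: rintegrable_tailf.
Qed.

Lemma exp_decay : exists2 C : R, 0 <= C & forall i : nat, expR (- (c * q ^+ i)) <= C * s ^+ i.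
Proof.
(* With p^n < q^m, the term of degree m + 1 of the exponential series already decays like q^(-(m +
   1) i), which is at most s^i. *)
have [m Pm] := expn_unbounded (P ^+ n) q1.
exists ((m.+1)`!%:R / c ^+ m.+1) => [|i].
  by rewrite divr_ge0// exprn_ge0// ltW.
set z := c * q ^+ i; have z0 : 0 < z by rewrite mulr_gt0// exprn_gt0.
have fz : z ^+ m.+1 / (m.+1)`!%:R <= expR z.
  by have := expR_ge1Dxn m (ltW z0); lra.
have f0 : 0 < (m.+1)`!%:R :> R by rewrite ltr0n fact_gt0.
rewrite expRN; apply: le_trans (_ : (z ^+ m.+1 / (m.+1)`!%:R)^-1 <= _).
  by rewrite lef_pV2// posrE ?expR_gt0// divr_gt0// exprn_gt0.
rewrite invf_div /z exprMn invfM mulrA ler_wpM2l//.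
  by rewrite divr_ge0// exprn_ge0// ltW.
rewrite -exprM mulnC exprM /decay exprVn lef_pV2 ?posrE ?exprn_gt0 ?mulr_gt0 ?exprn_gt0//.
apply: lerXn2r; rewrite ?nnegrE ?mulr_ge0 ?exprn_ge0 ?(ltW q0) ?(ltW P0)//.
by rewrite exprSr ler_wpM2r ?(ltW q0)// ltW.
Qed.

(** For q = p^(alpha d) the radius p^J is the discrete form of t^(-1/(alpha d)), the frequency at
    which t sigma becomes of order 1. *)
Lemma time_scale t : 0 < t -> exists J : int, q ^ (- J) <= t < q ^ (1 - J).
Proof.
move=> t0; have [k tk] := expn_unbounded t^-1 q1; have [k' tk'] := expn_unbounded t q1.
have : exists i : nat, t < q ^ (i%:Z - k%:Z).
  by exists (k + k')%N; rewrite PoszD addrAC subrr add0r.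
case/ex_minnP => -[|i] ti imin.
  move: ti; rewrite sub0r -exprnN ltNge => /negP; case; apply/ltW.
  by rewrite invf_plt ?posrE ?exprn_gt0.
have [J J1 J2] : exists2 J : int, - J = i%:Z - k%:Z & 1 - J = i.+1%:Z - k%:Z.
  by exists (k%:Z - i%:Z); [rewrite opprB|rewrite opprB addrA -addn1 PoszD (addrC 1)].
exists J; rewrite J2 J1 ti andbT leNgt; apply/negP => /imin.
by rewrite ltnn.
Qed.
End Kernel.

(** * Pointwise and L^1 bounds for the heat kernel *)

Section HeatKernel.
Context (R : realType) (p : nat) (p_pr : prime p) (n : nat).
Local Notation K := (Qp p_pr).
Local Notation V := ('rV[K]_n).
Local Notation VB := (QpnBorel p_pr n).
Local Notation P := (p%:R : R).
Local Notation nc := (@Normc.normc R).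
Implicit Types (x y h xi : V) (j N J : int) (t : R).
Variable mu : {measure set VB -> \bar R}.
Hypothesis mu_haar : normalized_haar mu.
Local Notation rintegrable u := (mu.-integrable [set: VB] (EFin \o (u : VB -> R))).
Local Notation cintble f := (cintegrable mu (f : VB -> R[i])).
Local Notation FT := (FT mu).
Local Notation Rint u := (Rintegral mu [set: VB] (u : VB -> R)).
Variables (sigma : V -> R) (c q : R) (l : nat).
Hypothesis hs : homogeneous_symbol sigma c q l.

Let c0 : 0 < c. Proof. exact: hs_c_gt0 hs. Qed.
Let q1 : 1 < q. Proof. exact: hs_q_gt1 hs. Qed.
Let q0 : 0 < q. Proof. exact: lt_trans ltr01 q1. Qed.
Let qn0 : q != 0. Proof. exact: lt0r_neq0 q0. Qed.
Let qB0 : 0 < q - 1. Proof. by rewrite subr_gt0. Qed.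
Let P0 : 0 < P. Proof. exact: PR_gt0. Qed.
Let Pn0 : P != 0. Proof. exact: lt0r_neq0 P0. Qed.
Local Notation s := (decay p n q).
Local Notation tailf := (tailf q).
Let s0 : 0 < s. Proof. exact: (decay_gt0 hs). Qed.

Lemma symbol_ge0 x : 0 <= sigma x.
Proof.
have [->|x0] := eqVneq x 0; first by rewrite (hs_0 hs).
have [j xj] := B_level x0; apply: le_trans (hs_lower hs xj).
by rewrite mulr_ge0 ?exprz_ge0// ltW.
Qed.

Lemma measurable_symbol : measurable_fun [set: VB] (sigma : VB -> R).
Proof.
apply: measurable_locally_constant_pos => [x|x px]; first exact: symbol_ge0.
have x0 : x != 0 by apply/eqP => x0; move: px; rewrite x0 (hs_0 hs) ltxx.
have [j xj] := B_level x0; exists (absz (j - l%:Z)%R) => y yx.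
have -> : y = x + (y - x) by rewrite addrC subrK.
apply: (hs_const hs xj); apply: B_le yx.
by have := ler_norm (- (j - l%:Z)); rewrite normrN -abszE lerNl.
Qed.

Definition heat t x : R := expR (- t * sigma x).

Lemma heat_gt0 t x : 0 < heat t x.
Proof. exact: expR_gt0. Qed.

Lemma heat_le1 t x : 0 <= t -> heat t x <= 1.
Proof. by move=> t0; rewrite /heat mulNr -expR0 ler_expR oppr_le0 mulr_ge0// symbol_ge0. Qed.

Lemma measurable_heat t : measurable_fun [set: VB] (heat t : VB -> R).
Proof.
have mt : measurable_fun [set: VB] ((fun x : V => - t * sigma x) : VB -> R).
  apply: measurable_funM; first exact: measurable_cst.
  exact: measurable_symbol.
exact: (measurableT_comp (@measurable_expR R) mt).
Qed.

Lemma measurable_ind k (a : V) :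
  measurable_fun [set: VB] (\1_([set y : V | B k (y - a)]) : VB -> R).
Proof. by apply: measurable_indic; exact: measurable_coset. Qed.

(** The constant is uniform in t because the bound is rescaled: on the sphere of radius p^j with j >
    J one has t sigma >= c q^(j - J), and [exp_decay] is applied at j - J. *)
Lemma heat_decay : exists2 C : R, 0 <= C & forall t J x, q ^ (- J) <= t ->
  heat t x <= \1_([set y : V | B J (y - 0)]) x + C * s ^ (- J) * tailf J x.
Proof.
have [C C0 Cexp] := exp_decay hs; exists C => // t J x Jt.
have t0 : 0 <= t by apply: le_trans Jt; rewrite exprz_ge0// ltW.
have [xJ|xJ] := pselect (B J x).
  rewrite indicE mem_set/= ?subr0//; apply: le_trans (heat_le1 x t0) _.
  by rewrite lerDl mulr_ge0 ?(tailf_ge0 hs)// ?mulr_ge0// exprz_ge0// ltW.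
have [j xj Jj] := level_exists xJ.
rewrite indicE memNset/= ?subr0// add0r (tailf_level hs Jj xj) -mulrA -expfzDr ?lt0r_neq0//.
have jJ : (absz (j - J)%R)%:Z = j - J by rewrite gez0_abs// subr_ge0 ltW.
rewrite (addrC (- J)) -jJ.
rewrite -exprnP; apply: le_trans (Cexp _); rewrite /heat ler_expR mulNr lerN2.
apply: le_trans (_ : q ^ (- J) * (c * q ^ j) <= _).
  rewrite mulrCA -expfzDr// exprnP jJ ler_wpM2l ?(ltW c0)//.
  by rewrite addrC.
apply: ler_pM => //; first by rewrite exprz_ge0// ltW.
  by rewrite mulr_ge0 ?exprz_ge0// ltW.
exact: (hs_lower hs xj).
Qed.

Lemma rintegrable_indZ (a : R) k (b : V) :
  rintegrable (fun x => a * \1_([set y : V | B k (y - b)]) x).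
Proof. exact: (integrableZl measurableT a (rintegrable_ball mu_haar k b)). Qed.

Lemma Rintegral_indZ (a : R) k (b : V) :
  Rint (fun x => a * \1_([set y : V | B k (y - b)]) x) = a * P ^ (k * n%:Z).
Proof. by rewrite RintegralZl ?Rintegral_ball//; exact: rintegrable_ball. Qed.

Lemma rintegrable_tailfZ (a : R) N : rintegrable (fun x => a * tailf N x).
Proof. exact: (integrableZl measurableT a (rintegrable_tailf mu_haar hs N)). Qed.

Lemma Rintegral_tailfZ (a : R) N : Rint (fun x => a * tailf N x) = a * Rint (tailf N).
Proof. by rewrite RintegralZl//; exact: rintegrable_tailf hs N. Qed.

Lemma Rintegral_ind_tailf (a b : R) k N : 0 <= b ->
  rintegrable (fun x => a * \1_([set y : V | B k (y - 0)]) x + b * tailf N x) /\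
  Rint (fun x => a * \1_([set y : V | B k (y - 0)]) x + b * tailf N x) <=
  a * P ^ (k * n%:Z) + b * (q ^ (- N) / (q - 1)).
Proof.
move=> b0; split.
  have := integrableD measurableT (rintegrable_indZ a k 0) (rintegrable_tailfZ b N).
  by apply: eq_integrable.
rewrite RintegralD//; [|exact: rintegrable_indZ|exact: rintegrable_tailfZ].
rewrite Rintegral_indZ Rintegral_tailfZ lerD2l ler_wpM2l//.
exact: Rintegral_tailf_le hs N.
Qed.

(** Integration of the majorant of [heat_decay]: the factors s^(-J) and q^(-J) combine to p^(Jn),
    the size of the ball term. *)
Lemma heat_integral : exists2 C : R, 0 <= C & forall t J, q ^ (- J) <= t ->
  rintegrable (heat t) /\ Rint (heat t) <= C * P ^ (J * n%:Z).
Proof.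
have [C C0 hC] := heat_decay; exists (1 + C / (q - 1)) => [|t J Jt].
  by rewrite addr_ge0// divr_ge0// ltW.
have CJ0 : 0 <= C * s ^ (- J) by rewrite mulr_ge0// exprz_ge0// ltW.
have [bi bI] := Rintegral_ind_tailf 1 J J CJ0.
have hb x : heat t x <= 1 * \1_([set y : V | B J (y - 0)]) x + C * s ^ (- J) * tailf J x.
  by rewrite mul1r; exact: hC.
have hi : rintegrable (heat t).
  apply: rintegrable_le bi => [|x]; first exact: measurable_heat.
  by rewrite ger0_norm ?(ltW (heat_gt0 _ _))//; apply: le_trans (hb x) (ler_norm _).
split=> //; apply: le_trans (le_Rintegral measurableT hi bi (fun x _ => hb x)) _.
apply: le_trans bI _; rewrite decay_expz// opprK mulrDl lerD2l.
rewrite le_eqVlt; apply/orP; left; apply/eqP.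
have E : q ^ J * q ^ (- J) = 1 by rewrite -expfzDr// subrr expr0z.
transitivity (C / (q - 1) * P ^ (J * n%:Z) * (q ^ J * q ^ (- J))); first by ring.
by rewrite E mulr1.
Qed.

Lemma rintegrable_heat t : 0 < t -> rintegrable (heat t).
Proof.
move=> t0; have [C _ hC] := heat_integral; have [J /andP[Jt _]] := time_scale hs t0.
by have [] := hC t J Jt.
Qed.

Lemma cintegrable_heat t : 0 < t -> cintble (fun x => (heat t x)%:C).
Proof. by move=> t0; split; [exact: rintegrable_heat|exact: integrable0]. Qed.

Definition hkernel t x : R[i] := FT false (fun xi => (heat t xi)%:C) x.

Lemma kernel_vcont t : 0 < t -> vcont (hkernel t).
Proof. by move=> t0; apply: FT_vcont; exact: cintegrable_heat. Qed.

Lemma nc_real_ge0 (r : R) : 0 <= r -> nc r%:C = r.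
Proof. by move=> r0; rewrite nc_real ger0_norm. Qed.

(* The function equal to [1] on [B (l - j)] and to [heat t] outside is
   [B (1 - j)]-periodic, so it does not contribute to the transform at [x]. *)
Lemma kernel_level t j x : 0 < t -> level j x ->
  nc (hkernel t x) <= 2 * (P ^+ n * q) ^+ l * t * s ^ j.
Proof.
move=> t0 xj; have l0 := hs_l_gt0 hs; pose k := l%:Z - j.
pose w xi := (heat t xi - 1) * \1_([set y : V | B k (y - 0)]) xi.
have wk xi : B k xi -> w xi = heat t xi - 1.
  by move=> xik; rewrite /w indicE mem_set/= ?subr0// mulr1.
have wnk xi : ~ B k xi -> w xi = 0.
  by move=> xik; rewrite /w indicE memNset/= ?subr0// mulr0.
have mw : measurable_fun [set: VB] (w : VB -> R).
  apply: measurable_funM; last exact: measurable_ind.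
  by apply: measurable_funB; [exact: measurable_heat|exact: measurable_cst].
(* Here 1 - e^(-t sigma) <= t sigma <= t q^k. Multiplied by the volume p^(kn) with k = l - j, this
   is t (p^n q)^l s^j. *)
have wb xi : `|w xi| <= t * q ^ k * \1_([set y : V | B k (y - 0)]) xi.
  have [xik|xik] := pselect (B k xi); last first.
    by rewrite (wnk _ xik) normr0 mulr_ge0 ?mulr_ge0 ?exprz_ge0 ?(ltW q0) ?(ltW t0)// indicE.
  rewrite (wk _ xik) indicE mem_set/= ?subr0// mulr1 distrC ger0_norm; last first.
    by rewrite subr_ge0 heat_le1// ltW.
  apply: le_trans (_ : t * sigma xi <= _).
    by have := expR_ge1Dx (- t * sigma xi); rewrite /heat; lra.
  by rewrite ler_wpM2l ?(ltW t0)//; exact: (hs_upper hs xik).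
have wi : rintegrable w.
  apply: rintegrable_le (rintegrable_indZ (t * q ^ k) k 0) => // xi.
  by apply: le_trans (wb xi) (ler_norm _).
have wci : cintble (fun xi => (w xi)%:C) by split; [exact: wi|exact: integrable0].
have hci := cintegrable_heat t0.
have gci := cintegrableB hci wci.
have [h hj h1] := @chr_neq1 R p p_pr n false j x xj.2.
have G0 : FT false (fun xi => (heat t xi)%:C - (w xi)%:C) x = 0.
  apply: (FT_vanish mu_haar gci _ h1) => y.
  have hk : B k h by apply: B_le hj; rewrite /k lerD2r lez_nat.
  have [yk|yk] := pselect (B k y).
    have yhk : B k (y + h) by apply: BD yk hk.
    rewrite (wk _ yk) (wk _ yhk) -!rmorphB/=; congr (_%:C).
    by rewrite !subKr.
  have yhk : ~ B k (y + h) by move=> /(BDr y hk).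
  rewrite (wnk _ yk) (wnk _ yhk) !subr0 /heat; congr ((expR (_ * _))%:C).
  have [j' yj' kj'] := level_exists yk.
  apply: (hs_const hs yj'); apply: B_le hj; rewrite lerBrDr.
  have -> : 1 - j + l%:Z = l%:Z - j + 1 by ring.
  by rewrite lezD1.
have KE : hkernel t x = FT false (fun xi => (w xi)%:C) x.
  apply/eqP; rewrite -subr_eq0 -G0 /hkernel; apply/eqP.
  by rewrite (FTB false hci wci).
rewrite KE; apply: le_trans (nc_FT_le _ _ _ _ (rintegrable_indZ (t * q ^ k) k 0)) _.
- exact: cmeasurable_real.
- by move=> y; rewrite nc_real.
rewrite Rintegral_indZ decay_expz// -!mulrA ler_wpM2l// /k.
rewrite le_eqVlt; apply/orP; left; apply/eqP.
have -> : (l%:Z - j) * n%:Z = l%:Z * n%:Z + - j * n%:Z by rewrite mulrDl.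
rewrite !expfzDr// exprMn [(P ^+ n) ^+ l]exprnP [P ^+ n]exprnP exprz_exp (mulrC n%:Z) exprnP.
by ring.
Qed.

(** With J the time scale of t, the kernel is O(p^(Jn)) on [B (- J)], whose volume p^(-Jn)
    compensates. Outside, [kernel_level] leaves a mass O(t q^J), bounded since t < q^(1 - J). The
    sum does not depend on t. *)
Lemma kernel_bound : exists2 C : R, 0 <= C &
  (forall t, 0 < t -> rintegrable (fun x => nc (hkernel t x)) /\
     Rint (fun x => nc (hkernel t x)) <= C) /\
  (forall t N x, 0 < t -> ~ B N x -> nc (hkernel t x) <= C * t * tailf N x).
Proof.
have [C1 C10 hC1] := heat_integral.
pose D : R := 2 * (P ^+ n * q) ^+ l.
have D0 : 0 <= D by rewrite mulr_ge0// exprn_ge0// mulr_ge0 ?exprn_ge0// ltW.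
have tail t N x : 0 < t -> ~ B N x -> nc (hkernel t x) <= D * t * tailf N x.
  move=> t0 xN; have [j xj Nj] := level_exists xN.
  by rewrite (tailf_level hs Nj xj); exact: kernel_level.
have DD0 : 0 <= D * q / (q - 1) by exact: (divr_ge0 (mulr_ge0 D0 (ltW q0)) (ltW qB0)).
have C20 : 0 <= 2 * C1 by rewrite mulr_ge0.
have C30 : 0 <= 2 * C1 + D * q / (q - 1) by exact: addr_ge0.
exists (2 * C1 + D * q / (q - 1) + D); first exact: addr_ge0.
split=> [t t0|t N x t0 xN]; last first.
  apply: le_trans (tail t N x t0 xN) _; rewrite ler_wpM2r ?(tailf_ge0 hs)//.
  by rewrite ler_wpM2r ?(ltW t0)// lerDr.
have [J /andP[Jt tJ]] := time_scale hs t0; have [hi hI] := hC1 t J Jt.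
have Dt0 : 0 <= D * t by rewrite mulr_ge0// ltW.
have [bi bI] := Rintegral_ind_tailf (2 * C1 * P ^ (J * n%:Z)) (- J) (- J) Dt0.
have kb x : nc (hkernel t x) <= 2 * C1 * P ^ (J * n%:Z) * \1_([set y : V | B (- J) (y - 0)]) x +
    D * t * tailf (- J) x.
  have [xJ|xJ] := pselect (B (- J) x).
    rewrite indicE mem_set/= ?subr0// mulr1.
    apply: le_trans (_ : 2 * C1 * P ^ (J * n%:Z) <= _); last first.
      by rewrite lerDl mulr_ge0// (tailf_ge0 hs).
    apply: le_trans (nc_FT_le _ _ _ _ hi) _.
    - by apply: cmeasurable_real; exact: measurable_heat.
    - by move=> y; rewrite nc_real_ge0// ltW// heat_gt0.
    by rewrite -mulrA ler_wpM2l.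
  by rewrite indicE memNset/= ?subr0// mulr0 add0r; exact: tail.
have ki : rintegrable (fun x => nc (hkernel t x)).
  apply: rintegrable_le bi => [|x].
    by apply: measurable_nc; apply: vcont_cmeasurable; exact: kernel_vcont.
  by rewrite ger0_norm ?nc_ge0//; apply: le_trans (kb x) (ler_norm _).
split=> //; apply: le_trans (le_Rintegral measurableT ki bi (fun x _ => kb x)) _.
apply: le_trans bI _; rewrite -mulrA -expfzDr// -mulrDl subrr mul0r expr0z mulr1 opprK.
rewrite -addrA lerD2l; apply: le_trans (_ : D * q / (q - 1) <= _); last by rewrite lerDl.
rewrite mulrA ler_wpM2r ?invr_ge0 ?(ltW qB0)// -mulrA ler_wpM2l//.
apply: le_trans (_ : q ^ (1 - J) * q ^ J <= _).
  by rewrite ler_wpM2r ?exprz_ge0 ?(ltW q0)// ltW.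
by rewrite -expfzDr// subrK expr1z.
Qed.

Lemma cintegrable_kernel t : 0 < t -> cintble (hkernel t).
Proof.
move=> t0; have [C _ [/(_ t t0)[ki _] _]] := kernel_bound.
by apply/cintegrableP; split => //; apply: vcont_cmeasurable; exact: kernel_vcont.
Qed.
End HeatKernel.

(** * Fourier multipliers *)

Section Multipliers.
Context (R : realType) (p : nat) (p_pr : prime p) (n : nat).
Local Notation K := (Qp p_pr).
Local Notation V := ('rV[K]_n).
Local Notation VB := (QpnBorel p_pr n).
Local Notation nc := (@Normc.normc R).
Implicit Types (x y : V) (k m N r : nat).
Variable mu : {measure set VB -> \bar R}.
Hypothesis mu_haar : normalized_haar mu.
Hypothesis n_gt0 : (0 < n)%N.
Local Notation rintegrable u := (mu.-integrable [set: VB] (EFin \o (u : VB -> R))).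
Local Notation cintble f := (cintegrable mu (f : VB -> R[i])).
Local Notation FT := (FT mu).
Local Notation Rint u := (Rintegral mu [set: VB] (u : VB -> R)).
Local Notation N2 f := (wnorm2 mu (fun=> 1%R) (f : VB -> R[i])).
Local Notation cmeas f := (cmeasurable (f : VB -> R[i])).
Local Notation rmeas u := (measurable_fun [set: VB] (u : VB -> R)).

Lemma ae_neq0 : {ae mu, forall x : VB, x != (0 : V)}.
Proof.
exists ([set 0] : set V); split; last by move=> x /= /negP; rewrite negbK => /eqP.
  rewrite -[X in measurable X]setCK; apply: measurableC; apply: open_measurableV.
  apply: open_B_invariant => x /= x0.
  have [k xk] : exists k, ~ B (- k%:Z) x by apply/existsNP => /B_inter0.
  by exists k => y yx y0; apply: xk; rewrite -[x]subr0 -y0; exact: BBC.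
exact: haar_set1.
Qed.

Lemma Rint_ge0 (u : V -> R) : (forall x, 0 <= u x) -> 0 <= Rint u.
Proof. by move=> u0; apply: Rintegral_ge0. Qed.

Lemma Rint_EFin (u : V -> R) : rintegrable u ->
  integral mu [set: VB] (EFin \o (u : VB -> R)) = (Rint u)%:E.
Proof. by move=> ui; rewrite /Rintegral fineK//; exact: integrable_fin_num. Qed.

Lemma Rint_cvg0 (u : nat -> V -> R) (g : V -> R) : (forall k, rmeas (u k)) ->
  (forall k x, 0 <= u k x <= g x) ->
  {ae mu, forall x : VB, u k x @[k --> \oo] --> (0 : R)} -> rintegrable g ->
  forall e : R, 0 < e -> exists N, forall k, (N <= k)%N -> Rint (u k) <= e.
Proof.
move=> mu_ ug u0 gi e e0.
have I0 k : (0 <= \int[mu]_(x in [set: VB]) (u k x)%:E)%E.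
  by apply: integral_ge0 => z _; rewrite lee_fin; case/andP: (ug k z).
have [N NP] := (ge0_cvge0P I0).1 (ge0_dominated_cvg0 mu_ ug u0 gi) e e0.
exists N => k Nk; rewrite -lee_fin -Rint_EFin; first exact: NP.
apply: rintegrable_le gi => // x; have /andP[a b] := ug k x.
by rewrite !ger0_norm// (le_trans a b).
Qed.

(* AM-GM: [|a| |b| <= (e a^2 + b^2 / e) / 2]. *)
Lemma L1_of_L2_cvg0 (u : V -> R) (D : nat -> V -> R[i]) : rmeas u ->
  rintegrable (fun x => u x ^+ 2) -> (forall k, cmeas (D k)) ->
  (forall e : R, 0 < e -> exists N, forall k, (N <= k)%N -> (N2 (D k) <= e%:E)%E) ->
  forall e : R, 0 < e -> exists N, forall k, (N <= k)%N ->
    rintegrable (fun x => `|u x| * nc (D k x)) /\ Rint (fun x => `|u x| * nc (D k x)) <= e.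
Proof.
move=> mu_ u2 mD D0 e e0; set A := Rint (fun x => u x ^+ 2).
have A0 : 0 <= A by apply: Rint_ge0 => x; exact: sqr_ge0.
have A1 : 0 < A + 1 by rewrite ltr_wpDl.
pose d := e / (A + 1); have d0 : 0 < d by rewrite divr_gt0.
have [N NP] := D0 (d * e) (mulr_gt0 d0 e0); exists N => k Nk.
have Di : rintegrable (fun x => nc (D k x) ^+ 2).
  apply: rintegrableP; first exact: measurable_nc2.
  apply: le_lt_trans (_ : (d * e)%:E < +oo)%E; last by rewrite ltry.
  apply: le_trans (NP k Nk); rewrite /wnorm2 le_eqVlt; apply/orP; left; apply/eqP.
  by apply: eq_integral => x _; rewrite mul1r ger0_norm// sqr_ge0.
have DI : Rint (fun x => nc (D k x) ^+ 2) <= d * e.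
  rewrite -lee_fin -Rint_EFin//; apply: le_trans (NP k Nk).
  rewrite /wnorm2 le_eqVlt; apply/orP; left; apply/eqP.
  by apply: eq_integral => x _; rewrite /= mul1r.
have i1 : rintegrable (fun x => d / 2 * u x ^+ 2) by exact: (integrableZl measurableT (d / 2) u2).
have i2 : rintegrable (fun x => (2 * d)^-1 * nc (D k x) ^+ 2).
  exact: (integrableZl measurableT (2 * d)^-1 Di).
have i3 : rintegrable (fun x => d / 2 * u x ^+ 2 + (2 * d)^-1 * nc (D k x) ^+ 2).
  by have := integrableD measurableT i1 i2; apply: eq_integrable.
have le3 x : `|u x| * nc (D k x) <= d / 2 * u x ^+ 2 + (2 * d)^-1 * nc (D k x) ^+ 2.
  rewrite -(real_normK (num_real (u x))); move: `|u x| (nc (D k x)) => a b.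
  have -> : d / 2 * a ^+ 2 + (2 * d)^-1 * b ^+ 2 = a * b + (2 * d)^-1 * (d * a - b) ^+ 2.
    by field; rewrite lt0r_neq0.
  by rewrite lerDl mulr_ge0 ?sqr_ge0// invr_ge0 mulr_ge0// ltW.
have i0 : rintegrable (fun x => `|u x| * nc (D k x)).
  apply: rintegrable_le i3 => [|x].
    by apply: measurable_funM; [exact: measurableT_comp|exact: measurable_nc].
  rewrite ger0_norm ?mulr_ge0 ?nc_ge0//; exact: le_trans (le3 x) (ler_norm _).
split=> //; apply: le_trans (le_Rintegral measurableT i0 i3 (fun x _ => le3 x)) _.
rewrite RintegralD// !RintegralZl// -/A.
have dA : d * A <= e.
  by rewrite /d mulrAC ler_pdivrMr// ler_wpM2l ?(ltW e0)// lerDl.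
have dd : (2 * d)^-1 * Rint (fun x => nc (D k x) ^+ 2) <= e / 2.
  apply: le_trans (_ : (2 * d)^-1 * (d * e) <= _).
    by rewrite ler_wpM2l// invr_ge0 mulr_ge0// ltW.
  by rewrite le_eqVlt; apply/orP; left; apply/eqP; field; rewrite lt0r_neq0.
move: dd; set X := _ * Rint _ => dd; rewrite -mulrAC; lra.
Qed.

Lemma step_level_sub k m (f g : V -> R[i]) : step k f -> step m g -> exists r, step r (fun x => f x - g x).
Proof.
move=> fk gm; exists (k + m)%N; apply: stepB.
  by apply: step_le fk; exact: leq_addr.
by apply: step_le gm; exact: leq_addl.
Qed.

(** The inverse transforms of [H k] are Cauchy in L^2 by Parseval and converge pointwise to
    [FT false G] by the L^1 hypothesis; Fatou's lemma shows that this pointwise limit is also the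
    L^2 limit. Inversion recovers [H k] as their transforms. *)
Lemma fourierL2_FT (H : nat -> V -> R[i]) (G : V -> R[i]) :
  (forall k, exists r, step r (H k)) -> cintble G -> in_L2 mu (G : VB -> R[i]) ->
  (forall e : R, 0 < e -> exists N, forall k, (N <= k)%N ->
    (N2 (fun x => (H k x - G x)%R) <= e%:E)%E) ->
  (forall e : R, 0 < e -> exists N, forall k, (N <= k)%N ->
    rintegrable (fun x => nc (H k x - G x)) /\ Rint (fun x => nc (H k x - G x)) <= e) ->
  fourierL2 mu (FT false G) G.
Proof.
move=> Hs Gi GL HG2 HG1.
have m1 : rmeas (fun=> 1 : R) by exact: measurable_cst.
have p1 (x : VB) : 0 <= 1 :> R by [].
have mG := GL.1.
have mH k : cmeas (H k) by have [r Hk] := Hs k; exact: step_cmeasurable Hk.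
have Hi k : cintble (H k) by have [r Hk] := Hs k; exact: step_cintegrable Hk.
pose v k := FT false (H k).
have vs k : exists r, step r (v k).
  by have [r Hk] := Hs k; exists r; exact: step_FT.
have mv k : cmeas (v k) by have [r vk] := vs k; exact: step_cmeasurable vk.
have mV : cmeas (FT false G) by apply: vcont_cmeasurable; exact: FT_vcont.
have HH e : 0 < e -> exists N, forall i k, (N <= i)%N -> (N <= k)%N ->
    (N2 (fun x => (v i x - v k x)%R) <= e%:E)%E.
  move=> e0; have [N NP] := HG2 (e / 4) (ltac:(by rewrite divr_gt0)).
  exists N => i k Ni Nk.
  have -> : N2 (fun x => (v i x - v k x)%R) = N2 (fun x => (H i x - H k x)%R).
    have [r Hr] := Hs i; have [r' Hr'] := Hs k; have [r'' Hr''] := step_level_sub Hr Hr'.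
    rewrite -(FT_parseval mu_haar false Hr''); congr wnorm2.
    by rewrite (FTB false (Hi i) (Hi k)).
  apply: le_trans (wnorm2_triangle mu m1 p1 (mH i) mG (mH k)) _.
  rewrite (wnorm2C mu _ G (H k)).
  have -> : e%:E = (2%:E * (e / 4)%:E + 2%:E * (e / 4)%:E)%E.
    by rewrite -!EFinM -EFinD; congr EFin; field.
  by apply: leeD; apply: lee_wpmul2l; rewrite ?lee_fin//; exact: NP.
have vV x : nc (v k x - FT false G x) @[k --> \oo] --> (0 : R).
  apply/cvgrPdist_le => e e0; have [N NP] := HG1 (e / 2) (ltac:(by rewrite divr_gt0)).
  exists N => // k /= Nk; rewrite sub0r normrN ger0_norm ?nc_ge0//.
  have [di dI] := NP k Nk.
  suff : nc (FT false (fun y => H k y - G y) x) <= e by rewrite (FTB false (Hi k) Gi).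
  apply: le_trans (nc_FT_le _ _ _ _ di) _ => //.
    exact: cmeasurableB.
  by rewrite mulrC -ler_pdivlMr.
have N2V e : 0 < e -> exists N, forall i, (N <= i)%N ->
    (N2 (fun x => (v i x - FT false G x)%R) <= e%:E)%E.
  move=> e0; have [N NP] := HH e e0; exists N => i Ni.
  apply: (wnorm2_fatou (s := fun k (x : VB) => v i x - v (k + N)%N x)) => //.
  - by move=> k; exact: cmeasurableB.
  - exact: cmeasurableB.
  - apply: aeW => x; have vx : nc (v (k + N)%N x - FT false G x) @[k --> \oo] --> (0 : R).
      by rewrite (cvg_shiftn N (fun k => nc (v k x - FT false G x))).
    apply: (le_limn_cvg0 _ vx) => k; apply/andP; split; first exact: nc_ge0.
    have E (a b c : R[i]) : nc (a - b - (a - c)) = nc (b - c).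
      by rewrite ncBC; congr nc; ring.
    by rewrite E.
  - by move=> k; apply: NP => //; exact: leq_addl.
have VL2 : in_L2 mu (FT false G : VB -> R[i]).
  split=> //; have [N NP] := N2V 1 ltr01; have [r vr] := vs N.
  have := wnorm2D mu m1 p1 (cmeasurableB mV (mv N)) (mv N).
  under [in X in wnorm2 _ _ X]eq_fun do rewrite subrK.
  move/le_lt_trans; apply; rewrite wnorm2C.
  apply: lte_add_pinfty; apply: lte_mul_pinfty => //.
  - by apply: le_lt_trans (NP N (leqnn N)) _; rewrite ltry.
  - exact: step_N2_lty vr.
split=> //; exists v; split.
- by move=> k; have [r vr] := vs k; exact: step_schwartz_bruhat vr.
- by apply/ge0_cvge0P => [k|//]; exact: wnorm2_ge0.
- have -> : (fun k => fourier mu (v k)) = H.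
    apply/funext => k; have [r Hr] := Hs k.
    by rewrite fourier_FT /v (FT_FT mu_haar false Hr).
  by apply/ge0_cvge0P => [k|//]; exact: wnorm2_ge0.
Qed.
End Multipliers.

(** * Truncated multipliers and their convergence in L^2 and L^1 *)

Section Truncation.
Context (R : realType) (p : nat) (p_pr : prime p) (n : nat).
Local Notation K := (Qp p_pr).
Local Notation V := ('rV[K]_n).
Local Notation VB := (QpnBorel p_pr n).
Local Notation nc := (@Normc.normc R).
Implicit Types (x h xi : V) (j : int) (k m N r : nat).
Variable mu : {measure set VB -> \bar R}.
Hypothesis mu_haar : normalized_haar mu.
Hypothesis n_gt0 : (0 < n)%N.
Local Notation rintegrable u := (mu.-integrable [set: VB] (EFin \o (u : VB -> R))).
Local Notation Rint u := (Rintegral mu [set: VB] (u : VB -> R)).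
Local Notation N2 f := (wnorm2 mu (fun=> 1%R) (f : VB -> R[i])).
Local Notation cmeas f := (cmeasurable (f : VB -> R[i])).
Local Notation rmeas u := (measurable_fun [set: VB] (u : VB -> R)).

(** The local constancy of the symbol and of all functions of it. The radius depends on the sphere
    and nothing is imposed near 0, which is why [trunc] removes a small ball besides the large
    values. *)
Definition symbol_mult (l : nat) (M : V -> R) :=
  forall j x h, level j x -> B (j - l%:Z) h -> M (x + h) = M x.

Definition trunc m (M : V -> R) x : R :=
  if `[< B m x /\ ~ B (- m%:Z) x >] then M x else 0.

Lemma trunc_in m M x : B m x -> ~ B (- m%:Z) x -> trunc m M x = M x.
Proof. by move=> xm nxm; rewrite /trunc asboolT. Qed.

Lemma trunc_out m M x : ~ (B m x /\ ~ B (- m%:Z) x) -> trunc m M x = 0.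
Proof. by move=> xm; rewrite /trunc asboolF. Qed.

Lemma norm_trunc_le m M x : `|trunc m M x| <= `|M x|.
Proof. by rewrite /trunc; case: ifP => // _; rewrite normr0. Qed.

Lemma norm_truncB_le m M x : `|trunc m M x - M x| <= `|M x|.
Proof. by rewrite /trunc; case: ifP => // _; rewrite ?subrr ?normr0// sub0r normrN. Qed.

Lemma level_trunc0 m M : trunc m M 0 = 0.
Proof. by apply: trunc_out => -[_]; apply; exact: B0. Qed.

Lemma trunc_eventually M x : x != 0 -> exists N, forall m, (N <= m)%N -> trunc m M x = M x.
Proof.
move=> x0; have [k xk] := B_bounded x.
have [m xm] : exists m, ~ B (- m%:Z) x.
  by apply/existsNP => /B_inter0 x00; move: x0; rewrite x00 eqxx.
exists (k + m)%N => i kmi; apply: trunc_in.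
  by apply: B_le xk; rewrite lez_nat (leq_trans _ kmi)// leq_addr.
by move=> xi; apply: xm; apply: B_le xi; rewrite lerN2 lez_nat (leq_trans _ kmi)// leq_addl.
Qed.

Lemma N2_Rint (f : V -> R[i]) : rintegrable (fun x => nc (f x) ^+ 2) ->
  N2 f = (Rint (fun x => nc (f x) ^+ 2))%:E.
Proof.
move=> fi; rewrite -Rint_EFin// /wnorm2.
by apply: eq_integral => x _; rewrite mul1r.
Qed.

Lemma in_L2_rintegrable (f : V -> R[i]) : in_L2 mu (f : VB -> R[i]) -> rintegrable (fun x => nc (f x) ^+ 2).
Proof.
move=> [mf f2]; apply: rintegrableP; first exact: measurable_nc2.
apply: le_lt_trans f2; rewrite /wnorm2 le_eqVlt; apply/orP; left; apply/eqP.
by apply: eq_integral => x _; rewrite mul1r ger0_norm// sqr_ge0.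
Qed.

Section Multiplier.
Variables (l : nat) (M : V -> R).
Hypothesis Ml : symbol_mult l M.
Hypothesis mM : rmeas M.

Lemma trunc_shift m x h : B (- (m + l)%N%:Z) h -> trunc m M (x + h) = trunc m M x.
Proof.
move=> hml; have hm : B m h by apply: B_le hml; lia.
have hnm : B (- m%:Z) h by apply: B_le hml; rewrite lerN2 lez_nat leq_addr.
have [[xm nxm]|xm] := pselect (B m x /\ ~ B (- m%:Z) x); last first.
  rewrite (trunc_out M xm) trunc_out// => -[xhm nxhm]; apply: xm; split.
    by move/(BDr x hm) : xhm.
  by move=> xnm; apply: nxhm; apply/(BDr x hnm).
rewrite !trunc_in//; last 2 first.
- exact/(BDr x hm).
- by move=> /(BDr x hnm).
(* Every point kept has level j > -m, so the common period group [B (- (m + l))] lies in its ball of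
   constancy [B (j - l)]. *)
have [j xj mj] := level_exists nxm; apply: (Ml xj); apply: B_le hml.
by rewrite PoszD opprD lerD2r ltW.
Qed.

Lemma trunc_step m : step (m + l)%N (fun x => (trunc m M x)%:C).
Proof.
split=> [x xml|x h hml]; last by rewrite trunc_shift.
rewrite trunc_out// => -[xm _]; apply: xml; apply: B_le xm.
by rewrite lez_nat leq_addr.
Qed.

Lemma trunc_mul_step m k g : step k g -> exists r, step r (fun x => (trunc m M x)%:C * g x).
Proof.
move=> gk; exists (k + (m + l))%N; apply: step_mul.
  move=> x h _ hr; congr (_%:C); apply: trunc_shift; apply: B_le hr.
  by rewrite lerN2 lez_nat leq_addl.
by apply: step_le gk; exact: leq_addr.
Qed.

Lemma measurable_trunc m : rmeas (trunc m M).
Proof. by have [] := step_cmeasurable (trunc_step m). Qed.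

(** At each x other than 0 the truncation error is eventually 0, and {0} is null. The parameter F
    covers the various expressions in the error that are integrated below. *)
Lemma trunc_cvg_ae (F : R -> V -> R) : (forall x, F 0 x = 0) ->
  {ae mu, forall x : VB, F (trunc m M x - M x) x @[m --> \oo] --> (0 : R)}.
Proof.
move=> F0; apply: filterS (ae_neq0 mu_haar n_gt0) => x x0.
apply/cvgrPdist_le => e e0; have [N NP] := trunc_eventually M x0.
by exists N => // m /= Nm; rewrite (NP m Nm) subrr F0 subrr normr0 ltW.
Qed.

Lemma rintegrable_mulL2 (u : V -> R) g : rmeas u -> rintegrable (fun x => u x ^+ 2) ->
  in_L2 mu (g : VB -> R[i]) -> rintegrable (fun x => `|u x| * nc (g x)).
Proof.
move=> mu_ u2 gL2; have mg := gL2.1; have gi := in_L2_rintegrable gL2.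
have i3 : rintegrable (fun x => u x ^+ 2 + nc (g x) ^+ 2).
  by have := integrableD measurableT u2 gi; apply: eq_integrable.
apply: rintegrable_le i3 => [|x].
  by apply: measurable_funM; [exact: measurableT_comp|exact: measurable_nc].
rewrite ger0_norm ?mulr_ge0 ?nc_ge0//; apply: le_trans (ler_norm _).
rewrite -(real_normK (num_real (u x))); move: `|u x| (nc (g x)) (normr_ge0 (u x)) (nc_ge0 (g x)).
move=> a b a0 b0; have := sqr_ge0 (a - b); have := mulr_ge0 a0 b0; rewrite sqrrB.
by move=> ab; rewrite addrAC subr_ge0; apply: le_trans; rewrite mulr2n lerDl.
Qed.

Variables (S : nat -> V -> R[i]) (g : V -> R[i]).
Hypothesis mS : forall k, cmeas (S k).
Hypothesis gL2 : in_L2 mu (g : VB -> R[i]).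
Hypothesis Sg : forall e : R, 0 < e -> exists N, forall k, (N <= k)%N ->
  (N2 (fun x => (S k x - g x)%R) <= e%:E)%E.

Lemma truncB_split m x : (trunc m M x)%:C * S m x - (M x)%:C * g x =
  (trunc m M x)%:C * (S m x - g x) + (trunc m M x - M x)%:C * g x.
Proof. by rewrite rmorphB/=; ring. Qed.

(** In [truncB_split] the first term is controlled by the L^2 convergence of [S], the second by
    dominated convergence with majorant C |g|^2. The weight is 1 for the L^2 statements and a power
    of [Xi] for the spaces [Htilde]. *)
Lemma multiplier_cvg (w : V -> R) (C : R) : rmeas w -> (forall x, 0 <= w x) ->
  (forall x, w x * M x ^+ 2 <= C) ->
  forall e : R, 0 < e -> exists N, forall k, (N <= k)%N ->
    (wnorm2 mu (w : VB -> R) (fun x => ((trunc k M x)%:C * S k x - (M x)%:C * g x)%R) <= e%:E)%E.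
Proof.
move=> mw w0 wM e e0; have mg := gL2.1.
have C0 : 0 <= C by apply: le_trans (wM 0); rewrite mulr_ge0// sqr_ge0.
have C1 : 0 < C + 1 by rewrite ltr_wpDl.
have mA k : cmeas (fun x => (trunc k M x)%:C * (S k x - g x)).
  apply: cmeasurableM; last exact: cmeasurableB.
  by apply: cmeasurable_real; exact: measurable_trunc.
have mD k : rmeas (fun x => trunc k M x - M x).
  by apply: measurable_funB => //; exact: measurable_trunc.
have mB k : cmeas (fun x => (trunc k M x - M x)%:C * g x).
  by apply: cmeasurableM => //; exact: cmeasurable_real.
have [N1 N1P] := Sg (e := e / (4 * (C + 1))) (ltac:(by rewrite divr_gt0// mulr_gt0)).
have g2 := in_L2_rintegrable gL2.
have gi : rintegrable (fun x => C * nc (g x) ^+ 2) by exact: (integrableZl measurableT C g2).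
pose u k x := w x * nc ((trunc k M x - M x)%:C * g x) ^+ 2.
have u0 k x : 0 <= u k x by rewrite mulr_ge0// sqr_ge0.
have uC k x : 0 <= u k x <= C * nc (g x) ^+ 2.
  rewrite u0/= /u ncM exprMn mulrA ler_wpM2r ?sqr_ge0//; apply: le_trans (wM x).
  rewrite ler_wpM2l// nc_real real_normK ?num_real// -(real_normK (num_real (M x))).
  rewrite -(real_normK (num_real (_ - _))).
  by rewrite ler_pXn2r ?nnegrE ?normr_ge0// norm_truncB_le.
have I0 k : (0 <= \int[mu]_(x in [set: VB]) (u k x)%:E)%E.
  by apply: integral_ge0 => x _; rewrite lee_fin.
have F0 x : w x * nc (0%:C * g x) ^+ 2 = 0 by rewrite mul0r nc0 expr0n mulr0.
have ucvg := ge0_dominated_cvg0 (fun k => measurable_wnc2 mw (mB k)) uC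
  (trunc_cvg_ae (F := fun a x => w x * nc (a%:C * g x) ^+ 2) F0) gi.
have [N2 N2P] := (ge0_cvge0P I0).1 ucvg (e / 4) (ltac:(by rewrite divr_gt0)).
exists (N1 + N2)%N => k Nk.
under [in X in wnorm2 _ _ X]eq_fun do rewrite truncB_split.
apply: le_trans (wnorm2D mu mw w0 (mA k) (mB k)) _.
have -> : e%:E = (2%:E * (e / 4)%:E + 2%:E * (e / 4)%:E)%E.
  by rewrite -!EFinM -EFinD; congr EFin; field.
apply: leeD; apply: lee_wpmul2l; rewrite ?lee_fin//; last first.
  by apply: N2P; apply: leq_trans Nk; exact: leq_addl.
apply: le_trans (wnorm2_le (w' := fun=> C) (g := fun x : VB => S k x - g x) mu mw _ _ _ w0 _) _.
- exact: mA.
- exact: measurable_cst.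
- exact: cmeasurableB.
- move=> x; rewrite ncM exprMn mulrA ler_wpM2r ?sqr_ge0//; apply: le_trans (wM x).
  rewrite ler_wpM2l// nc_real -(real_normK (num_real (M x))).
  by rewrite ler_pXn2r ?nnegrE ?normr_ge0// norm_trunc_le.
have -> : wnorm2 mu (fun=> C) (fun x : VB => S k x - g x) = (C%:E * wnorm2 mu (fun=> 1%R) (fun x : VB => (S k x - g x)%R))%E.
  rewrite /wnorm2 -ge0_integralZl_EFin//.
  - by apply: eq_integral => x _; rewrite -EFinM mul1r.
  - by move=> x _; rewrite lee_fin mul1r sqr_ge0.
  - apply/measurable_EFinP; apply: measurable_wnc2; first exact: measurable_cst.
    exact: cmeasurableB.
apply: le_trans (_ : C%:E * (e / (4 * (C + 1)))%:E <= _)%E.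
  apply: lee_wpmul2l; rewrite ?lee_fin//; apply: N1P; apply: leq_trans Nk; exact: leq_addr.
rewrite -EFinM lee_fin.
have -> : C * (e / (4 * (C + 1))) = e / 4 * (C / (C + 1)) by field; rewrite lt0r_neq0.
by rewrite ger_pMr ?divr_gt0// ler_pdivrMr// mul1r lerDl.
Qed.

(** The same splitting in L^1; square integrability of M now takes the place of its boundedness,
    through [L1_of_L2_cvg0] and the majorant |M| |g|. *)
Lemma multiplier_cvg1 : rintegrable (fun x => M x ^+ 2) ->
  forall e : R, 0 < e -> exists N, forall k, (N <= k)%N ->
    rintegrable (fun x => nc ((trunc k M x)%:C * S k x - (M x)%:C * g x)) /\
    Rint (fun x => nc ((trunc k M x)%:C * S k x - (M x)%:C * g x)) <= e.
Proof.
move=> M2 e e0; have mg := gL2.1.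
have mSg k : cmeas (fun x => S k x - g x) by exact: cmeasurableB.
have e2 : 0 < e / 2 by rewrite divr_gt0.
have [N1 N1P] := L1_of_L2_cvg0 mM M2 mSg Sg e2.
have Mg := rintegrable_mulL2 mM M2 gL2.
have mD k : rmeas (fun x => trunc k M x - M x).
  by apply: measurable_funB => //; exact: measurable_trunc.
have u01 k x : 0 <= `|trunc k M x - M x| * nc (g x) <= `|M x| * nc (g x).
  by rewrite mulr_ge0 ?nc_ge0//= ler_wpM2r ?nc_ge0// norm_truncB_le.
have mu_ k : rmeas (fun x => `|trunc k M x - M x| * nc (g x)).
  by apply: measurable_funM; [exact: measurableT_comp|exact: measurable_nc].
have F0 x : `|0 : R| * nc (g x) = 0 by rewrite normr0 mul0r.
have [N2 N2P] := Rint_cvg0 mu_ u01 (trunc_cvg_ae (F := fun a x => `|a| * nc (g x)) F0) Mg e2.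
exists (N1 + N2)%N => k Nk.
have [i1 I1] := N1P k (leq_trans (leq_addr _ _) Nk).
have I2 := N2P k (leq_trans (leq_addl _ _) Nk).
have i2 : rintegrable (fun x => `|trunc k M x - M x| * nc (g x)).
  apply: rintegrable_le Mg => // x; have /andP[a b] := u01 k x.
  by rewrite (ger0_norm a) (ger0_norm (le_trans a b)).
have i3 : rintegrable (fun x => `|M x| * nc (S k x - g x) + `|trunc k M x - M x| * nc (g x)).
  by have := integrableD measurableT i1 i2; apply: eq_integrable.
have le3 x : nc ((trunc k M x)%:C * S k x - (M x)%:C * g x) <=
    `|M x| * nc (S k x - g x) + `|trunc k M x - M x| * nc (g x).
  rewrite truncB_split; apply: le_trans (ncD _ _) _; rewrite !ncM !nc_real lerD2r.
  by rewrite ler_wpM2r ?nc_ge0// norm_trunc_le.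
have i0 : rintegrable (fun x => nc ((trunc k M x)%:C * S k x - (M x)%:C * g x)).
  apply: rintegrable_le i3 => [|x].
    apply: measurable_nc; apply: cmeasurableB.
      by apply: cmeasurableM (mS k); apply: cmeasurable_real; exact: measurable_trunc.
    by apply: cmeasurableM mg; apply: cmeasurable_real.
  by rewrite ger0_norm ?nc_ge0//; apply: le_trans (le3 x) (ler_norm _).
split=> //; apply: le_trans (le_Rintegral measurableT i0 i3 (fun x _ => le3 x)) _.
by rewrite RintegralD// [e]splitr lerD.
Qed.
End Multiplier.
End Truncation.

(** * The solution *)

Section HeatSemigroup.
Context (R : realType) (p : nat) (p_pr : prime p) (n : nat).
Local Notation K := (Qp p_pr).
Local Notation V := ('rV[K]_n).
Local Notation VB := (QpnBorel p_pr n).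
Local Notation P := (p%:R : R).
Local Notation nc := (@Normc.normc R).
Implicit Types (x y h xi : V) (j : int) (t : R) (k m N r : nat) (f g : V -> R[i]).
Variable mu : {measure set VB -> \bar R}.
Hypothesis mu_haar : normalized_haar mu.
Hypothesis n_gt0 : (0 < n)%N.
Local Notation rintegrable u := (mu.-integrable [set: VB] (EFin \o (u : VB -> R))).
Local Notation cint f := (cintegral mu (f : VB -> R[i])).
Local Notation cintble f := (cintegrable mu (f : VB -> R[i])).
Local Notation FT := (FT mu).
Local Notation Rint u := (Rintegral mu [set: VB] (u : VB -> R)).
Local Notation cmeas f := (cmeasurable (f : VB -> R[i])).
Local Notation rmeas u := (measurable_fun [set: VB] (u : VB -> R)).

Lemma nc_small_eq (z w : R[i]) : (forall e : R, 0 < e -> nc (z - w) <= e) -> z = w.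
Proof.
move=> h; apply/eqP; rewrite -subr_eq0; apply/eqP; apply: nc_eq0; apply/eqP.
rewrite eq_le nc_ge0 andbT leNgt; apply/negP => z0.
have z2 : 0 < nc (z - w) / 2 by rewrite divr_gt0.
by have := h _ z2; rewrite leNgt ltr_pdivrMr// ltr_pMr// ltr1n.
Qed.

Lemma rintegrable_cintegrable (u : V -> R) : rintegrable u -> cintble (fun x => (u x)%:C).
Proof. by move=> ui; split=> //=; exact: integrable0. Qed.

Lemma rintegrable_norm (u : V -> R) : rintegrable u -> rintegrable (fun x => `|u x|).
Proof.
move=> ui; have := cintegrable_nc (rintegrable_cintegrable ui).
by apply: eq_integrable => // x _; congr EFin; exact: nc_real.
Qed.

Lemma Rintegral_Zr (a : R) (u : V -> R) : rintegrable u ->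
  rintegrable (fun x => a * u x) /\ Rint (fun x => a * u x) = a * Rint u.
Proof.
move=> ui; split; last exact: RintegralZl.
by have := integrableZl measurableT a ui; apply: eq_integrable.
Qed.

Section Pairing.
Variables (l : nat) (M : V -> R).
Hypothesis Ml : symbol_mult l M.
Hypothesis Mi : rintegrable M.

Let mM : rmeas M.
Proof. by have /integrableP[/measurable_EFinP] := Mi. Qed.

Lemma trunc_L1 (e : R) : 0 < e -> exists k,
  rintegrable (fun x => `|trunc k M x - M x|) /\ Rint (fun x => `|trunc k M x - M x|) <= e.
Proof.
move=> e0; have mt k : rmeas (fun x => trunc k M x - M x).
  by apply: measurable_funB => //; exact: (measurable_trunc n_gt0 Ml).
have Mn := rintegrable_norm Mi.
have F0 x : `|0 : R| = 0 by rewrite normr0.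
have mn k : rmeas (fun x => `|trunc k M x - M x|) by exact: measurableT_comp.
have b01 k x : 0 <= `|trunc k M x - M x| <= `|M x|.
  by rewrite normr_ge0 norm_truncB_le.
have [N NP] := Rint_cvg0 mn b01 (trunc_cvg_ae mu_haar n_gt0 M (F := fun a _ => `|a|) F0) Mn e0.
exists N; split; last exact: NP.
by apply: rintegrable_le Mn => // x; rewrite !normr_id norm_truncB_le.
Qed.

(** The multiplication formula passes to the L^1 limit of truncations: on the left their transforms
    converge uniformly against the integrable g, on the right [FT b g] is bounded. The errors are at
    most 4 A I and 2 C I, with I the L^1 distance. *)
Lemma FT_mult_integrable b r g : step r g ->
  cint (fun x => FT b (fun xi => (M xi)%:C) x * g x) = cint (fun x => (M x)%:C * FT b g x).
Proof.
move=> gr; have Mc := rintegrable_cintegrable Mi.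
have gi := step_cintegrable mu_haar gr.
have Fgr := step_FT mu_haar b gr.
have [C Cb] := step_bounded Fgr.
have C0 : 0 <= C by apply: le_trans (Cb 0); exact: nc_ge0.
set A := Rint (fun x => nc (g x)).
have A0 : 0 <= A by apply: Rint_ge0 => x; exact: nc_ge0.
apply: nc_small_eq => e e0.
have D0 : 0 < 4 * A + 2 * C + 1 by rewrite ltr_wpDl// addr_ge0// mulr_ge0.
have [k [ki kI]] := trunc_L1 (divr_gt0 e0 D0).
set I := Rint _ in kI.
pose a x := (trunc k M x)%:C; have ak : step (k + l)%N a by exact: (trunc_step n_gt0 Ml).
have ai := step_cintegrable mu_haar ak.
have Fa := step_FT mu_haar b ak.
have E : cint (fun x => FT b a x * g x) = cint (fun x => a x * FT b g x).
  apply: (@FT_mult _ _ _ _ _ mu_haar b (k + l + r)%N).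
    by apply: step_le ak; exact: leq_addr.
  by apply: step_le gr; exact: leq_addl.
have mF : cmeas (FT b (fun xi => (M xi)%:C)).
  by apply: vcont_cmeasurable; exact: (FT_vcont b Mc).
have dE x : FT b (fun xi => (M xi)%:C) x - FT b a x = FT b (fun xi => (M xi)%:C - a xi) x.
  by rewrite (FTB b Mc ai).
have dM y : nc ((M y)%:C - a y) <= `|trunc k M y - M y|.
  by rewrite ncBC /a -rmorphB nc_real.
have mMa : cmeas (fun y => (M y)%:C - a y).
  by apply: cmeasurableB (cintegrable_cmeasurable Mc) (cintegrable_cmeasurable ai).
have dF x : nc (FT b (fun xi => (M xi)%:C) x - FT b a x) <= 2 * I.
  by rewrite dE; exact: nc_FT_le.
have i1 : cintble (fun x => FT b (fun xi => (M xi)%:C) x * g x).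
  apply: (cintegrable_bddM gi mF (M := 2 * Rint (fun x => `|M x|))) => x.
  apply: nc_FT_le; first exact: cintegrable_cmeasurable Mc.
    by move=> y; rewrite nc_real.
  exact: rintegrable_norm.
have i2 : cintble (fun x => FT b a x * g x) by exact: (step_cintegrableM Fa gi).
have i3 : cintble (fun x => a x * FT b g x).
  by apply: (step_cintegrableM ak); exact: (step_cintegrable mu_haar Fgr).
have i4 : cintble (fun x => (M x)%:C * FT b g x).
  have -> : (fun x => (M x)%:C * FT b g x) = (fun x => FT b g x * (M x)%:C).
    by apply/funext => x; rewrite mulrC.
  exact: step_cintegrableM Fgr Mc.
apply: le_trans (nc_triangle (cint (fun x => FT b a x * g x)) _ _) _.
rewrite {2}E -!cintegralB//.
have [j1 J1] := Rintegral_Zr (2 * I) (cintegrable_nc gi).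
have [j2 J2] := Rintegral_Zr C ki.
apply: le_trans (lerD (nc_cintegral_le (h := fun x : VB => 2 * I * nc (g x)) _ _ j1)
   (nc_cintegral_le (h := fun x : VB => C * `|trunc k M x - M x|) _ _ j2)) _.
- exact: cmeasurableB (cintegrable_cmeasurable i1) (cintegrable_cmeasurable i2).
- by move=> x; rewrite -mulrBl ncM ler_wpM2r ?nc_ge0.
- exact: cmeasurableB (cintegrable_cmeasurable i3) (cintegrable_cmeasurable i4).
- move=> x; rewrite -mulrBl ncM mulrC ler_pM ?nc_ge0//.
  by rewrite ncBC.
rewrite J1 J2.
have -> : 2 * (2 * I * A) + 2 * (C * I) = (4 * A + 2 * C) * I by ring.
apply: le_trans (_ : (4 * A + 2 * C + 1) * I <= _); last by rewrite -ler_pdivlMl// mulrC.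
by rewrite ler_wpM2r ?lerDl//; apply: Rint_ge0.
Qed.
End Pairing.

Lemma ballf_reflect j a x y : ballf R j a (x - y) = ballf R j (x - a) y.
Proof.
have e : (x - y) - a = (x - a) - y by rewrite -!addrA [- y - a]addrC.
have [h|h] := pselect (B j ((x - y) - a)).
  have h' : B j (y - (x - a)) by apply: BBC; rewrite -e.
  exact: etrans (ballf1 R h) (esym (ballf1 R h')).
have h' : ~ B j (y - (x - a)) by move=> h'; apply: h; rewrite e; exact: BBC.
exact: etrans (ballf0 R h) (esym (ballf0 R h')).
Qed.

Lemma step_reflect k g x : step k g -> B k x -> step k (fun y => g (x - y)).
Proof.
move=> [g0 gk] xk; split=> [y yk|y h hk].
  by apply: g0 => xyk; apply: yk; have := BB xk xyk; rewrite opprB addrC subrK.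
by have := gk (x - y) (- h) (BN hk); rewrite -addrA -opprD.
Qed.

(** [normalized_haar] speaks of translations only, so the change of variable y -> x - y is verified
    on indicators of balls, which are symmetric, and extended by [step_ind]. *)
Lemma FT_reflect k g x xi : step k g -> B k x ->
  FT false (fun y => g (x - y)) xi = chr R false x xi * FT true g xi.
Proof.
move=> gk xk; move: g gk.
apply: (@step_ind _ _ _ _ _ (fun g => FT false (fun y => g (x - y)) xi = chr R false x xi * FT true g xi)).
- by rewrite !FT0 mulr0.
- move=> c a ak.
  transitivity (FT false (fun y => c * ballf R (- k%:Z) (x - a) y) xi).
    apply: eq_FT => y; cbv beta.
    exact: (congr1 (fun z => chr R false xi y * (c * z)) (ballf_reflect (- k%:Z) a x y)).
  have xa : B k (x - a) by exact: BB.
  have E b v : B k v -> FT b (fun y => c * ballf R (- k%:Z) v y) xi =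
      c * ((P ^ (- k%:Z * n%:Z))%:C * chr R b xi v * ballf R k 0 xi).
    by move=> vk; rewrite (FTZ b c (cintegrable_ballf mu_haar _ _)) (FT_ballf_step mu_haar b vk).
  rewrite (E false _ xa) (E true _ ak) (chrC R false xi) (chrC R true xi) chrDl -(chrN R false a).
  by move: (chr _ _ _ _) (chr _ _ _ _) (ballf _ _ _ _) => A1 A2 A3; ring.
- move=> f g fk gk fE gE.
  have si s : step k s -> cintble (fun y => s (x - y)).
    by move=> sk; apply: (step_cintegrable mu_haar (k := k)); exact: step_reflect.
  rewrite (FTD _ (si f fk) (si g gk)) fE gE.
  by rewrite (FTD _ (step_cintegrable mu_haar fk) (step_cintegrable mu_haar gk)) mulrDr.
Qed.

Variables (sigma : V -> R) (c q : R) (l : nat).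
Hypothesis hs : homogeneous_symbol sigma c q l.
Local Notation heat := (heat sigma).
Local Notation hkernel := (hkernel mu sigma).

Lemma symbol_mult_heat t : symbol_mult l (heat t).
Proof. by move=> j x h xj hj; rewrite /heat (hs_const hs xj hj). Qed.

(** The convolution at x is a pairing of the kernel with the step function y -> g(x - y); the
    multiplication formula and [FT_reflect] evaluate it. *)
Lemma convolution_step t k g x : 0 < t -> step k g ->
  cint (fun y => hkernel t y * g (x - y)) = FT false (fun xi => (heat t xi)%:C * FT true g xi) x.
Proof.
move=> t0 gk; have [m xm] := B_bounded x.
have gkm : step (k + m)%N g by apply: step_le gk; exact: leq_addr.
have xkm : B (k + m)%N x by apply: B_le xm; rewrite lez_nat leq_addl.
rewrite (FT_mult_integrable (symbol_mult_heat t) (rintegrable_heat mu_haar hs t0) false (step_reflect gkm xkm)).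
apply: eq_cintegral => xi; rewrite (FT_reflect xi gkm xkm).
by rewrite mulrCA.
Qed.

Lemma expz_small (D e : R) : 0 <= D -> 0 < e -> exists N : nat, D * q ^ (- N%:Z) <= e.
Proof.
move=> D0 e0; have [N NP] := expn_unbounded (D / e) (hs_q_gt1 hs).
have q0 : 0 < q by apply: lt_trans (hs_q_gt1 hs).
by exists N; rewrite -exprnN ler_pdivrMr ?exprn_gt0// mulrC -ler_pdivrMr// ltW.
Qed.

Lemma step_large_ball k : step k (ballf R k%:Z (0 : V)).
Proof.
split=> [x xk|x h hk]; first by apply: ballf0; rewrite subr0.
by apply: ballfDr; apply: B_le hk; lia.
Qed.

(** Pairing the kernel with the indicator of [B N] loses a tail O(t q^(-N)). By the multiplication
    formula the pairing is the mean of [heat t] over [B (- N)], which differs from 1 by O(t q^(-N)).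
    Let N grow. *)
Lemma cintegral_hkernel t : 0 < t -> cint (hkernel t) = 1.
Proof.
move=> t0; have [C C0 [_ ktail]] := kernel_bound mu_haar hs.
have ki := cintegrable_kernel mu_haar hs t0.
have q1 := hs_q_gt1 hs; have q10 : 0 < q - 1 by rewrite subr_gt0.
apply: nc_small_eq => e e0.
have D0 : 0 <= 2 * (C * t * (q - 1)^-1) + 2 * t.
  by rewrite addr_ge0 ?mulr_ge0 ?invr_ge0 ?(ltW t0) ?(ltW q10).
have [N NP] := expz_small D0 e0.
have bN := step_large_ball N.
have kb : cintble (fun x => hkernel t x * ballf R N%:Z 0 x).
  have -> : (fun x => hkernel t x * ballf R N%:Z 0 x) = (fun x => ballf R N%:Z 0 x * hkernel t x).
    by apply/funext => x; rewrite mulrC.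
  exact: step_cintegrableM bN ki.
apply: le_trans (nc_triangle (cint (fun x => hkernel t x * ballf R N%:Z 0 x)) _ _) _.
apply: le_trans NP; rewrite mulrDl; apply: lerD.
  rewrite -cintegralB//.
  have [j1 J1] := Rintegral_Zr (C * t) (rintegrable_tailf mu_haar hs N).
  apply: le_trans (nc_cintegral_le (h := fun x : VB => C * t * tailf q N x) _ _ j1) _.
  - exact: cmeasurableB (cintegrable_cmeasurable ki) (cintegrable_cmeasurable kb).
  - move=> x; have [xN|xN] := pselect (B N (x - 0)).
      rewrite (ballf1 R xN) mulr1 subrr nc0; rewrite !mulr_ge0 ?(ltW t0)//.
      exact: tailf_ge0 hs _ _.
    rewrite (ballf0 R xN) (etrans (mulr0 _) erefl) subr0; apply: ktail => //.
    by move=> xN'; apply: xN; rewrite subr0.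
  rewrite J1 -[leRHS]mulrA ler_wpM2l// -[leRHS]mulrA ler_wpM2l ?mulr_ge0 ?(ltW t0)//.
  by rewrite mulrC; exact: (Rintegral_tailf_le mu_haar hs N).
rewrite (FT_mult_integrable (symbol_mult_heat t) (rintegrable_heat mu_haar hs t0) false bN).
have hc := cintegrable_heat mu_haar hs t0.
have FE x : FT false (ballf R N%:Z 0) x = (P ^ (N%:Z * n%:Z))%:C * ballf R (- N%:Z) 0 x.
  have := FT_ballf mu_haar false (- N%:Z) 0 x; rewrite opprK => ->.
  by rewrite chr0r mulr1.
have b2 := cintegrable_ballf mu_haar (- N%:Z) (0 : V).
have E1 : 1 = cint (fun x => (P ^ (N%:Z * n%:Z))%:C * ballf R (- N%:Z) 0 x).
  rewrite cintegralZ// cintegral_ballf// -rmorphM -expfzDr ?(lt0r_neq0 (PR_gt0 R p_pr))//.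
  by rewrite mulNr subrr.
rewrite [X in nc (_ - X)]E1.
have b3 : cintble (fun x => (P ^ (N%:Z * n%:Z))%:C * ballf R (- N%:Z) 0 x) by exact: cintegrableZ.
have b4 : cintble (fun x => (heat t x)%:C * FT false (ballf R N%:Z 0) x).
  have -> : (fun x => (heat t x)%:C * FT false (ballf R N%:Z 0) x) =
      (fun x => FT false (ballf R N%:Z 0) x * (heat t x)%:C).
    by apply/funext => x; rewrite mulrC.
  exact: step_cintegrableM (step_FT mu_haar false bN) hc.
rewrite -cintegralB//.
have j2 := rintegrable_indZ mu_haar (P ^ (N%:Z * n%:Z) * (t * q ^ (- N%:Z))) (- N%:Z) 0.
have J2 := Rintegral_indZ mu_haar (P ^ (N%:Z * n%:Z) * (t * q ^ (- N%:Z))) (- N%:Z) 0.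
apply: le_trans (nc_cintegral_le (h := fun x : VB => P ^ (N%:Z * n%:Z) * (t * q ^ (- N%:Z)) * \1_([set y : V | B (- N%:Z) (y - 0)]) x) _ _ j2) _.
- exact: cmeasurableB (cintegrable_cmeasurable b4) (cintegrable_cmeasurable b3).
- move=> x; rewrite FE.
  have -> : (heat t x)%:C * ((P ^ (N%:Z * n%:Z))%:C * ballf R (- N%:Z) 0 x) -
      (P ^ (N%:Z * n%:Z))%:C * ballf R (- N%:Z) 0 x =
      (P ^ (N%:Z * n%:Z))%:C * (((heat t x)%:C - 1) * ballf R (- N%:Z) 0 x).
    by move: (_%:C) (_%:C) (ballf _ _ _ _) => A1 A2 A3; ring.
  have Pn0 : 0 <= P ^ (N%:Z * n%:Z) by rewrite ltW// exprz_gt0// PR_gt0.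
  rewrite ncM nc_real (ger0_norm Pn0) -!mulrA ler_wpM2l//.
  rewrite indicE; have [xN|xN] := pselect (B (- N%:Z) (x - 0)).
    rewrite (mem_set (A := [set y : V | B (- N%:Z) (y - 0)]) xN) (ballf1 R xN).
    rewrite (mulr1 ((heat t x)%:C - 1)) (mulr1 (q ^ _)) -(rmorph1 (real_complex R)) -rmorphB nc_real.
    rewrite ler0_norm ?subr_le0 ?(heat_le1 hs) ?(ltW t0)// opprB.
    have xN' : B (- N%:Z) x by rewrite -[x]subr0.
    apply: le_trans (_ : t * sigma x <= _); last by rewrite ler_wpM2l ?(ltW t0)// (hs_upper hs).
    by rewrite lerBlDl -lerBlDr /heat -mulNr; exact: expR_ge1Dx.
  rewrite (memNset (A := [set y : V | B (- N%:Z) (y - 0)]) xN) (ballf0 R xN).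
  by rewrite (mulr0 ((heat t x)%:C - 1)) nc0 (mulr0 (q ^ _)) (mulr0 t).
rewrite J2 mulNr.
have -> : P ^ (N%:Z * n%:Z) * (t * q ^ (- N%:Z)) * P ^ (- (N%:Z * n%:Z)) = t * q ^ (- N%:Z).
  by rewrite mulrAC -expfzDr ?(lt0r_neq0 (PR_gt0 R p_pr))// subrr mul1r.
by rewrite mulrA.
Qed.

End HeatSemigroup.

(** * Step approximations of the datum and the L^2 limit of their transforms *)

Section Approximation.
Context (R : realType) (p : nat) (p_pr : prime p) (n : nat).
Local Notation K := (Qp p_pr).
Local Notation V := ('rV[K]_n).
Local Notation VB := (QpnBorel p_pr n).
Local Notation nc := (@Normc.normc R).
Implicit Types (x y h : V) (j : int) (k m N r i : nat) (f g : V -> R[i]).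
Variable mu : {measure set VB -> \bar R}.
Hypothesis mu_haar : normalized_haar mu.
Hypothesis n_gt0 : (0 < n)%N.
Local Notation rintegrable u := (mu.-integrable [set: VB] (EFin \o (u : VB -> R))).
Local Notation FT := (FT mu).
Local Notation Rint u := (Rintegral mu [set: VB] (u : VB -> R)).
Local Notation N2 f := (wnorm2 mu (fun=> 1%R) (f : VB -> R[i])).
Local Notation cmeas f := (cmeasurable (f : VB -> R[i])).
Local Notation rmeas u := (measurable_fun [set: VB] (u : VB -> R)).

Lemma normCE (z : R[i]) : `|z| = (nc z)%:C.
Proof. by []. Qed.

Lemma continuous_vcont f : continuous f -> vcont f.
Proof.
move=> cf x e e0; have /cvgrPdist_lt/(_ e%:C) := cf x.
rewrite ltcR => /(_ e0)/nbhsVP[k kP]; exists k => y /kP.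
by rewrite normCE ltcR ncBC.
Qed.

(** The selected point depends only on the coset of x modulo [B (- i)], since equal sets give equal
    choices; the default is never taken because x belongs to the set. *)
Definition sample i x : V := xget 0 [set y | B (- i%:Z) (y - x)].

Lemma sampleB i x : B (- i%:Z) (sample i x - x).
Proof.
rewrite /sample; case: xgetP => [y _ //|/(_ x)/=] H; exfalso; apply: H.
by rewrite (subrr x); exact: B0.
Qed.

Lemma sample_shift i x h : B (- i%:Z) h -> sample i (x + h) = sample i x.
Proof.
move=> hi.
have E : [set y : V | B (- i%:Z) (y - (x + h))] = [set y : V | B (- i%:Z) (y - x)].
  apply: funext => y; apply: propext; rewrite /mkset opprD addrA.
  exact: (BDr _ (BN hi)).
exact: (congr1 (fun A : set V => xget 0 A) E).
Qed.

Definition step_sample k i f x : R[i] := if `[< B k x >] then f (sample i x) else 0.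

Lemma step_step_sample k i f : step (k + i)%N (step_sample k i f).
Proof.
rewrite /step_sample; split=> [x xk|x h hk].
  by rewrite asboolF// => xk'; apply: xk; apply: B_le xk'; rewrite lez_nat leq_addr.
have hi : B (- i%:Z) h by apply: B_le hk; rewrite lerN2 lez_nat leq_addl.
have hk' : B k h by apply: B_le hk; lia.
have -> : `[< B k (x + h) >] = `[< B k x >] by apply: asbool_equiv_eq; exact: BDr.
by rewrite sample_shift.
Qed.

Variables (phi : V -> R[i]) (M : R).
Hypothesis phi_L2 : in_L2 mu (phi : VB -> R[i]).
Hypothesis phi_vcont : vcont phi.
Hypothesis phi_le : forall x, nc (phi x) <= M.

Lemma step_sample_le k i x : nc (step_sample k i phi x) <= M.
Proof.
rewrite /step_sample; case: ifP => // _; rewrite nc0.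
by apply: le_trans (phi_le x); exact: nc_ge0.
Qed.

(** First k is fixed so that phi has little L^2 mass outside [B k]; then i grows, with dominated
    convergence under (2 M)^2 on [B k]. The lower bound m on both indices gives pointwise
    convergence along the chosen sequence. *)
Lemma step_sample_L2 (e : R) m : 0 < e -> exists k i, [/\ (m <= k)%N, (m <= i)%N &
  (N2 (fun x => (step_sample k i phi x - phi x)%R) <= e%:E)%E].
Proof.
move=> e0; have e4 : 0 < e / 4 by rewrite divr_gt0.
have mphi := phi_L2.1; have phi2 := in_L2_rintegrable phi_L2.
have mcut k : cmeas (fun x => ballf R k%:Z (0 : V) x * phi x).
  apply: cmeasurableM mphi; exact: cintegrable_cmeasurable (cintegrable_ballf mu_haar _ _).
have M0 : 0 <= M by apply: le_trans (phi_le 0); exact: nc_ge0.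
pose v k x := nc (ballf R k%:Z (0 : V) x * phi x - phi x) ^+ 2.
have mv k : rmeas (v k) by apply: measurable_nc2; exact: cmeasurableB.
have v01 k x : 0 <= v k x <= nc (phi x) ^+ 2.
  rewrite sqr_ge0/= /v; have [xk|xk] := pselect (B k (x - 0)).
    by rewrite (ballf1 R xk) mul1r subrr nc0 expr0n/= sqr_ge0.
  by rewrite (ballf0 R xk) mul0r sub0r ncN.
have v0 : {ae mu, forall x : VB, v k x @[k --> \oo] --> (0 : R)}.
  apply: aeW => x; have [k xk] := B_bounded (x : V).
  apply/cvgrPdist_le => d d0; exists k => // i /= ki; rewrite /v ballf1.
    by rewrite mul1r subrr nc0 expr0n/= subr0 normr0 ltW.
  by rewrite subr0; apply: B_le xk; rewrite lez_nat.
have [k0 k0P] := Rint_cvg0 mv v01 v0 phi2 e4.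
pose k := (m + k0)%N; have kI := k0P k (leq_addl _ _).
have vi : rintegrable (v k).
  apply: rintegrable_le phi2 => // x; have /andP[a b] := v01 k x.
  by rewrite (ger0_norm a) (ger0_norm (le_trans a b)).
pose w i x := nc (step_sample k i phi x - ballf R k%:Z (0 : V) x * phi x) ^+ 2.
have ms i : cmeas (step_sample k i phi) by exact: step_cmeasurable (step_step_sample k i phi).
have mw i : rmeas (w i) by apply: measurable_nc2; exact: cmeasurableB.
pose D x := 4 * M ^+ 2 * \1_([set y : V | B k (y - 0)]) x : R.
have Di : rintegrable D by exact: (rintegrable_indZ mu_haar).
have w01 i x : 0 <= w i x <= D x.
  rewrite sqr_ge0/= /w /D indicE /step_sample; have [xk|xk] := pselect (B k (x - 0)).
    rewrite (mem_set (A := [set y : V | B k (y - 0)]) xk) (ballf1 R xk).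
    have xk' : B k x by rewrite -[x]subr0.
    rewrite (mulr1 (4 * M ^+ 2)) (mul1r (phi x)) (asboolT xk').
    have -> : 4 * M ^+ 2 = (M + M) ^+ 2 by ring.
    rewrite ler_pXn2r ?nnegrE ?addr_ge0 ?nc_ge0//.
    by apply: le_trans (ncB _ _) _; exact: lerD.
  rewrite (memNset (A := [set y : V | B k (y - 0)]) xk) (ballf0 R xk).
  have xk' : ~ B k x by move=> xk'; apply: xk; rewrite subr0.
  by rewrite (asboolF xk') (mul0r (phi x)) subr0 nc0 expr0n (mulr0 (4 * M ^+ 2)).
have w0 : {ae mu, forall x : VB, w k x @[k --> \oo] --> (0 : R)}.
  apply: aeW => x; rewrite /w /step_sample.
  have [xk|xk] := pselect (B k ((x : V) - 0)); last first.
    apply/cvgrPdist_le => d d0; exists 0%N => // i /= _.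
    have xk' : ~ B k (x : V) by move=> xk'; apply: xk; rewrite subr0.
    by rewrite (ballf0 R xk) (asboolF xk') (mul0r (phi x)) subr0 nc0 expr0n subr0 normr0 ltW.
  apply/cvgrPdist_le => d d0.
  have [i iP] := phi_vcont x (e := Num.sqrt d) (ltac:(by rewrite sqrtr_gt0)).
  have xk' : B k (x : V) by rewrite -[x : V]subr0.
  exists i => // r /= ir; rewrite (ballf1 R xk) (mul1r (phi x)) (asboolT xk').
  rewrite sub0r normrN ger0_norm ?sqr_ge0// -[leRHS]sqr_sqrtr ?(ltW d0)//.
  rewrite ler_pXn2r ?nnegrE ?sqrtr_ge0 ?nc_ge0// ltW//; apply: iP.
  by apply: B_le (sampleB r x); rewrite lerN2 lez_nat.
have [i0 i0P] := Rint_cvg0 mw w01 w0 Di e4.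
pose i := (m + i0)%N; have iI := i0P i (leq_addl _ _).
have wi : rintegrable (w i).
  apply: rintegrable_le Di => // x; have /andP[a b] := w01 i x.
  by rewrite (ger0_norm a) (ger0_norm (le_trans a b)).
exists k, i; split; do ?exact: leq_addr.
apply: le_trans (wnorm2_triangle mu (g := fun x => ballf R k%:Z (0 : V) x * phi x) _ _ _ _ _) _ => //.
rewrite !N2_Rint// -!EFinM -EFinD lee_fin.
apply: le_trans (_ : 2 * (e / 4) + 2 * (e / 4) <= _).
  by apply: lerD; rewrite ler_wpM2l.
by rewrite le_eqVlt; apply/orP; left; apply/eqP; field.
Qed.

Lemma step_approximation : exists s : nat -> V -> R[i], [/\
  forall k, exists r, step r (s k), forall k x, nc (s k x) <= M,
  forall x (e : R), 0 < e -> exists N, forall k, (N <= k)%N -> nc (s k x - phi x) < e &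
  forall e : R, 0 < e -> exists N, forall k, (N <= k)%N ->
    (N2 (fun x => (s k x - phi x)%R) <= e%:E)%E].
Proof.
have H m : {ki : nat * nat | [/\ (m <= ki.1)%N, (m <= ki.2)%N &
    (N2 (fun x => (step_sample ki.1 ki.2 phi x - phi x)%R) <= (m.+1%:R^-1)%:E)%E]}.
  apply: cid; have [k [i H]] := step_sample_L2 m (e := m.+1%:R^-1) (ltac:(by rewrite invr_gt0 ltr0n)).
  by exists (k, i).
exists (fun m => step_sample (sval (H m)).1 (sval (H m)).2 phi); split.
- by move=> m; exists ((sval (H m)).1 + (sval (H m)).2)%N; exact: step_step_sample.
- by move=> m x; exact: step_sample_le.
- move=> x e e0; have [k xk] := B_bounded x; have [i iP] := phi_vcont x e0.
  exists (k + i)%N => m kim; case: (H m) => -[k' i'] /= [k'm i'm _].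
  rewrite /step_sample asboolT; last first.
    by apply: B_le xk; rewrite lez_nat (leq_trans _ k'm)// (leq_trans _ kim)// leq_addr.
  apply: iP; apply: B_le (sampleB i' x).
  by rewrite lerN2 lez_nat (leq_trans _ i'm)// (leq_trans _ kim)// leq_addl.
- move=> e e0; have [N NP] := expn_unbounded e^-1 (ltr1n R 2).
  exists (2 ^ N)%N => m Nm; case: (H m) => -[k i] /= [_ _]; move/le_trans; apply.
  rewrite lee_fin invf_ple ?posrE ?ltr0n//; apply: le_trans (ltW NP) _.
  by rewrite -natrX ler_nat (leq_trans Nm).
Qed.

(** By Parseval the transforms of a sequence convergent in L^2 are Cauchy; g is the L^2 transform of
    f. *)
Lemma fourier_limit (s : nat -> V -> R[i]) f : cmeas f ->
  (forall k, exists r, step r (s k)) ->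
  (forall e : R, 0 < e -> exists N, forall k, (N <= k)%N ->
    (N2 (fun x => (s k x - f x)%R) <= e%:E)%E) ->
  exists2 g, in_L2 mu (g : VB -> R[i]) & forall e : R, 0 < e -> exists N, forall k, (N <= k)%N ->
    (N2 (fun x => (FT true (s k) x - g x)%R) <= e%:E)%E.
Proof.
move=> mf ss sf.
have ms k : cmeas (s k) by have [r /step_cmeasurable] := ss k.
have mS k : cmeas (FT true (s k)).
  by have [r /(step_FT mu_haar true)/step_cmeasurable] := ss k.
have [|g mg gS] := L2_complete (mu := mu) (s := fun k => FT true (s k)) mS.
  move=> e e0; have [N NP] := sf (e / 4) (ltac:(by rewrite divr_gt0)).
  exists N => i j Ni Nj.
  have [r ri] := ss i; have [r' rj] := ss j.
  have [m mij] := step_level_sub ri rj.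
  have -> : (fun x => FT true (s i) x - FT true (s j) x) = FT true (fun x => s i x - s j x).
    by rewrite (FTB _ (step_cintegrable mu_haar ri) (step_cintegrable mu_haar rj)).
  rewrite (FT_parseval mu_haar true mij).
  apply: le_trans (wnorm2_triangle mu (g := f) _ _ _ _ _) _ => //.
  have -> : e%:E = (2%:E * (e / 4)%:E + 2%:E * (e / 4)%:E)%E.
    by rewrite -!EFinM -EFinD; congr EFin; field.
  apply: leeD; apply: lee_wpmul2l; rewrite ?lee_fin//; first exact: NP.
  by rewrite wnorm2C; exact: NP.
have I0 k : (0 <= N2 (fun x => (FT true (s k) x - g x)%R))%E by apply: wnorm2_ge0.
have gP := (ge0_cvge0P I0).1 gS.
exists g => //; split=> //.
have [N NP] := gP 1 ltr01; have [r rN] := ss N.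
have gE : wnorm2 mu (fun=> 1%R) (g : VB -> R[i]) = wnorm2 mu (fun=> 1%R) (fun x : VB => g x - 0).
  by congr wnorm2; apply/funext => x; rewrite subr0.
rewrite gE; apply: le_lt_trans (wnorm2_triangle mu (g := FT true (s N)) _ _ _ _ _) _ => //.
rewrite wnorm2C; apply: lte_add_pinfty; apply: lte_mul_pinfty; rewrite ?lee_fin//.
  exact: le_lt_trans (NP N (leqnn N)) (ltry _).
have -> : wnorm2 mu (fun=> 1%R) (fun x : VB => FT true (s N) x - 0) = N2 (FT true (s N)).
  by congr wnorm2; apply/funext => x; rewrite subr0.
by rewrite (FT_parseval mu_haar true rN); exact: (step_N2_lty mu_haar rN).
Qed.

End Approximation.

Section ExpBounds.
Variable R : realType.
Implicit Types (y : R) (i : nat).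

Lemma pow_le_expR i y : 0 <= y -> y ^+ i <= i`!%:R * expR y.
Proof.
move=> y0; case: i => [|i]; first by rewrite expr0 mul1r -expR0 ler_expR.
have f0 : 0 < (i.+1)`!%:R :> R by rewrite ltr0n fact_gt0.
rewrite -ler_pdivrMl// mulrC; apply: le_trans (expR_ge1Dxn i y0).
by rewrite lerDr.
Qed.

Lemma expR_sub1_le y : `|expR y - 1| <= `|y| * expR `|y|.
Proof.
have e1 : 1 + - y <= expR (- y) by exact: expR_ge1Dx.
have e2 : 1 + y <= expR y by exact: expR_ge1Dx.
have ep : 1 <= expR `|y| by rewrite -expR0 ler_expR.
have [y0|y0] := leP 0 y.
  rewrite ger0_norm; last by rewrite subr_ge0; apply: le_trans e2; rewrite lerDl.
  have : (1 - y) * expR y <= 1 by rewrite -[leRHS](mulVf (lt0r_neq0 (expR_gt0 y))) ler_wpM2r ?expR_ge0// -expRN.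
  rewrite (ger0_norm y0) mulrBl mul1r => h; lra.
have yn : `|y| = - y by rewrite ltr0_norm.
rewrite ler0_norm; last by rewrite subr_le0 -expR0 ler_expR ltW.
apply: le_trans (_ : `|y| * 1 <= _); last by rewrite ler_wpM2l.
rewrite yn; lra.
Qed.

Lemma expR_taylor2_le y : `|expR y - 1 - y| <= y ^+ 2 * expR `|y|.
Proof.
have e2 : 1 + y <= expR y by exact: expR_ge1Dx.
rewrite ger0_norm; last by lra.
have e1 : (1 - y) * expR y <= 1.
  rewrite -[leRHS](mulVf (lt0r_neq0 (expR_gt0 y))) ler_wpM2r ?expR_ge0// -expRN.
  exact: expR_ge1Dx.
apply: le_trans (_ : y * (expR y - 1) <= _); first by lra.
apply: le_trans (ler_norm _) _; rewrite normrM -real_normK ?num_real// expr2 -mulrA.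
by rewrite ler_wpM2l// expR_sub1_le.
Qed.

End ExpBounds.

Section HeatMultiplier.
Context (R : realType) (p : nat) (p_pr : prime p) (n : nat).
Local Notation K := (Qp p_pr).
Local Notation V := ('rV[K]_n).
Local Notation VB := (QpnBorel p_pr n).
Implicit Types (x y h : V) (j : int) (t : R) (r i : nat).
Variable mu : {measure set VB -> \bar R}.
Hypothesis mu_haar : normalized_haar mu.
Local Notation rintegrable u := (mu.-integrable [set: VB] (EFin \o (u : VB -> R))).
Local Notation rmeas u := (measurable_fun [set: VB] (u : VB -> R)).
Variables (sigma : V -> R) (c q : R) (l : nat).
Hypothesis hs : homogeneous_symbol sigma c q l.
Local Notation heat := (heat sigma).

(** Up to sign the i-th time derivative of [heat]: index 0 gives the solution, 1 its derivative, 2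
    the Taylor remainder. *)
Definition heat_mult i t x : R := sigma x ^+ i * heat t x.

Let s0 x : 0 <= sigma x. Proof. exact: symbol_ge0 hs x. Qed.

Lemma heat_mult_ge0 i t x : 0 <= heat_mult i t x.
Proof. by rewrite mulr_ge0 ?exprn_ge0// ltW// heat_gt0. Qed.

Lemma symbol_mult_heat_mult i t : symbol_mult l (heat_mult i t).
Proof.
move=> j x h xj hj; rewrite /heat_mult (hs_const hs xj hj).
by rewrite (symbol_mult_heat hs t xj hj).
Qed.

Lemma measurable_heat_mult i t : rmeas (heat_mult i t).
Proof.
apply: measurable_funM; last exact: measurable_heat hs t.
exact: measurable_funX (measurable_symbol hs).
Qed.

(** Half of the exponent absorbs the power of sigma, by y^i <= i! e^y at y = t sigma / 2. *)
Lemma heat_mult_le i t x : 0 < t -> heat_mult i t x <= i`!%:R * (2 / t) ^+ i * heat (t / 2) x.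
Proof.
move=> t0; have y0 : 0 <= t / 2 * sigma x by rewrite mulr_ge0// divr_ge0// ltW.
have := pow_le_expR i y0; set y := t / 2 * sigma x => h.
rewrite /heat_mult.
have -> : heat t x = expR (- y) * heat (t / 2) x.
  by rewrite /heat -expRD; congr expR; rewrite /y; field.
have -> : sigma x = 2 / t * y by rewrite /y; field; rewrite lt0r_neq0.
rewrite exprMn mulrA ler_wpM2r ?(ltW (heat_gt0 _ _ _))//.
rewrite -mulrA mulrC ler_wpM2r ?exprn_ge0 ?divr_ge0 ?(ltW t0)//.
by rewrite expRN -ler_pdivlMr ?invr_gt0 ?expR_gt0// invrK.
Qed.

Lemma heat_mult_bounded i t x : 0 < t -> heat_mult i t x <= i`!%:R * (2 / t) ^+ i.
Proof.
move=> t0; apply: le_trans (heat_mult_le i x t0) _.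
rewrite ler_piMr ?mulr_ge0 ?exprn_ge0 ?divr_ge0 ?(ltW t0)//.
by apply: (heat_le1 hs); rewrite divr_ge0// ltW.
Qed.

Lemma rintegrable_heat_mult2 i t : 0 < t -> rintegrable (fun x => heat_mult i t x ^+ 2).
Proof.
move=> t0; have t20 : 0 < t / 2 by rewrite divr_gt0.
have [ji _] := Rintegral_Zr ((i`!%:R * (2 / t) ^+ i) ^+ 2) (rintegrable_heat mu_haar hs t20).
apply: rintegrable_le ji => [|x].
  exact: measurable_funX (measurable_heat_mult i t).
have h0 := heat_gt0 sigma (t / 2) x.
rewrite !ger0_norm ?sqr_ge0 ?mulr_ge0 ?sqr_ge0 ?exprn_ge0 ?divr_ge0 ?(ltW t0) ?(ltW h0)//.
apply: le_trans (_ : (i`!%:R * (2 / t) ^+ i * heat (t / 2) x) ^+ 2 <= _).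
  rewrite ler_pXn2r ?nnegrE ?heat_mult_ge0 ?heat_mult_le//.
  by apply: le_trans (heat_mult_le i x t0); exact: heat_mult_ge0.
rewrite exprMn ler_wpM2l ?sqr_ge0// expr2 ler_piMl ?(ltW h0)//.
by apply: (heat_le1 hs); exact: ltW.
Qed.

Lemma heat_shift t t' x : heat t' x = heat t x * expR (- (t' - t) * sigma x).
Proof. by rewrite /heat -expRD; congr expR; ring. Qed.

(** A time shift of at most t / 2 costs at most half of the exponent, so the remainders of [expR]
    below are dominated by a multiplier at time t / 2 that does not depend on t'. *)
Lemma heat_half t t' x : `|t' - t| <= t / 2 ->
  heat t x * expR `|- (t' - t) * sigma x| <= heat (t / 2) x.
Proof.
move=> tt; rewrite /heat -expRD ler_expR normrM normrN (ger0_norm (s0 x)) -mulrDl.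
rewrite ler_wpM2r//; move: tt; set a := `|_|; move: a => a tt; lra.
Qed.

Lemma heat_mult_lipschitz i t t' x : `|t' - t| <= t / 2 ->
  `|heat_mult i t' x - heat_mult i t x| <= `|t' - t| * heat_mult i.+1 (t / 2) x.
Proof.
move=> tt; rewrite /heat_mult (heat_shift t t'); set E := expR _.
have -> : sigma x ^+ i * (heat t x * E) - sigma x ^+ i * heat t x =
  sigma x ^+ i * (heat t x * (E - 1)) by ring.
have -> : `|t' - t| * (sigma x ^+ i.+1 * heat (t / 2) x) =
  sigma x ^+ i * (`|t' - t| * (sigma x * heat (t / 2) x)) by rewrite exprS; ring.
rewrite !normrM (ger0_norm (exprn_ge0 _ (s0 x))) (gtr0_norm (heat_gt0 _ _ _)).
rewrite ler_wpM2l ?exprn_ge0//.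
apply: le_trans (_ : heat t x * (`|- (t' - t) * sigma x| * expR `|- (t' - t) * sigma x|) <= _).
  by rewrite ler_wpM2l ?(ltW (heat_gt0 _ _ _))// expR_sub1_le.
rewrite mulrCA {1}normrM normrN (ger0_norm (s0 x)) -mulrA.
by rewrite ler_wpM2l// ler_wpM2l// heat_half.
Qed.

Lemma heat_taylor t (r : R) x : `|r| <= t / 2 ->
  `|heat (t + r) x - heat t x + r * heat_mult 1 t x| <= r ^+ 2 * heat_mult 2 (t / 2) x.
Proof.
move=> rt; have rE : (t + r) - t = r by rewrite addrC addKr.
rewrite /heat_mult (heat_shift t (t + r)) rE expr1.
have -> : heat t x * expR (- r * sigma x) - heat t x + r * (sigma x * heat t x) =
  heat t x * (expR (- r * sigma x) - 1 - (- r * sigma x)) by ring.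
rewrite normrM (gtr0_norm (heat_gt0 _ _ _)).
apply: le_trans (ler_wpM2l (ltW (heat_gt0 _ _ _)) (expR_taylor2_le _)) _.
rewrite mulrCA exprMn sqrrN -mulrA.
rewrite !ler_wpM2l ?sqr_ge0//.
by have := @heat_half t (t + r) x; rewrite rE; apply.
Qed.

End HeatMultiplier.

Lemma half_shift_gt0 (R : realType) (t t' : R) : 0 < t -> `|t' - t| <= t / 2 -> 0 < t'.
Proof. by move=> t0; rewrite ler_norml => /andP[]; lra. Qed.

Section Solution.
Context (R : realType) (p : nat) (p_pr : prime p) (n : nat).
Local Notation K := (Qp p_pr).
Local Notation V := ('rV[K]_n).
Local Notation VB := (QpnBorel p_pr n).
Local Notation nc := (@Normc.normc R).
Implicit Types (x y h xi : V) (t e : R) (k m N r i : nat) (f : V -> R[i]).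
Variable mu : {measure set VB -> \bar R}.
Hypothesis mu_haar : normalized_haar mu.
Hypothesis n_gt0 : (0 < n)%N.
Local Notation rintegrable u := (mu.-integrable [set: VB] (EFin \o (u : VB -> R))).
Local Notation cint f := (cintegral mu (f : VB -> R[i])).
Local Notation cintble f := (cintegrable mu (f : VB -> R[i])).
Local Notation FT := (FT mu).
Local Notation Rint u := (Rintegral mu [set: VB] (u : VB -> R)).
Local Notation N2 f := (wnorm2 mu (fun=> 1%R) (f : VB -> R[i])).
Local Notation cmeas f := (cmeasurable (f : VB -> R[i])).
Local Notation rmeas u := (measurable_fun [set: VB] (u : VB -> R)).
Variables (sigma : V -> R) (c q : R) (l : nat).
Hypothesis hs : homogeneous_symbol sigma c q l.
Local Notation heat := (heat sigma).
Local Notation hkernel := (hkernel mu sigma).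
Local Notation hm := (heat_mult sigma).
Variables (phi g : V -> R[i]) (M : R) (s : nat -> V -> R[i]).
Hypothesis phi_vcont : vcont phi.
Hypothesis phi_le : forall x, nc (phi x) <= M.
Hypothesis s_step : forall k, exists r, step r (s k).
Hypothesis s_le : forall k x, nc (s k x) <= M.
Hypothesis s_cvg : forall x e, 0 < e -> exists N, forall k, (N <= k)%N -> nc (s k x - phi x) < e.
Hypothesis g_L2 : in_L2 mu (g : VB -> R[i]).
Hypothesis g_lim : forall e, 0 < e -> exists N, forall k, (N <= k)%N ->
    (N2 (fun x => (FT true (s k) x - g x)%R) <= e%:E)%E.

Let mg : cmeas g := g_L2.1.
Let mS k : cmeas (FT true (s k)).
Proof. by have [r /(step_FT mu_haar true)/step_cmeasurable] := s_step k. Qed.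
Let M0 : 0 <= M.
Proof. by apply: le_trans (phi_le 0); exact: nc_ge0. Qed.
Let mphi : cmeas phi := vcont_cmeasurable phi_vcont.

Lemma cintegrable_mulL2 (u : V -> R) : rmeas u -> rintegrable (fun x => u x ^+ 2) ->
  cintble (fun x => (u x)%:C * g x).
Proof.
move=> mu_ u2; have ug := rintegrable_mulL2 mu_ u2 g_L2.
apply: (cintegrable_le (h := (fun x => `|u x| * nc (g x)) : VB -> R)) ug.
  by apply: cmeasurableM mg; exact: cmeasurable_real.
by move=> x; rewrite ncM nc_real.
Qed.

Lemma in_L2_bddM (u : V -> R) (C : R) : rmeas u -> (forall x, `|u x| <= C) ->
  in_L2 mu ((fun x => (u x)%:C * g x) : VB -> R[i]).
Proof.
move=> mu_ uC; have C0 : 0 <= C by apply: le_trans (uC 0).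
have mug : cmeas (fun x => (u x)%:C * g x).
  by apply: cmeasurableM mg; exact: cmeasurable_real.
split=> //.
have [ji _] := Rintegral_Zr (C ^+ 2) (in_L2_rintegrable g_L2).
rewrite N2_Rint ?ltry//; apply: rintegrable_le ji => [|x]; first exact: measurable_nc2.
rewrite !ger0_norm ?sqr_ge0 ?mulr_ge0 ?sqr_ge0 ?nc_ge0//.
rewrite ncM exprMn ler_wpM2r ?sqr_ge0// nc_real.
by rewrite ler_pXn2r ?nnegrE.
Qed.

Section OneMultiplier.
Variables (u : V -> R) (C : R).
Hypothesis ul : symbol_mult l u.
Hypothesis mu_ : rmeas u.
Hypothesis uC : forall x, `|u x| <= C.
Hypothesis u2 : rintegrable (fun x => u x ^+ 2).

Definition mult_step k x : R[i] := (trunc k u x)%:C * FT true (s k) x.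

Lemma step_mult_step k : exists r, step r (mult_step k).
Proof.
have [r rk] := s_step k.
exact: (trunc_mul_step n_gt0 ul k (step_FT mu_haar true rk)).
Qed.

Lemma mult_step_L2 (e : R) : 0 < e -> exists N, forall k, (N <= k)%N ->
  (N2 (fun x => (mult_step k x - (u x)%:C * g x)%R) <= e%:E)%E.
Proof.
apply: (multiplier_cvg mu_haar n_gt0 ul mu_ mS g_L2 g_lim (C := C ^+ 2)) => //.
move=> x; rewrite mul1r -(real_normK (num_real (u x))).
by rewrite ler_pXn2r ?nnegrE//; apply: le_trans (uC x).
Qed.

Lemma fourierL2_mult : fourierL2 mu (FT false (fun x => (u x)%:C * g x)) (fun x => (u x)%:C * g x).
Proof.
apply: (fourierL2_FT mu_haar (H := mult_step)).
- exact: step_mult_step.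
- exact: cintegrable_mulL2.
- exact: in_L2_bddM uC.
- exact: mult_step_L2.
- exact: (multiplier_cvg1 mu_haar n_gt0 ul mu_ mS g_L2 g_lim).
Qed.
End OneMultiplier.

(** [heatU 0] is the solution for t > 0; [heatU 1] is f(D, alpha) applied to it, hence minus its
    time derivative. *)
Definition heatU i t x : R[i] := FT false (fun xi => (hm i t xi)%:C * g xi) x.

Lemma cintegrable_hm i t : 0 < t -> cintble (fun xi => (hm i t xi)%:C * g xi).
Proof.
move=> t0; apply: cintegrable_mulL2; first exact: measurable_heat_mult hs i t.
exact: (rintegrable_heat_mult2 mu_haar hs).
Qed.

Lemma hm_abs_le i t x : 0 < t -> `|hm i t x| <= i`!%:R * (2 / t) ^+ i.
Proof. by move=> t0; rewrite ger0_norm ?(heat_mult_ge0 hs)// (heat_mult_bounded hs). Qed.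

Lemma fourierL2_heatU i t : 0 < t -> fourierL2 mu (heatU i t) (fun xi => (hm i t xi)%:C * g xi).
Proof.
move=> t0; apply: fourierL2_mult (hm_abs_le i (t := t) ^~ t0) _.
- exact: (symbol_mult_heat_mult hs).
- exact: (measurable_heat_mult hs).
- exact: (rintegrable_heat_mult2 mu_haar hs).
Qed.

Lemma heatU_lipschitz i t : 0 < t -> exists2 L : R, 0 <= L &
  forall t' x, `|t' - t| <= t / 2 -> nc (heatU i t' x - heatU i t x) <= L * `|t' - t|.
Proof.
move=> t0; have t20 : 0 < t / 2 by rewrite divr_gt0.
have Ui := cintegrable_nc (cintegrable_hm i.+1 t20).
exists (2 * Rint (fun xi => nc ((hm i.+1 (t / 2) xi)%:C * g xi))).
  by rewrite mulr_ge0//; apply: Rint_ge0 => x; exact: nc_ge0.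
move=> t' x tt.
have t'0 : 0 < t'.
  exact: half_shift_gt0 tt.
rewrite /heatU; have := FTB false (cintegrable_hm i t'0) (cintegrable_hm i t0).
move=> /(congr1 (fun F => F x)) <-.
have [j1 J1] := Rintegral_Zr `|t' - t| Ui.
rewrite mulrC mulrCA -J1; apply: nc_FT_le j1.
  exact: cmeasurableB (cintegrable_cmeasurable (cintegrable_hm i t'0)) (cintegrable_cmeasurable (cintegrable_hm i t0)).
move=> y; rewrite -mulrBl -rmorphB !ncM !nc_real mulrA ler_wpM2r ?nc_ge0//.
rewrite (ger0_norm (heat_mult_ge0 hs _ _ _)).
exact: (heat_mult_lipschitz hs).
Qed.

(** [heat_taylor] bounds the integrand by |r| sigma^2 e^(-t sigma / 2) |g|, which is integrable; the
    difference quotient therefore converges at rate O(|r|), uniformly in x. *)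
Lemma heatU_taylor t : 0 < t -> exists2 L : R, 0 <= L &
  forall (r : R) x, r != 0 -> `|r| <= t / 2 ->
    nc ((r^-1)%:C * (heatU 0 (t + r) x - heatU 0 t x) + heatU 1 t x) <= L * `|r|.
Proof.
move=> t0; have t20 : 0 < t / 2 by rewrite divr_gt0.
have Ui := cintegrable_nc (cintegrable_hm 2 t20).
exists (2 * Rint (fun xi => nc ((hm 2 (t / 2) xi)%:C * g xi))).
  by rewrite mulr_ge0//; apply: Rint_ge0 => x; exact: nc_ge0.
move=> r x r0 rt.
have t'0 : 0 < t + r.
  by apply: half_shift_gt0 t0 _; rewrite [t + r]addrC addrK.
have i1 := cintegrable_hm 0 t'0; have i2 := cintegrable_hm 0 t0.
have i3 := cintegrable_hm 1 t0.
have i4 := cintegrableB i1 i2; have i5 := cintegrableZ (r^-1)%:C i4.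
rewrite /heatU; have := FTB false i1 i2.
move=> /(congr1 (fun F => F x)) <-.
have := FTZ false (r^-1)%:C i4 => /(congr1 (fun F => F x)) <-.
have := FTD false i5 i3 => /(congr1 (fun F => F x)) <-.
have [j1 J1] := Rintegral_Zr `|r| Ui.
rewrite mulrC mulrCA -J1; apply: nc_FT_le j1.
  exact: cintegrable_cmeasurable (cintegrableD i5 i3).
move=> y; rewrite -mulrBl mulrA -mulrDl -rmorphB -rmorphM -rmorphD !ncM !nc_real mulrA.
rewrite ler_wpM2r ?nc_ge0// (ger0_norm (heat_mult_ge0 hs _ _ _)).
have -> : r^-1 * (hm 0 (t + r) y - hm 0 t y) + hm 1 t y =
   r^-1 * (heat (t + r) y - heat t y + r * hm 1 t y).
  by rewrite {1 2}/heat_mult !expr0 !mul1r; field.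
rewrite normrM normfV ler_pdivrMl ?normr_gt0// [leRHS]mulrA -[_ * `|r|]expr2 real_normK ?num_real//.
exact: (heat_taylor hs).
Qed.

Lemma vcont_reflect f x : vcont f -> vcont (fun y => f (x - y)).
Proof.
move=> fc y e e0; have [k kP] := fc (x - y) e e0; exists k => z zy; apply: kP.
have -> : x - z - (x - y) = - (z - y) by rewrite opprD opprK addrACA subrr add0r opprB addrC.
exact: BN.
Qed.

Lemma cintegrable_convolution t x f (D : R) : 0 < t -> vcont f -> (forall y, nc (f y) <= D) ->
  cintble (fun y => hkernel t y * f (x - y)).
Proof.
move=> t0 fc fD; have ki := cintegrable_kernel mu_haar hs t0.
have -> : (fun y => hkernel t y * f (x - y)) = (fun y => f (x - y) * hkernel t y).
  by apply/funext => y; rewrite mulrC.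
by apply: (cintegrable_bddM ki (vcont_cmeasurable (vcont_reflect x fc)) (M := D)) => y.
Qed.

(** The formula holds for the step approximations of phi. The convolution passes to the limit by
    dominated convergence under 2 M |Z|, the inverse transform because [heat t] is square integrable
    and the transforms converge to g in L^2. *)
Lemma heat_convolution t x : 0 < t -> cint (fun y => hkernel t y * phi (x - y)) = heatU 0 t x.
Proof.
move=> t0; have kn := cintegrable_nc (cintegrable_kernel mu_haar hs t0).
apply: nc_small_eq => e e0; have e4 : 0 < e / 4 by rewrite divr_gt0.
have sc k : vcont (s k) by have [r /step_vcont] := s_step k.
have si k := cintegrable_convolution x t0 (sc k) (s_le k).
have pi := cintegrable_convolution x t0 phi_vcont phi_le.
pose v k y := nc (hkernel t y) * nc (s k (x - y) - phi (x - y)).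
have mk : rmeas (fun y => nc (hkernel t y)).
  exact: (measurable_nc (cintegrable_cmeasurable (cintegrable_kernel mu_haar hs t0))).
have md k : cmeas (fun y => s k (x - y) - phi (x - y)).
  by apply: cmeasurableB; apply: vcont_cmeasurable; exact: vcont_reflect.
have mv k : rmeas (v k) by apply: measurable_funM => //; exact: measurable_nc.
have [j1 J1] := Rintegral_Zr (2 * M) kn.
have v01 k y : 0 <= v k y <= 2 * M * nc (hkernel t y).
  rewrite mulr_ge0 ?nc_ge0//= /v mulrC ler_wpM2r ?nc_ge0//.
  by rewrite mulr2n mulrDl mul1r; apply: le_trans (ncB _ _) _; exact: lerD.
have v0 : {ae mu, forall y : VB, v k y @[k --> \oo] --> (0 : R)}.
  apply: aeW => y; apply/cvgrPdist_le => d d0.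
  have D0 : 0 < nc (hkernel t y) + 1 by rewrite ltr_wpDl// nc_ge0.
  have [N NP] := s_cvg (x - (y : V)) (divr_gt0 d0 D0).
  exists N => // k /= Nk; have /andP[vk0 _] := v01 k y.
  rewrite sub0r normrN (ger0_norm vk0) /v.
  apply: le_trans (ler_wpM2l (nc_ge0 _) (ltW (NP k Nk))) _.
  rewrite mulrCA ger_pMr// ler_pdivrMr// mul1r; by rewrite lerDl.
have [N1 N1P] := Rint_cvg0 mv v01 v0 j1 e4.
have mh : rmeas (heat t) by exact: measurable_heat hs t.
have h2 : rintegrable (fun y => heat t y ^+ 2).
  have := rintegrable_heat_mult2 mu_haar hs 0 t0.
  by apply: eq_integrable => // y _ /=; rewrite /heat_mult expr0 mul1r.
have mSg k : cmeas (fun y => FT true (s k) y - g y) by exact: cmeasurableB.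
have [N2 N2P] := L1_of_L2_cvg0 mh h2 mSg g_lim e4.
pose k := (N1 + N2)%N.
have I1 := N1P k (leq_addr _ _); have [i2 I2] := N2P k (leq_addl _ _).
have vi : rintegrable (v k).
  apply: rintegrable_le j1 => // y; have /andP[a b] := v01 k y.
  by rewrite (ger0_norm a) (ger0_norm (le_trans a b)).
apply: le_trans (nc_triangle (cint (fun y => hkernel t y * s k (x - y))) _ _) _.
apply: le_trans (_ : 2 * (e / 4) + 2 * (e / 4) <= _); last first.
  by rewrite le_eqVlt; apply/orP; left; apply/eqP; field.
apply: lerD.
  rewrite ncBC -cintegralB//.
  apply: le_trans (nc_cintegral_le (h := (v k : VB -> R)) _ _ vi) _; last by rewrite ler_wpM2l.
    exact: cmeasurableB (cintegrable_cmeasurable (si k)) (cintegrable_cmeasurable pi).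
  by move=> y; rewrite -mulrBr ncM.
have [r rk] := s_step k.
have ci : cintble (fun y => (heat t y)%:C * FT true (s k) y).
  have -> : (fun y => (heat t y)%:C * FT true (s k) y) = (fun y => FT true (s k) y * (heat t y)%:C).
    by apply/funext => y; rewrite mulrC.
  exact: step_cintegrableM (step_FT mu_haar true rk) (cintegrable_heat mu_haar hs t0).
have hi : cintble (fun y => (heat t y)%:C * g y) by exact: cintegrable_mulL2.
have -> : heatU 0 t x = FT false (fun y => (heat t y)%:C * g y) x.
  by apply: eq_FT => y; rewrite /heat_mult expr0 mul1r.
rewrite (convolution_step mu_haar n_gt0 hs x t0 rk).
have := FTB false ci hi => /(congr1 (fun F => F x)) <-.
apply: le_trans (nc_FT_le _ _ _ _ i2) _; last by rewrite ler_wpM2l.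
  exact: cmeasurableB (cintegrable_cmeasurable ci) (cintegrable_cmeasurable hi).
by move=> y; rewrite -mulrBr ncM nc_real.
Qed.

(** Total mass 1 turns the difference into the integral of Z(y) (phi(x - y) - phi(x0)). Near y = 0
    continuity at x0 and the uniform L^1 bound act; far away the kernel is O(t) times an integrable
    tail. *)
Lemma heatU_initial x0 e : 0 < e -> exists m, exists2 dl : R, 0 < dl &
  forall x t, B (- m%:Z) (x - x0) -> 0 < t -> t < dl -> nc (heatU 0 t x - phi x0) <= e.
Proof.
move=> e0; have [C C0 [kint ktail]] := kernel_bound mu_haar hs.
have C1 : 0 < 4 * (C + 1) by rewrite mulr_gt0// ltr_wpDl.
have [m mP] := phi_vcont x0 (divr_gt0 e0 C1).
set e1 := e / (4 * (C + 1)) in mP.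
have e10 : 0 < e1 by rewrite divr_gt0.
set T0 := Rint (tailf q (- m%:Z)).
have T00 : 0 <= T0 by apply: Rint_ge0 => y; exact: tailf_ge0 hs _ _.
have D0 : 0 < 8 * (M * C * T0) + 1 by rewrite ltr_wpDl// mulr_ge0// mulr_ge0// mulr_ge0.
exists m, (e / (8 * (M * C * T0) + 1)); first by rewrite divr_gt0.
move=> x t xm t0 td; have [kn kC] := kint t t0.
have ki := cintegrable_kernel mu_haar hs t0.
have pi := cintegrable_convolution x t0 phi_vcont phi_le.
rewrite -(heat_convolution x t0).
have ki0 := cintegrableZ (phi x0) ki.
have -> : phi x0 = cint (fun y => phi x0 * hkernel t y).
  by rewrite cintegralZ// (cintegral_hkernel mu_haar n_gt0 hs t0) mulr1.
rewrite -cintegralB//.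
have [j1 J1] := Rintegral_Zr e1 kn.
have [j2 J2] := Rintegral_Zr (2 * M * (C * t)) (rintegrable_tailf mu_haar hs (- m%:Z)).
have ji : rintegrable (fun y => e1 * nc (hkernel t y) + 2 * M * (C * t) * tailf q (- m%:Z) y).
  by have := integrableD measurableT j1 j2; apply: eq_integrable.
apply: le_trans (nc_cintegral_le _ _ ji) _.
- exact: cmeasurableB (cintegrable_cmeasurable pi) (cintegrable_cmeasurable ki0).
- move=> y; rewrite [phi x0 * _]mulrC -mulrBr ncM.
  have [ym|ym] := pselect (B (- m%:Z) y).
    apply: le_trans (_ : e1 * nc (hkernel t y) <= _).
      rewrite mulrC ler_wpM2r ?nc_ge0// ltW//; apply: mP.
      (* By the ultrametric inequality x - y stays in the same ball around x0 as x, so continuity at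
         the single point x0 serves for all nearby x, with no halving of the radius. *)
      rewrite addrAC; exact: BB.
    rewrite lerDl mulr_ge0//; last exact: tailf_ge0 hs _ _.
    by rewrite !mulr_ge0// ltW.
  apply: le_trans (_ : 2 * M * (C * t) * tailf q (- m%:Z) y <= _); last first.
    by rewrite lerDr mulr_ge0 ?nc_ge0// ltW.
  rewrite mulrC -mulrA ler_pM ?nc_ge0//; last exact: ktail.
  by rewrite mulr2n mulrDl mul1r; apply: le_trans (ncB _ _) _; exact: lerD.
rewrite RintegralD// J1 J2 -/T0.
apply: le_trans (_ : 2 * (e / 4 + e / 4) <= _); last first.
  by rewrite le_eqVlt; apply/orP; left; apply/eqP; field.
rewrite ler_wpM2l//; apply: lerD.
  apply: le_trans (_ : e1 * (C + 1) <= _).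
    by rewrite ler_wpM2l ?(ltW e10)//; apply: le_trans kC _; rewrite lerDl.
  by rewrite /e1 le_eqVlt; apply/orP; left; apply/eqP; field; rewrite lt0r_neq0// ltr_wpDl.
have -> : 2 * M * (C * t) * T0 = t * (8 * (M * C * T0)) / 4 by field.
rewrite ler_wpM2r//; apply: le_trans (_ : t * (8 * (M * C * T0) + 1) <= _).
  by rewrite ler_wpM2l ?(ltW t0)// lerDl.
by rewrite -ler_pdivlMr// ltW.
Qed.

(** At t = 0 the multiplier is 1 and g need not be integrable, so the initial value is put in by
    hand; continuity there is [heatU_initial]. *)
Definition heat_solution x t : R[i] := if 0 < t then heatU 0 t x else phi x.

Lemma heat_solution_gt0 x t : 0 < t -> heat_solution x t = heatU 0 t x.
Proof. by rewrite /heat_solution => ->. Qed.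

Lemma heat_solution_continuous x0 t0 e : 0 <= t0 -> 0 < e -> exists m, exists2 dl : R, 0 < dl &
  forall x t, B (- m%:Z) (x - x0) -> `|t - t0| < dl -> 0 <= t ->
    nc (heat_solution x t - heat_solution x0 t0) < e.
Proof.
move=> t00 e0; have e2 : 0 < e / 2 by rewrite divr_gt0.
have [t0p|] := ltP 0 t0.
  have [L L0 LP] := heatU_lipschitz 0 t0p.
  have L1 : 0 < L + 1 by rewrite ltr_wpDl.
  have [m mP] := FT_vcont false (cintegrable_hm 0 t0p) x0 e2.
  exists m, (Num.min (t0 / 2) (e / 2 / (L + 1))).
    by rewrite lt_min !divr_gt0.
  move=> x t xm; rewrite lt_min => /andP[ta tb] _.
  have tp := half_shift_gt0 t0p (ltW ta).
  rewrite !heat_solution_gt0//.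
  apply: le_lt_trans (nc_triangle (heatU 0 t0 x) _ _) _.
  rewrite [e]splitr; apply: ler_ltD; last exact: mP.
  apply: le_trans (LP t x (ltW ta)) _.
  apply: le_trans (_ : `|t - t0| * (L + 1) <= _).
    by rewrite mulrC ler_wpM2l// lerDl.
  by rewrite -ler_pdivlMr// ltW.
move=> t0n; have -> : t0 = 0 by apply/eqP; rewrite eq_le t0n.
have [m [d d0 dP]] := heatU_initial x0 e2.
have [k kP] := phi_vcont x0 e0.
exists (m + k)%N, d => // x t xm; rewrite subr0 => td t1.
rewrite {2}/heat_solution ltxx /heat_solution; case: ifP => [tp|_].
  apply: le_lt_trans (dP x t _ tp _) _.
  - by apply: B_le xm; rewrite lerN2 lez_nat leq_addr.
  - by rewrite -(ger0_norm t1).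
  - by rewrite ltr_pdivrMr// ltr_pMr// ltr1n.
by apply: kP; apply: B_le xm; rewrite lerN2 lez_nat leq_addl.
Qed.
End Solution.

(** * Comparison of [Xi] with the symbol *)

Section Weights.
Context (R : realType) (p : nat) (p_pr : prime p) (n : nat).
Local Notation K := (Qp p_pr).
Local Notation V := ('rV[K]_n).
Local Notation P := (p%:R : R).
Implicit Types (x : V) (t : R) (m N : nat).
Variables (sigma : V -> R) (c alpha : R) (l d : nat).
Hypothesis alpha_gt0 : 0 < alpha.
Hypothesis hs : homogeneous_symbol sigma c ((P `^ alpha) ^+ d) l.
Local Notation heat := (heat sigma).

(** On the sphere of radius p^j, p^(jd) = (q^j)^(1/alpha) <= (sigma / c)^(1/alpha). Adding 1 makes
    the base at least 1, so the exponent may be raised to an integer N >= 1/alpha. *)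
Lemma Xi_symbol_le : exists N, forall x, Xi R d x <= n%:R * (1 + sigma x / c) ^+ N.
Proof.
have P0 := PR_gt0 R p_pr; have a0 : 0 <= alpha^-1 by rewrite invr_ge0 ltW.
have c0 := hs_c_gt0 hs.
exists (Num.bound alpha^-1) => x.
have s0 : 0 <= sigma x / c by rewrite divr_ge0 ?(ltW c0)//; exact: symbol_ge0 hs x.
have y1 : 1 <= 1 + sigma x / c by rewrite lerDl.
have [x0|x0] := eqVneq x 0.
  have B00 : B 0 x by rewrite x0; exact: B0.
  apply: le_trans (Xi_level_le R d B00) _.
  by rewrite mul0r expr0z ler_wpM2l// exprn_ege1.
have [j [xj xj1]] := B_level x0.
apply: le_trans (Xi_level_le R d xj) _; rewrite ler_wpM2l//.
have z0 : 0 < P ^ (j * d%:Z) by rewrite exprz_gt0.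
have -> : P ^ (j * d%:Z) = (((P `^ alpha) ^+ d) ^ j) `^ alpha^-1.
  have -> : ((P `^ alpha) ^+ d) ^ j = (P ^ (j * d%:Z)) `^ alpha.
    rewrite (powR_pz p_pr alpha (j * d%:Z)). by rewrite exprnP exprz_exp mulrC.
  by rewrite -powRrM mulfV ?lt0r_neq0// powRr1// ltW.
rewrite -(powR_mulrn _ (le_trans ler01 y1)).
apply: le_trans (_ : (1 + sigma x / c) `^ alpha^-1 <= _).
  apply: ge0_ler_powR; rewrite ?nnegrE ?(le_trans ler01 y1)//.
    by rewrite exprz_ge0// exprn_ge0// powR_ge0.
  apply: le_trans (_ : sigma x / c <= _); last by rewrite lerDr.
  by rewrite ler_pdivlMr// mulrC; exact: (hs_lower hs).
by apply: ler_powR => //; rewrite ltW// archi_boundP.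
Qed.

Lemma Xi_weight_heat_le (beta : nat) t : 0 < t ->
  exists C : R, forall x, Xi_weight d beta%:R x * heat t x ^+ 2 <= C.
Proof.
move=> t0; have [N NP] := Xi_symbol_le; have c0 := hs_c_gt0 hs.
pose m := (N * (2 * beta))%N.
have tc0 : 0 < t * c by rewrite mulr_gt0.
exists (n%:R ^+ (2 * beta) * (m`!%:R / (t * c) ^+ m * expR (t * c))) => x.
have s0 : 0 <= sigma x / c by rewrite divr_ge0 ?(ltW c0)//; exact: symbol_ge0 hs x.
have h0 := heat_gt0 sigma t x.
have -> : Xi_weight d beta%:R x = Xi R d x ^+ (2 * beta).
  by rewrite /Xi_weight -natrM powR_mulrn// Xi_ge0.
apply: le_trans (_ : (n%:R * (1 + sigma x / c) ^+ N) ^+ (2 * beta) * heat t x ^+ 2 <= _).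
  rewrite ler_wpM2r ?sqr_ge0// lerXn2r ?nnegrE ?Xi_ge0 ?mulr_ge0 ?exprn_ge0//.
  by rewrite addr_ge0.
rewrite exprMn -exprM -/m -[leLHS]mulrA ler_wpM2l ?exprn_ge0//.
(* This number equals t c + t sigma, so y^m <= m! e^y costs exactly one of the two factors e^(-t
   sigma); the other is at most 1. *)
have y0 : 0 <= t * c * (1 + sigma x / c) by rewrite mulr_ge0 ?addr_ge0// ltW.
have := pow_le_expR m y0; rewrite exprMn.
have -> : t * c * (1 + sigma x / c) = t * c + t * sigma x by field; rewrite lt0r_neq0.
rewrite -ler_pdivlMl ?exprn_gt0// => yle.
apply: le_trans (ler_wpM2r (sqr_ge0 _) yle) _.
rewrite expRD expr2 /heat.
have e1 : expR (t * sigma x) * expR (- t * sigma x) = 1.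
  by rewrite -expRD mulNr subrr expR0.
have -> : ((t * c) ^+ m)^-1 * (m`!%:R * (expR (t * c) * expR (t * sigma x))) *
   (expR (- t * sigma x) * expR (- t * sigma x)) =
   m`!%:R / (t * c) ^+ m * expR (t * c) * ((expR (t * sigma x) * expR (- t * sigma x)) * expR (- t * sigma x)).
  by ring.
rewrite e1 mul1r ler_piMr//.
  by rewrite !mulr_ge0 ?invr_ge0 ?exprn_ge0 ?expR_ge0 ?(ltW tc0).
by apply: (heat_le1 hs); exact: ltW.
Qed.

End Weights.

(** * Membership in the spaces [Htilde] *)

Section Sobolev.
Context (R : realType) (p : nat) (p_pr : prime p) (n : nat).
Local Notation K := (Qp p_pr).
Local Notation V := ('rV[K]_n).
Local Notation VB := (QpnBorel p_pr n).
Local Notation nc := (@Normc.normc R).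
Variable mu : {measure set VB -> \bar R}.
Hypothesis mu_haar : normalized_haar mu.
Hypothesis n_gt0 : (0 < n)%N.
Local Notation FT := (FT mu).
Local Notation N2 f := (wnorm2 mu (fun=> 1%R) (f : VB -> R[i])).
Variables (u : V -> R) (l : nat) (C : R) (w : V -> R).
Hypothesis ul : symbol_mult l u.
Hypothesis mu_ : measurable_fun [set: VB] (u : VB -> R).
Variables (g : V -> R[i]) (s : nat -> V -> R[i]).
Hypothesis s_step : forall k, exists r, step r (s k).
Hypothesis g_L2 : in_L2 mu (g : VB -> R[i]).
Hypothesis g_lim : forall e : R, 0 < e -> exists N, forall k, (N <= k)%N ->
    (N2 (fun x => (FT true (s k) x - g x)%R) <= e%:E)%E.

(** By inversion the transform is [mult_step] itself, which vanishes at 0 since truncation removes a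
    ball around the origin. *)
Lemma Phi_mult_step k : Phi mu (FT false (mult_step mu s u k)).
Proof.
have [r rk] := step_mult_step mu_haar n_gt0 s_step ul k; split.
  exact: step_schwartz_bruhat (step_FT mu_haar false rk).
rewrite fourier_FT (FT_FT mu_haar false rk).
by rewrite /mult_step level_trunc0 mul0r.
Qed.

Hypothesis mw : measurable_fun [set: VB] (w : VB -> R).
Hypothesis w0 : forall x, 0 <= w x.
Hypothesis wC : forall x, w x * u x ^+ 2 <= C.

Lemma in_wL2_mult : in_wL2 mu (w : VB -> R) ((fun x => (u x)%:C * g x) : VB -> R[i]).
Proof.
have mg := g_L2.1; have C0 : 0 <= C by apply: le_trans (wC 0); rewrite mulr_ge0 ?sqr_ge0.
have mug : cmeasurable ((fun x => (u x)%:C * g x) : VB -> R[i]).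
  by apply: cmeasurableM mg; exact: cmeasurable_real.
split=> //; have [ji J] := Rintegral_Zr C (in_L2_rintegrable g_L2).
apply: le_lt_trans (_ : (\int[mu]_x (C * nc (g x) ^+ 2)%:E)%E < _)%E; last first.
  by rewrite (Rint_EFin ji) ltry.
apply: ge0_le_integral => //.
- by move=> x _; rewrite lee_fin mulr_ge0 ?sqr_ge0.
- by apply/measurable_EFinP; exact: measurable_wnc2.
- by apply/measurable_EFinP; apply: measurable_funM => //; exact: measurable_nc2.
- move=> x _; rewrite lee_fin ncM exprMn mulrA ler_wpM2r ?sqr_ge0//.
  by rewrite nc_real real_normK ?num_real.
Qed.

Lemma wL2_cvg_mult_step : wL2_cvg mu (w : VB -> R)
  (fun k => fourier mu (FT false (mult_step mu s u k))) (fun x => (u x)%:C * g x).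
Proof.
have mS k : cmeasurable (FT true (s k) : VB -> R[i]).
  by have [r /(step_FT mu_haar true)/step_cmeasurable] := s_step k.
have E k : fourier mu (FT false (mult_step mu s u k)) = mult_step mu s u k.
  have [r rk] := step_mult_step mu_haar n_gt0 s_step ul k.
  by apply/funext => x; rewrite fourier_FT (FT_FT mu_haar false rk).
rewrite /wL2_cvg; apply/ge0_cvge0P => [k|e e0]; first exact: wnorm2_ge0.
have [N NP] := multiplier_cvg mu_haar n_gt0 ul mu_ mS g_L2 g_lim mw w0 wC e0.
by exists N => k Nk; rewrite E; exact: NP.
Qed.
End Sobolev.

Lemma complex_gt0P (R : realType) (e : R[i]) : 0 < e -> exists2 r : R, 0 < r & e = r%:C.
Proof.
case: e => a b; rewrite ltcE /= => /andP[/eqP b0 a0].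
by exists a => //; rewrite b0.
Qed.

Lemma t_derivative_bound (R : realType) (v : R -> R[i]) (t : R) (z : R[i]) (L dl : R) :
  0 <= L -> 0 < dl ->
  (forall h : R, h != 0 -> `|h| <= dl ->
    Normc.normc ((h^-1)%:C * (v (t + h) - v t) - z) <= L * `|h|) ->
  t_derivative v t z.
Proof.
move=> L0 dl0 H; apply/cvgrPdist_lt => e /complex_gt0P[r r0 ->].
have L1 : 0 < L + 1 by rewrite ltr_wpDl.
near=> h; rewrite normCE ltcR ncBC.
have h0 : h != 0 by near: h; exact: nbhs_dnbhs_neq.
have hd : `|h| < dl by near: h; exact: dnbhs0_lt.
have hr : `|h| < r / (L + 1) by near: h; apply: dnbhs0_lt; rewrite divr_gt0.
apply: le_lt_trans (H h h0 (ltW hd)) _.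
apply: le_lt_trans (_ : (L + 1) * `|h| < _); first by rewrite ler_wpM2r// lerDl.
by rewrite mulrC -ltr_pdivlMr.
Unshelve. all: by end_near.
Qed.

Lemma lipschitz_continuous_at (R : realType) (v : R -> R[i]) (t L dl : R) : 0 <= L -> 0 < dl ->
  (forall t' : R, `|t' - t| <= dl -> Normc.normc (v t' - v t) <= L * `|t' - t|) ->
  {for t, continuous v}.
Proof.
move=> L0 dl0 H; apply/cvgrPdist_lt => e /complex_gt0P[r r0 ->].
have L1 : 0 < L + 1 by rewrite ltr_wpDl.
have m0 : 0 < Num.min dl (r / (L + 1)) by rewrite lt_min dl0 divr_gt0.
have := @cvgr_dist_lt _ _ _ _ (nbhs_filter t) id t (fun A => id) _ m0.
apply: filterS => t'; rewrite distrC lt_min => /andP[ta tb].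
rewrite normCE ltcR ncBC; apply: le_lt_trans (H t' (ltW ta)) _.
apply: le_lt_trans (_ : (L + 1) * `|t' - t| < _); first by rewrite ler_wpM2r// lerDl.
by rewrite mulrC -ltr_pdivlMr.
Qed.

(** The two integrability assertions belong to the conclusion because [cintegral] is total: they
    guarantee that the formulas for Z and u are genuine integrals. *)
Theorem theorem6p9 (R : realType) (p : nat) (p_pr : prime p) (n d : nat)
    (mu : {measure set (QpnBorel p_pr n) -> \bar R}) (mu_haar : normalized_haar mu)
    (f : mpoly.mpoly n (Qp p_pr)) (f_Zp : Zp_coefs f) (f_elliptic : elliptic f d)
    (alpha : R) (alpha_gt0 : 0 < alpha)
    (phi : 'rV[Qp p_pr]_n -> R[i])
    (phi_L2 : in_L2 mu phi) (phi_cont : continuous phi) (phi_bounded : cbounded phi) :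
  (forall x (t : R), 0 < t -> cintegrable mu (heat_integrand f alpha x t)) /\
  exists u : 'rV[Qp p_pr]_n -> R -> R[i],
    [/\ classical_solution mu f alpha phi u,
        forall x (t : R), 0 < t ->
          cintegrable mu (fun eta => heat_kernel mu f alpha eta t * phi (x - eta)) /\
          u x t = cintegral mu (fun eta => heat_kernel mu f alpha eta t * phi (x - eta))
      & forall t : R, 0 < t -> Htilde_oo mu d (u^~ t)].
Proof.
have n_gt0 := elliptic_dim_gt0 f_elliptic.
have [c [l hs]] := elliptic_symbol f_Zp f_elliptic alpha_gt0.
have phi_vc := continuous_vcont phi_cont.
have [M phi_le] := phi_bounded.
have [s [s_step s_le s_cvg s_lim]] := step_approximation mu_haar n_gt0 phi_L2 phi_vc phi_le.
have [g gL2 g_lim] := fourier_limit mu_haar phi_L2.1 s_step s_lim.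
set sigma := symbol f alpha in hs *.
have integrandE x t xi : heat_integrand f alpha x t xi = chr R false x xi * (heat sigma t xi)%:C.
  by rewrite chr_false.
have kernelE t : (fun eta => heat_kernel mu f alpha eta t) = hkernel mu sigma t.
  apply/funext => x; rewrite /heat_kernel /hkernel /FT.
  by apply: eq_cintegral => xi; exact: integrandE.
have convE x t y : heat_kernel mu f alpha y t * phi (x - y) = hkernel mu sigma t y * phi (x - y).
  by rewrite -kernelE.
split=> [x t t0|].
  have -> : heat_integrand f alpha x t = (fun xi => chr R false x xi * (heat sigma t xi)%:C).
    by apply/funext => xi; exact: integrandE.
  exact: cintegrable_chr (cintegrable_heat mu_haar hs t0).
have uE t : 0 < t -> (heat_solution mu sigma phi g)^~ t = heatU mu sigma g 0 t.
  by move=> t0; apply/funext => x; exact: heat_solution_gt0.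
(* Applying f(D, alpha) raises the index of the multiplier from 0 to 1; domain and equation both
   come down to this. *)
have mult1 t : (fun xi => (symbol f alpha xi)%:C * ((heat_mult sigma 0 t xi)%:C * g xi)) =
    (fun xi => (heat_mult sigma 1 t xi)%:C * g xi).
  apply/funext => xi; rewrite mulrA -rmorphM; congr (_%:C * _).
  by rewrite /heat_mult expr0 mul1r expr1.
have FU i t t0 := @fourierL2_heatU _ _ _ _ _ mu_haar n_gt0 _ _ _ _ hs _ _ s_step gL2 g_lim i t t0.
exists (heat_solution mu sigma phi g); split; first split.
- apply/subspace_continuousP => -[x0 t0] /= t00.
  apply/cvgrPdist_lt => e /complex_gt0P[r r0 ->].
  have [m [dl dl0 H]] := heat_solution_continuous mu_haar n_gt0 hs phi_vc phi_le s_step s_le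
    s_cvg gL2 g_lim x0 t00 r0.
  exists ([set x | B (- m%:Z) (x - x0)], [set t : R | `|t - t0| < dl]).
    split=> /=; first by apply/nbhsVP; exists m.
    by apply/nbhs_ballP; exists dl => // t; rewrite /ball/= distrC.
  move=> [x t] /= [xm td] t1.
  by rewrite normCE ltcR ncBC; exact: H.
- by move=> x; rewrite /heat_solution ltxx.
- move=> t t0; rewrite uE//; exists (fun xi => (heat_mult sigma 0 t xi)%:C * g xi).
    exact: FU.
  rewrite mult1; apply: (in_L2_bddM gL2 (measurable_heat_mult hs 1 t)) => xi.
  exact: (hm_abs_le hs).
- exists (fun x t => - heatU mu sigma g 1 t x); split=> x.
  + move=> t t0; have [L L0 H] := heatU_taylor mu_haar hs gL2 t0.
    apply: (t_derivative_bound L0 (dl := t / 2)); first by rewrite divr_gt0.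
    move=> h h0 ht; rewrite opprK !heat_solution_gt0//; first exact: H.
    by apply: half_shift_gt0 t0 _; rewrite [t + h]addrC addrK.
  + move=> t t0; have [L L0 H] := heatU_lipschitz mu_haar hs gL2 1 t0.
    apply: (lipschitz_continuous_at L0 (dl := t / 2)); first by rewrite divr_gt0.
    move=> t' tt'; rewrite -opprD ncN; exact: H.
  + move=> t0; rewrite uE//; exists (heatU mu sigma g 1 x); last by move=> y; rewrite addNr.
    exists (fun xi => (heat_mult sigma 0 x xi)%:C * g xi); first exact: FU.
    by rewrite mult1; exact: FU.
- move=> x t t0.
  have E : (fun y => heat_kernel mu f alpha y t * phi (x - y)) =
      (fun y => hkernel mu sigma t y * phi (x - y)).
    by apply: funext => y; exact: convE.
  split.
    apply: (eq_rect_r (fun F => cintegrable mu F) _ E).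
    exact: (cintegrable_convolution mu_haar hs x t0 phi_vc phi_le).
  apply: etrans (heat_solution_gt0 mu sigma phi g x t0) _.
  apply: etrans (congr1 (cintegral mu) (esym E)); apply: esym.
  exact: (heat_convolution mu_haar n_gt0 hs phi_vc phi_le s_step s_le s_cvg gL2 g_lim x t0).
- move=> t t0; rewrite uE//; exists (fun xi => (heat_mult sigma 0 t xi)%:C * g xi); first exact: FU.
  move=> beta; have [C CP] := Xi_weight_heat_le alpha_gt0 hs beta t0.
  (* This bound lets the L^2 convergence to g control the weighted norm of exponent beta, for each
     beta separately. *)
  have wC x : Xi_weight d beta%:R x * heat_mult sigma 0 t x ^+ 2 <= C.
    by rewrite /heat_mult expr0 mul1r; exact: CP.
  have mw := @measurable_Xi_weight R p p_pr n d beta%:R.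
  have w0 x : 0 <= @Xi_weight R p p_pr n d beta%:R x by exact: powR_ge0.
  have mm := measurable_heat_mult hs 0 t.
  have ml := symbol_mult_heat_mult hs 0 t.
  split; first exact: (in_wL2_mult mm gL2 mw w0 wC).
  exists (fun k => FT mu false (mult_step mu s (heat_mult sigma 0 t) k)); split.
    by move=> k; exact: (Phi_mult_step mu_haar n_gt0 ml s_step).
  exact: (wL2_cvg_mult_step mu_haar n_gt0 ml mm s_step gL2 g_lim mw w0 wC).
Qed.
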